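(* Let $\chi$ be a stationary, ergodic and square integrable point process on $\mathbb{R}^d$. Let $\widetilde{P}$ be its Palm measure and let $I(\widetilde{P})$ be the intensity of that measure. For $R>0$ let $$\gamma_R:=\frac{1}{|B_R|}\sum_{x,y\in\chi\cap B_R}\delta_{y-x}.$$ Then $I(\widetilde{P})$ is locally finite, and for each bounded Borel set $C\subset\mathbb{R}^d$ we have $$\lim_{R\to\infty}\gamma_R(C)=I(\widetilde{P})(C)\quad\text{almost everywhere (a.e.)}.$$ In particular, almost everywhere, $\gamma_R$ converges to $I(\widetilde{P})$ in the vague topology as $R\to\infty$.
   Context: $\delta_x$ is the Dirac measure at $x$, $|\cdot|$ is Lebesgue measure on $\mathbb{R}^d$, and $B_R$ is the ball of radius $R$ centered at $0$. $\mathcal{M}_\sigma(\mathbb{R}^d)$ is the set of locally finite subsets of $\mathbb{R}^d$, endowed with the $\sigma$-algebra $\mathcal{A}$ generated by the maps $N_A:\phi\mapsto\mathrm{card}(A\cap\phi)$, $A$ a bounded Borel set. A point process $\chi$ on $\mathbb{R}^d$ is a measurable map from a probability space to $(\mathcal{M}_\sigma(\mathbb{R}^d),\mathcal{A})$; equipping $(\mathcal{M}_\sigma(\mathbb{R}^d),\mathcal{A})$ with the law of $\chi$, one may take $\chi$ to be the identity map. It is integrable (resp. square integrable) if the random variables $N_A$ are integrable (resp. square integrable) for every compact $A$. For $t\in\mathbb{R}^d$, $T_t$ is the translation $T_t(\phi)=\phi-t$ of $\mathcal{M}_\sigma(\mathbb{R}^d)$. The process is stationary if its law is invariant under $(T_t)_{t\in\mathbb{R}^d}$,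 and ergodic if its law is ergodic for this action. The Palm measure of a stationary integrable point process $\chi$ is the measure on $(\mathcal{M}_\sigma(\mathbb{R}^d),\mathcal{A})$ defined by $$\widetilde{P}(F):=\frac{1}{|B|}\,E\sum_{x\in\chi\cap B}1_F(\chi-x),\quad F\in\mathcal{A},$$ where $B\subset\mathbb{R}^d$ is a Borel set with $0<|B|<\infty$ (the definition does not depend on $B$). The intensity of a measure $m$ on $(\mathcal{M}_\sigma(\mathbb{R}^d),\mathcal{A})$ is the measure $I(m)$ on $\mathbb{R}^d$ given by $I(m)(A)=\int\mathrm{card}(\phi\cap A)\,dm(\phi)$ for Borel $A$. *)

(* Defs.v *)
From HB Require Import structures.
From mathcomp Require Import all_boot all_order all_algebra.
From mathcomp Require Import all_classical all_reals all_analysis.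
From mathcomp Require Import measurable_realfun.

Set Implicit Arguments.
Unset Strict Implicit.
Unset Printing Implicit Defensive.

Import Order.TTheory GRing.Theory Num.Theory.
Import numFieldNormedType.Exports.

Local Open Scope classical_set_scope.
Local Open Scope ring_scope.

HB.instance Definition _ (R : realType) (n : nat) :=
  @isMeasurable.Build (sigma_display (@open 'rV[R]_n)) 'rV[R]_n
    <<s @open 'rV[R]_n >>
    (@sigma_algebra0 _ setT _) (@sigma_algebraC 'rV[R]_n _)
    (@sigma_algebra_bigcup _ setT _).

Section rV_borel.
Context {R : realType}.

Lemma rV_open_measurable n (U : set 'rV[R]_n) : open U -> measurable U.
Proof. exact: sub_sigma_algebra. Qed.

Lemma rV_continuous_measurable n m (f : 'rV[R]_n -> 'rV[R]_m) :
  continuous f -> measurable_fun setT f.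
Proof.
move=> cf; apply: (measurability (@open 'rV[R]_m)) => //.
move=> _ [U oU <-]; rewrite setTI; apply: rV_open_measurable.
by move/continuousP : cf; exact.
Qed.

Lemma rV_coord_measurable n (i : 'I_n) :
  measurable_fun setT (fun v : 'rV[R]_n => v ord0 i).
Proof.
apply: (measurability _ (RGenOpens.measurableE R)) => //.
move=> _ [_ [a [b ->] <-]]; rewrite setTI; apply: rV_open_measurable.
have /continuousP := @coord_continuous R 1 n ord0 i.
by apply; exact: interval_open.
Qed.

Lemma rV_measurable_funP d (T : measurableType d) n (f : T -> 'rV[R]_n) :
  measurable_fun setT f <->
  forall i, measurable_fun setT (fun t => f t ord0 i).
Proof.
split=> [mf i|mf].
  exact: (measurableT_comp (rV_coord_measurable i)).
apply: (measurability (@open 'rV[R]_n)) => //.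
move=> _ [U oU <-]; rewrite setTI.
pose c (p : 'rV[rat]_n * nat) : set 'rV[R]_n :=
  ball (map_mx (@ratr R) p.1) p.2.+1%:R^-1.
have UE : U = \bigcup_p (if `[< c p `<=` U >] then c p else set0).
  apply/seteqP; split=> [v Uv|v [p _]]; last by case: asboolP => // + ?; exact.
  have /nbhs_ballP[e /= e0 eU] : nbhs v U by exact: open_nbhs_nbhs.
  have [k ke] : exists k : nat, k.+1%:R^-1 < e / 2.
    have /ltr_add_invr[k] : 0 < e / 2 by rewrite divr_gt0.
    by rewrite add0r; exists k.
  have k0 : 0 < k.+1%:R^-1 :> R by rewrite invr_gt0.
  have /choice[q qP] (i : 'I_n) : exists q : rat,
      `|v ord0 i - ratr q| < k.+1%:R^-1.
    have : v ord0 i - k.+1%:R^-1 < v ord0 i + k.+1%:R^-1.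
      by rewrite ltrD2l gtrN.
    move=> /rat_in_itvoo[q].
    by rewrite in_itv/= -ltr_distlC => ?; exists q.
  have vc : c (\row_i q i, k) v.
    by split=> // i j; rewrite /ball/= !mxE ord1 distrC.
  exists (\row_i q i, k) => //; case: asboolP => // -[] w [_ cw].
  apply: eU; split => // i j; rewrite /ball/= (splitr e).
  have -> : v i j - w i j = (v i j - ratr (q j)) + (ratr (q j) - w i j).
    by rewrite addrA subrK.
  apply: (le_lt_trans (ler_normD _ _)); apply: ltrD.
    by rewrite (lt_trans _ ke)// ord1.
  by have := cw i j; rewrite /ball/= !mxE => /lt_trans; apply.
rewrite UE preimage_bigcup; apply: countable_bigcupT_measurable => // -[q k].
case: asboolP => _; last by rewrite preimage_set0.
have -> : f @^-1` c (q, k) = \bigcap_(i in [set: 'I_n])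
    ((fun t => f t ord0 i) @^-1` ball (ratr (q ord0 i) : R) k.+1%:R^-1).
  apply/seteqP; split=> [t [_ ct] i _|t ct].
    by have := ct ord0 i; rewrite /= mxE.
  split=> [|i j]; first by rewrite invr_gt0.
  by rewrite ord1 mxE; exact: ct.
apply: fin_bigcap_measurable => // i _; rewrite -[X in measurable X]setTI.
by apply: mf => //; exact: measurable_ball.
Qed.
End rV_borel.

Section lebesgue_rV.
Context {R : realType}.

Definition cons_rV n (p : measurableTypeR R * 'rV[R]_n) : 'rV[R]_n.+1 :=
  \row_i oapp (p.2 ord0) p.1 (unlift ord0 i).

Definition uncons_rV n (v : 'rV[R]_n.+1) : measurableTypeR R * 'rV[R]_n :=
  (v ord0 ord0, \row_i v ord0 (lift ord0 i)).

Lemma cons_rVK n : cancel (@cons_rV n) (@uncons_rV n).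
Proof.
move=> [x v]; congr (_, _); first by rewrite mxE unlift_none.
by apply/rowP => i; rewrite !mxE liftK.
Qed.

Lemma uncons_rVK n : cancel (@uncons_rV n) (@cons_rV n).
Proof.
by move=> v; apply/rowP => i; rewrite mxE; case: unliftP => [j|] -> //=; rewrite mxE.
Qed.

Lemma measurable_cons_rV n : measurable_fun setT (@cons_rV n).
Proof.
apply/rV_measurable_funP => i.
under eq_fun do rewrite mxE.
case: unliftP => [j|] _ /=; last exact: measurable_fst.
exact: (measurableT_comp (rV_coord_measurable j) measurable_snd).
Qed.

Lemma measurable_uncons_rV n : measurable_fun setT (@uncons_rV n).
Proof.
apply/measurable_fun_pairP; split; first exact: rV_coord_measurable.
apply/rV_measurable_funP => i; rewrite /comp/=.
under eq_fun do rewrite mxE.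
exact: rV_coord_measurable.
Qed.

HB.instance Definition _ n :=
  isMeasurableFun.Build _ _ _ _ (@cons_rV n) (@measurable_cons_rV n).

Section step.
Variables (n : nat) (mu : {sigma_finite_measure set 'rV[R]_n -> \bar R}).

Definition lebesgue_rV_step : set 'rV[R]_n.+1 -> \bar R :=
  pushforward (@lebesgue_measure R \x mu)%E (@cons_rV n).

Let step0 : lebesgue_rV_step set0 = 0%E.
Proof. by rewrite /lebesgue_rV_step /pushforward preimage_set0 measure0. Qed.

Let step_ge0 A : (0 <= lebesgue_rV_step A)%E.
Proof. by rewrite /lebesgue_rV_step /pushforward. Qed.

Let step_sigma_additive : semi_sigma_additive lebesgue_rV_step.
Proof.
have mf A : measurable A -> measurable (@cons_rV n @^-1` A).
  by move=> mA; rewrite -[X in measurable X]setTI; exact: measurable_cons_rV.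
move=> F mF tF mUF; rewrite /lebesgue_rV_step /pushforward preimage_bigcup.
apply: measure_semi_sigma_additive => [k||].
- exact: mf.
- apply/trivIsetP => /= i j _ _ ij; rewrite -preimage_setI.
  by move/trivIsetP : tF => /(_ _ _ _ _ ij) ->//; rewrite preimage_set0.
- by rewrite -preimage_bigcup; exact: mf.
Qed.

HB.instance Definition _ := isMeasure.Build _ _ _ lebesgue_rV_step
  step0 step_ge0 step_sigma_additive.

Let step_sigma_finite : sigma_finite setT lebesgue_rV_step.
Proof.
have /sigma_finiteP[F [FT ndF Foo]] := sigma_finiteT (@lebesgue_measure R).
have /sigma_finiteP[G [GT ndG Goo]] := sigma_finiteT mu.
exists (fun k => @uncons_rV n @^-1` (F k `*` G k)).
  rewrite -preimage_bigcup -(@preimage_setT _ _ (@uncons_rV n)); congr (_ @^-1` _).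
  apply/esym; rewrite -subTset => -[x v] _.
  have [k _ Fkx] : (\bigcup_k F k) x by rewrite -FT.
  have [l _ Glv] : (\bigcup_k G k) v by rewrite -GT.
  exists (maxn k l) => //; split.
  - by move: x Fkx; exact/subsetPset/ndF/leq_maxl.
  - by move: v Glv; exact/subsetPset/ndG/leq_maxr.
move=> k; have [mFk Fk] := Foo k; have [mGk Gk] := Goo k; split.
  rewrite -[X in measurable X]setTI; apply: measurable_uncons_rV => //.
  exact: measurableX.
rewrite /lebesgue_rV_step /pushforward -comp_preimage.
rewrite (_ : _ \o _ = id); last by apply/funext => p /=; rewrite cons_rVK.
by rewrite preimage_id product_measure1E// lte_mul_pinfty// ge0_fin_numE.
Qed.

HB.instance Definition _ := Measure_isSigmaFinite.Build _ _ _ lebesgue_rV_step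
  step_sigma_finite.
End step.

Fixpoint lebesgue_rV n : {sigma_finite_measure set 'rV[R]_n -> \bar R} :=
  match n return {sigma_finite_measure set 'rV[R]_n -> \bar R} with
  | 0 => dirac (0 : 'rV[R]_0)
  | n'.+1 => lebesgue_rV_step (lebesgue_rV n')
  end.

Lemma lebesgue_rV_box n (a b : 'rV[R]_n) : (forall i, a ord0 i <= b ord0 i) ->
  lebesgue_rV n [set v : 'rV[R]_n | forall i, a ord0 i <= v ord0 i <= b ord0 i] =
  (\prod_i (b ord0 i - a ord0 i))%:E.
Proof.
elim: n a b => [|n IH] a b ab.
  by rewrite big_ord0 /= diracE mem_set// => -[].
rewrite /= /lebesgue_rV_step /pushforward.
have -> : @cons_rV n @^-1` [set v : 'rV[R]_n.+1 | forall i, a ord0 i <= v ord0 i <= b ord0 i] =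
    (`[a ord0 ord0, b ord0 ord0] `*`
    [set v : 'rV[R]_n | forall i, (uncons_rV a).2 ord0 i <= v ord0 i
                       <= (uncons_rV b).2 ord0 i]).
  apply/seteqP; split=> -[x v] /=.
    move=> abv; split.
      by rewrite in_itv/=; have := abv ord0; rewrite mxE unlift_none.
    by move=> i; have := abv (lift ord0 i); rewrite !mxE liftK.
  move=> [+ abv] i; rewrite in_itv/= mxE; case: unliftP => [j|] -> //= _.
  by have := abv j; rewrite !mxE.
rewrite product_measure1E//; last first.
  rewrite (_ : [set v | _] = \bigcap_(i in [set: 'I_n])
      ((fun v : 'rV[R]_n => v ord0 i) @^-1`
       `[(uncons_rV a).2 ord0 i, (uncons_rV b).2 ord0 i])); last first.
    apply/seteqP; split=> v.
      by move=> abv i _; rewrite /= in_itv/=; exact: abv.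
    by move=> abv i; have := abv i Logic.I; rewrite /= in_itv.
  apply: fin_bigcap_measurable => // i _; rewrite -[X in measurable X]setTI.
  exact: rV_coord_measurable.
have L : lebesgue_measure `[a ord0 ord0, b ord0 ord0]%classic =
    (b ord0 ord0 - a ord0 ord0)%:E.
  rewrite lebesgue_measure_itv/= lte_fin; case: ltP => [_|ba]; first by rewrite EFinD.
  rewrite (_ : b ord0 ord0 = a ord0 ord0) ?subrr//.
  by apply/le_anti; rewrite ba ab.
apply: etrans (congr2 mule L (IH _ _ _)) _ => [i|]; first by rewrite !mxE.
rewrite big_ord_recl -EFinM; congr (_ * _)%:E.
by apply: eq_bigr => i _; rewrite !mxE.
Qed.
End lebesgue_rV.

Section configurations.
Variables (R : realType) (d : nat).
Implicit Types (A B C : set 'rV[R]_d) (r : R).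

(* The library norm on 'rV[R]_d is the sup norm, hence this separate ball. *)
Definition eucl_ball r : set 'rV[R]_d :=
  [set v | Num.sqrt (\sum_i v ord0 i ^+ 2) < r].

Definition locally_finite_set A : Prop :=
  forall K : set 'rV[R]_d, compact K -> finite_set (A `&` K).

Record config := Config {
  points :> set 'rV[R]_d ;
  points_locally_finite : locally_finite_set points }.

HB.instance Definition _ := gen_eqMixin config.
HB.instance Definition _ := gen_choiceMixin config.

Lemma locally_finite_set0 : locally_finite_set set0.
Proof. by move=> K _; rewrite set0I. Qed.

HB.instance Definition _ := isPointed.Build config (Config locally_finite_set0).

Definition npoints A (phi : config) : \bar R := counting (phi `&` A).

Definition npoints_cylinder : set (set config) :=
  [set F | exists2 A : set 'rV[R]_d, measurable A /\ bounded_set A &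
           exists2 Y : set (\bar R), measurable Y & F = npoints A @^-1` Y].

HB.instance Definition _ :=
  @isMeasurable.Build (sigma_display npoints_cylinder) config
    <<s npoints_cylinder >>
    (@sigma_algebra0 _ setT _) (@sigma_algebraC config _)
    (@sigma_algebra_bigcup _ setT _).

Lemma translate_locally_finite (t : 'rV[R]_d) (phi : config) :
  locally_finite_set [set x - t | x in phi].
Proof.
move=> K cK.
have cKt : compact [set x + t | x in K].
  apply: continuous_compact => //; apply: continuous_subspaceT => x.
  have := @continuousD R 'rV[R]_d 'rV[R]_d id (cst t) x.
  by apply; [move=> ? /=|exact: cst_continuous].
apply: (@sub_finite_set _ _ [set x - t | x in phi `&` [set x + t | x in K]]).
  move=> _ [[x px <-] Kx]; exists x => //; split => //.
  by exists (x - t) => //; rewrite subrK.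
by apply: finite_image; exact: points_locally_finite.
Qed.

Definition translate (t : 'rV[R]_d) (phi : config) : config :=
  Config (@translate_locally_finite t phi).

Definition stationary (mu : probability config R) : Prop :=
  forall (t : 'rV[R]_d) (F : set config), measurable F ->
    mu (translate t @^-1` F) = mu F.

(* Invariance is literal equality of sets; since invariance up to null sets is
   not required of F, this is the weaker of the two usual hypotheses. *)
Definition ergodic (mu : probability config R) : Prop :=
  forall F : set config, measurable F ->
    (forall t : 'rV[R]_d, translate t @^-1` F = F) ->
    mu F = 0%E \/ mu F = 1%E.

Definition locally_finite_measure (m : set 'rV[R]_d -> \bar R) : Prop :=
  forall K : set 'rV[R]_d, compact K -> (m K < +oo)%E.

(* The library integral accepts a bare set function, of which it only reads the
   values on measurable sets; m is therefore not a bundled measure here, nor are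
   [gamma] and [palm] below. *)
Definition intensity (m : set config -> \bar R) A : \bar R :=
  (\int[m]_phi npoints A phi)%E.

Definition gamma (phi : config) r C : \bar R :=
  ((fine (lebesgue_rV d (eucl_ball r)))^-1%:E *
   \esum_(xy in (phi `&` eucl_ball r) `*` (phi `&` eucl_ball r))
     \d_(xy.2 - xy.1)%R C)%E.

Definition vague_cvg (m : R -> set 'rV[R]_d -> \bar R) (F : set_system R)
    (m0 : set 'rV[R]_d -> \bar R) : Prop :=
  forall f : 'rV[R]_d -> R, continuous f ->
    compact (closure [set x | f x != 0]) ->
    (\int[m r]_x (f x)%:E)%E @[r --> F] --> (\int[m0]_x (f x)%:E)%E.

Section point_process.
Context {disp : measure_display} {Omega : measurableType disp}.
Variables (P : probability Omega R) (chi : {RV P >-> config}).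

Definition square_integrable : Prop :=
  forall K : set 'rV[R]_d, compact K ->
    P.-integrable setT (fun w => npoints K (chi w) ^+ 2)%E.

Definition palm B (F : set config) : \bar R :=
  ((fine (lebesgue_rV d B))^-1%:E *
   \int[P]_w \esum_(x in chi w `&` B) (\1_F (translate x (chi w)))%:E)%E.

End point_process.
End configurations.

(* Main.v *)
Require Import Defs.
From HB Require Import structures.
From mathcomp Require Import all_boot all_order all_algebra.
From mathcomp Require Import all_classical all_reals all_analysis.
From mathcomp Require Import measurable_realfun.
From mathcomp Require Import finmap lra ring zify.

Set Implicit Arguments.
Unset Strict Implicit.
Unset Printing Implicit Defensive.

Import Order.TTheory GRing.Theory Num.Theory.
Import numFieldNormedType.Exports.

Local Open Scope classical_set_scope.
Local Open Scope ring_scope.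

(* For a bounded window C, write w(phi) for the number of points of phi in C.
   The number of pairs in the ball of radius r lies between the weighted counts
   sum_{x in phi, |x| < s} w(phi - x) for s = r - rho and s = r, where rho bounds
   C.  This count is additive in the region, so after cutting space into unit
   cells it is a sum of f(phi - z) over the lattice points z of a ball, where f
   is the count over the unit cube; the mean of f is the Palm intensity of C
   by Campbell's formula.

   The lattice action need not be ergodic.  Still, moving a large box by t in R^d
   changes the sum over it by a boundary term only, so the limits of the lattice
   averages of a bounded f are R^d-invariant, hence constant.  Capping w
   makes f bounded and gives L^1 convergence (the averages form an L^2-norm
   minimizing, hence Cauchy, sequence); a Vitali-type maximal inequality for
   lattice boxes controls the error and upgrades this to almost sure convergence.

   Vague convergence only needs the countable family of the cells of the grids
   Z^d/j, since a compactly supported continuous function is a uniform limit of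
   step functions on them. *)

(** Square integrability yields an integrable pair count: the count over the unit cube is at most
    the square of the number of points in a larger ball. Before an L^2 argument can start, the cap
    has to bound the whole sum over the cube and not only each weight. Discarding the points with an
    overcrowded neighbourhood does this, and the weight remains a function of the configuration seen
    from the point, so counts stay additive and move along with the configuration.

    Ergodicity concerns literally invariant events. The limit is therefore never formed as a
    function modulo null sets; an event about the upper limit of concrete averages takes its place.

    The maximal inequality is about cubes, the averages about Euclidean balls of real radius. A ball
    lies in a cube of comparable volume and the controlled function is nonnegative, so one
    exceptional set serves all large radii at once. *)

Section rV_topology.
Context {R : realType} {d : nat}.
Implicit Types (A K : set 'rV[R]_d) (r : R).

Definition sup_ball r : set 'rV[R]_d := [set v | `|v| <= r].

Lemma rV_closed_measurable A : closed A -> measurable A.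
Proof.
by move=> cA; rewrite -(setCK A); apply: measurableC; apply: rV_open_measurable;
  rewrite openC.
Qed.

Lemma closed_sup_ball r : closed (sup_ball r).
Proof.
have -> : sup_ball r = (fun v : 'rV[R]_d => `|v|) @^-1` [set x | x <= r] by [].
apply: preimage_closed; last exact: closed_le.
by move=> x _; exact: norm_continuous.
Qed.

Lemma measurable_sup_ball r : measurable (sup_ball r).
Proof. by apply: rV_closed_measurable; exact: closed_sup_ball. Qed.

Lemma bounded_sup_ball r : bounded_set (sup_ball r).
Proof. by exists r; split; [exact: num_real|move=> M rM x xr; exact: le_trans xr (ltW rM)]. Qed.

Lemma compact_sup_ball r : compact (sup_ball r).
Proof. exact: bounded_closed_compact (@bounded_sup_ball r) (@closed_sup_ball r). Qed.

Lemma bounded_set_sub_sup_ball A : bounded_set A -> exists n : nat, A `<=` sup_ball n%:R.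
Proof.
move=> [M [_ MA]]; exists (Num.truncn `|M + 1|).+1 => x Ax.
apply: (MA _ _ x Ax); apply: (lt_le_trans _ (ltW (truncnS_gt _))).
by rewrite (lt_le_trans _ (ler_norm _))// ltrDl.
Qed.

Lemma bounded_subset A K : A `<=` K -> bounded_set K -> bounded_set A.
Proof. by move=> AK [M [Mr MK]]; exists M; split => // M' MM' x /AK; exact: MK. Qed.

Lemma compact_rV_measurable K : compact K -> measurable K.
Proof.
by move=> cK; apply: rV_closed_measurable; apply: compact_closed => //; exact: norm_hausdorff.
Qed.

Lemma rV_sub_measurable :
  measurable_fun setT (fun p : 'rV[R]_d * 'rV[R]_d => p.2 - p.1).
Proof.
apply/rV_measurable_funP => i; under eq_fun do rewrite !mxE.
by apply: measurable_funB; apply: (measurableT_comp (rV_coord_measurable i)).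
Qed.

Lemma rV_affine_measurable r (t : 'rV[R]_d) :
  measurable_fun setT (fun v : 'rV[R]_d => r *: v + t).
Proof.
apply/rV_measurable_funP => i; under eq_fun do rewrite !mxE.
by apply: measurable_funD => //; apply: measurable_funM => //; exact: rV_coord_measurable.
Qed.

End rV_topology.

(** * Configurations as measures *)

Section point_measure.
Context {R : realType} {d : nat}.
Implicit Types (A B K : set 'rV[R]_d) (r : R) (phi : config R d).

Lemma finite_config_bounded phi A : bounded_set A -> finite_set (phi `&` A).
Proof.
move=> /bounded_set_sub_sup_ball[n An].
have := points_locally_finite phi (@compact_sup_ball R d n%:R).
by apply: sub_finite_set; apply: setIS.
Qed.

Lemma countable_config phi : countable phi.
Proof.
rewrite (_ : points phi = \bigcup_(n : nat) (phi `&` sup_ball n%:R)).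
  apply: bigcup_countable => // n _; apply: finite_set_countable.
  exact/finite_config_bounded/bounded_sup_ball.
apply/seteqP; split=> [x px|x [n _ []//]].
exists (Num.truncn `|x|).+1 => //; split => //; exact/ltW/truncnS_gt.
Qed.

Lemma measurable_set1_rV (x : 'rV[R]_d) : measurable [set x].
Proof.
by apply: rV_closed_measurable; apply: accessible_closed_set1; apply: hausdorff_accessible;
  exact: norm_hausdorff.
Qed.

(** An injection into nat labels the points; labels that are not taken give the empty fibre, so
    finite and infinite configurations are treated alike. Sums over points and integrals can then be
    compared fibre by fibre. *)
Lemma config_fibration phi : exists F : nat -> set 'rV[R]_d,
  [/\ forall n, F n = set0 \/ (exists2 x, points phi x & F n = [set x]),
      trivIset setT F & points phi = \bigcup_n F n].
Proof.
have /countable_injP[f finj] := countable_config phi.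
exists (fun n => phi `&` f @^-1` [set n]); split.
- move=> n; have [[x [px fx]]|nx] := pselect (exists x, points phi x /\ f x = n).
    right; exists x => //; apply/seteqP; split=> [y [py /= fy]|y -> //].
    exact: (finj y x (mem_set py) (mem_set px) (etrans fy (esym fx))).
  left; apply/seteqP; split=> [y [py fy]|//]; apply: nx; by exists y.
- by move=> i j _ _ [x [[_ /= <-] [_ /= <-]]].
- by apply/seteqP; split=> [x px|x [n _ []//]]; exists (f x).
Qed.

Lemma measurable_config phi : measurable (phi : set 'rV[R]_d).
Proof.
have [F [FE _ ->]] := config_fibration phi.
by apply: bigcup_measurable => n _; have [->|[x _ ->]] := FE n; [exact: measurable0|exact: measurable_set1_rV].
Qed.

Definition point_measure phi A : \bar R := npoints A phi.

Let point_measure0 phi : point_measure phi set0 = 0%E.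
Proof. by rewrite /point_measure /npoints setI0 /counting asboolT// fset_set0. Qed.

Lemma npoints_ge0 phi A : (0 <= npoints A phi)%E.
Proof. by rewrite /npoints /counting; case: ifPn; rewrite ?lee_fin// leey. Qed.

Let point_measure_ge0 phi A : (0 <= point_measure phi A)%E.
Proof. exact: npoints_ge0. Qed.

Let point_measure_sigma_additive phi : semi_sigma_additive (point_measure phi).
Proof.
move=> F mF tF mUF; rewrite /point_measure /npoints setI_bigcupr.
apply: (@measure_semi_sigma_additive _ 'rV[R]_d R (@counting 'rV[R]_d R)).
- by move=> k; apply: measurableI => //; exact: measurable_config.
- by apply: trivIset_setIl.
- by rewrite -setI_bigcupr; apply: measurableI => //; exact: measurable_config.
Qed.

HB.instance Definition _ phi := isMeasure.Build _ _ _ (point_measure phi)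
  (@point_measure0 phi) (@point_measure_ge0 phi) (@point_measure_sigma_additive phi).

Lemma npoints_fin phi A : bounded_set A -> npoints A phi \is a fin_num.
Proof. by move=> bA; rewrite /npoints /counting asboolT//; exact: finite_config_bounded. Qed.

Lemma npoints_set1 phi x : points phi x -> npoints [set x] phi = 1%E.
Proof.
move=> px; rewrite /npoints (_ : _ `&` _ = [set x]) ?/counting ?asboolT ?fset_set1//.
  by rewrite cardfs1.
by apply/seteqP; split=> [y []//|y -> /=].
Qed.

(** The complement of phi carries no mass, so both sides split along the fibres of
    [config_fibration], where each is a single value of H or 0. Through this identity sums over
    points inherit monotone convergence and measurability. *)
Lemma integral_point_measure phi A (H : 'rV[R]_d -> \bar R) : measurable A ->
  measurable_fun setT H -> (forall x, 0 <= H x)%E ->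
  (\int[point_measure phi]_(x in A) H x = \esum_(x in phi `&` A) H x)%E.
Proof.
move=> mA mH H0.
have [F [FE tF phiE]] := config_fibration phi.
have mF n : measurable (F n).
  by have [->|[x _ ->]] := FE n; [exact: measurable0|exact: measurable_set1_rV].
rewrite (@ge0_negligible_integral _ _ _ (point_measure phi) A (A `&` ~` phi))//; last 3 first.
- exact: measurableI mA (measurableC (measurable_config phi)).
- exact: measurable_funTS.
- rewrite /= /point_measure /npoints (_ : _ `&` _ = set0) ?/counting ?asboolT ?fset_set0//.
  by apply/seteqP; split=> x // [px []].
have -> : A `\` (A `&` ~` phi) = \bigcup_n (F n `&` A).
  rewrite -setI_bigcupl -phiE; apply/seteqP; split=> x /=.
    by move=> [Ax /not_andP[//|/contrapT]].
  by move=> [px Ax]; split => // -[].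
have -> : phi `&` A = \bigcup_n (F n `&` A) by rewrite -setI_bigcupl -phiE.
have tFA : trivIset setT (fun n => F n `&` A) by exact: trivIset_setIr.
rewrite ge0_integral_bigcup//=; last 2 first.
- by move=> k; apply: measurableI.
- exact: measurable_funTS.
rewrite esum_bigcupT// -nneseries_esumT; last by move=> n; exact: esum_ge0.
apply: eq_eseriesr => n _.
have [->|[x px ->]] := FE n; first by rewrite set0I integral_set0 esum_set0.
have [Ax|nAx] := pselect (A x); last first.
  by rewrite (_ : _ `&` _ = set0) ?integral_set0 ?esum_set0//; apply/seteqP; split=> y // [-> ].
rewrite (_ : _ `&` _ = [set x]); last by apply/seteqP; split=> y //= [-> ].
rewrite esum_set1// (eq_integral (cst (H x))); last by move=> y /set_mem ->.
by rewrite integral_cst/= ?/point_measure ?npoints_set1 ?mule1//; exact: measurable_set1_rV.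
Qed.
End point_measure.

Section point_kernel.
Context {R : realType} {d : nat}.
Implicit Types (A B : set 'rV[R]_d) (r : R) (phi : config R d).

(** The sigma-algebra is generated by counts in bounded windows. Shells are bounded, disjoint and
    exhaust space, so a count in any measurable window is a countable sum of such counts. *)
Definition shell (k : nat) : set 'rV[R]_d := [set v | Num.truncn `|v| = k].

Lemma shellE k : shell k = sup_ball k.+1%:R `&` shell k.
Proof.
by apply/seteqP; split=> [v /= vk|v []//]; split => //; rewrite -vk; exact/ltW/truncnS_gt.
Qed.

Lemma bounded_shell k : bounded_set (shell k).
Proof. by rewrite shellE; apply: bounded_subset (@bounded_sup_ball R d k.+1%:R); exact: subIsetl. Qed.

Lemma measurable_shell k : measurable (shell k).
Proof.
have mlt r : measurable [set v : 'rV[R]_d | r <= `|v|].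
  apply: rV_closed_measurable.
  rewrite (_ : [set _ | _] = (fun v : 'rV[R]_d => `|v|) @^-1` [set x | r <= x])//.
  by apply: preimage_closed; [move=> x _; exact: norm_continuous|exact: closed_ge].
rewrite (_ : shell k = [set v | k%:R <= `|v|] `\` [set v | k.+1%:R <= `|v|]).
  by apply: measurableD.
apply/seteqP; split=> v /=.
  by move=> <-; split; [rewrite truncn_le|apply/negP; rewrite -ltNge truncnS_gt].
by move=> [kv /negP]; rewrite -ltNge => vk; apply: truncn_def; rewrite kv.
Qed.

Lemma trivIset_shell : trivIset setT shell.
Proof. by move=> i j _ _ [x [<- <-]]. Qed.

Lemma bigcup_shell : \bigcup_k shell k = setT.
Proof. by apply/seteqP; split => // v _; exists (Num.truncn `|v|). Qed.

Lemma npoints_shell phi A : measurable A ->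
  npoints A phi = (\sum_(k <oo) npoints (A `&` shell k) phi)%E.
Proof.
move=> mA; rewrite -[in LHS](setIT A) -bigcup_shell setI_bigcupr.
apply: (@measure_semi_bigcup _ _ _ (point_measure phi)).
- by move=> k; apply: measurableI => //; exact: measurable_shell.
- by apply: trivIset_setIl; exact: trivIset_shell.
- by apply: bigcup_measurable => k _; apply: measurableI => //; exact: measurable_shell.
Qed.

Lemma measurable_npoints A : measurable A ->
  measurable_fun setT (npoints A : config R d -> \bar R).
Proof.
move=> mA.
rewrite (_ : npoints A = (fun phi => \sum_(k <oo) npoints (A `&` shell k) phi))%E; last first.
  by apply/funext => phi; rewrite -npoints_shell.
apply: ge0_emeasurable_sum => [n phi _ _|k _]; first exact: npoints_ge0.
move=> _ Y mY; rewrite setTI; apply: sub_sigma_algebra.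
exists (A `&` shell k); last by exists Y.
split; first by apply: measurableI => //; exact: measurable_shell.
by apply: bounded_subset (bounded_shell k); exact: subIsetr.
Qed.

Lemma measurable_config_fun dT (T : measurableType dT) (g : T -> config R d) :
  (forall A, measurable A -> bounded_set A -> measurable_fun setT (fun t => npoints A (g t))) ->
  measurable_fun setT g.
Proof.
move=> mg; apply: (measurability (@npoints_cylinder R d)) => //.
move=> _ [_ [A [mA bA] [Y mY ->]] <-].
exact: mg.
Qed.

Section kernel.
Context {dT : measure_display} {T : measurableType dT} (g : T -> config R d).
Hypothesis mg : measurable_fun setT g.

(* Cutting space into bounded shells and fixing the number [j] of points in a shell
   writes the kernel [t |-> g t] as a sum of finite kernels. *)
Definition point_kernel_part (k j : nat) (t : T) : {measure set 'rV[R]_d -> \bar R} :=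
  if npoints (shell k) (g t) == j%:R%:E then (mrestr (point_measure (g t)) (measurable_shell k) : {measure set 'rV[R]_d -> \bar R})
  else (mzero : {measure set 'rV[R]_d -> \bar R}).

Let part_measurable k j U : measurable U ->
  measurable_fun setT (point_kernel_part k j ^~ U).
Proof.
move=> mU; rewrite /point_kernel_part.
rewrite (_ : (fun t => _) = (fun t => if npoints (shell k) (g t) == j%:R%:E then
  npoints (U `&` shell k) (g t) else 0%E)); last first.
  by apply/funext => t; case: ifPn.
have mN A : measurable A -> measurable_fun setT (fun t => npoints A (g t)).
  by move=> mA; exact: measurableT_comp (measurable_npoints mA) mg.
apply: measurable_fun_ifT => //.
- apply: measurable_fun_eqe => //; apply: mN; exact: measurable_shell.
- by apply: mN; apply: measurableI => //; exact: measurable_shell.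
Qed.

HB.instance Definition _ k j := isKernel.Build _ _ _ _ _ (point_kernel_part k j)
  (@part_measurable k j).

Let part_uub k j : measure_fam_uub (point_kernel_part k j).
Proof.
exists j.+1%:R => t; rewrite /point_kernel_part; case: ifPn => [/eqP E|_] /=.
  by rewrite /mrestr setTI /point_measure E lte_fin ltr_nat.
by rewrite /mzero lte_fin.
Qed.

HB.instance Definition _ k j := Kernel_isFinite.Build _ _ _ _ _ (point_kernel_part k j)
  (@part_uub k j).

Let ker : R.-sfker T ~> 'rV[R]_d :=
  kseries (fun k => kseries (fun j => point_kernel_part k j : R.-sfker T ~> 'rV[R]_d)).

Let kerE t U : measurable U -> ker t U = npoints U (g t).
Proof.
move=> mU; rewrite npoints_shell//; apply: eq_eseriesr => k _.
have := npoints_fin (g t) (bounded_shell k).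
rewrite {1}/npoints /counting; case: ifPn => //.
set j := #|` _| => fin _.
have Nj : npoints (shell k) (g t) = j%:R%:E by rewrite /npoints /counting fin.
rewrite /kseries/= /mseries/= (@nneseriesD1 _ _ j)//.
rewrite eseries0 ?adde0.
  by rewrite /point_kernel_part Nj eqxx.
move=> i _ ij; rewrite /point_kernel_part Nj ifF//.
by apply/negbTE; rewrite eqe eqr_nat eq_sym.
Qed.

(** The sum is the integral of H against an s-finite kernel, and such integrals are measurable in t
    even if H depends jointly on t and the point. All measurability of sums over random points comes
    from here. *)
Lemma measurable_esum_config (H : T * 'rV[R]_d -> \bar R) A : measurable A ->
  measurable_fun setT H -> (forall p, 0 <= H p)%E ->
  measurable_fun setT (fun t => \esum_(x in g t `&` A) H (t, x))%E.
Proof.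
move=> mA mH H0.
pose HA p := (H p * (\1_A p.2)%:E)%E.
have mHA : measurable_fun setT HA.
  apply: emeasurable_funM => //; apply/measurable_EFinP.
  by apply: measurableT_comp => //; exact: measurable_indic.
have HA0 p : (0 <= HA p)%E by rewrite /HA mule_ge0// lee_fin.
have := measurable_fun_integral_sfinite_kernel HA ker HA0 mHA.
apply: eq_measurable_fun => t _.
rewrite (eq_measure_integral (point_measure (g t))); last first.
  by move=> U mU _; exact: kerE.
rewrite integral_point_measure//; last first.
  by apply: measurableT_comp mHA _; exact: measurable_pair1.
rewrite setIT esum_mkcondr; apply: eq_esum => x _.
by rewrite /HA/= indicE; case: (x \in A); rewrite ?mule1 ?mule0.
Qed.

End kernel.
End point_kernel.

(** * Translations of configurations and weighted counts of points *)

Section translation.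
Context {R : realType} {d : nat}.
Implicit Types (A B : set 'rV[R]_d) (s t : 'rV[R]_d) (phi : config R d).
Implicit Types (w : config R d -> \bar R).

Lemma config_ext phi psi : points phi = points psi -> phi = psi.
Proof.
case: phi => p hp; case: psi => q hq /= pq; subst q.
by congr Config; exact: Prop_irrelevance.
Qed.

Lemma translate_translate s t phi : translate s (translate t phi) = translate (s + t) phi.
Proof.
apply: config_ext; apply/seteqP; split=> x /=.
  by move=> [_ [y py <-] <-]; exists y => //; rewrite opprD addrA addrAC.
by move=> [y py <-]; exists (y - t); [exists y|rewrite opprD addrA addrAC].
Qed.

Lemma translate0 phi : translate 0 phi = phi.
Proof.
apply: config_ext; apply/seteqP; split=> x /=; first by move=> [y py <-]; rewrite subr0.
by move=> px; exists x => //; rewrite subr0.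
Qed.

Definition shift_set t A : set 'rV[R]_d := [set x | A (x - t)].

Lemma measurable_shift_set t A : measurable A -> measurable (shift_set t A).
Proof.
move=> mA; rewrite /shift_set -[X in measurable X]setTI.
have := @rV_affine_measurable R d 1 (- t) measurableT A mA.
by congr (measurable (_ `&` _)); apply/seteqP; split => x /=; rewrite scale1r.
Qed.

Lemma npoints_esum phi A : measurable A ->
  npoints A phi = \esum_(x in phi) (\1_A x)%:E.
Proof.
move=> mA; rewrite -[in RHS](setIT (points phi)).
rewrite -(@integral_point_measure _ _ _ setT (fun x => (\1_A x)%:E))//.
  by rewrite integral_indic// setIT.
by apply/measurable_EFinP; exact: measurable_indic.
Qed.

(** Each point contributes the weight of the configuration seen from it. The indicator of an event
    gives the sum in the Palm measure; [npoints C] gives the number of pairs with first point in A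
    and difference in C. *)
Definition weighted_count w A phi : \bar R := \esum_(x in phi `&` A) w (translate x phi).

Lemma esum_translate (H : 'rV[R]_d -> \bar R) t phi A :
  \esum_(x in translate t phi `&` A) H x = \esum_(x in phi `&` shift_set t A) H (x - t).
Proof.
rewrite (_ : _ `&` A = (fun x => x - t) @` (phi `&` shift_set t A)).
  by rewrite esum_image// => x y _ _ /addIr.
apply/seteqP; split=> x /=; first by move=> [[y py <-] Ay]; exists y.
by move=> [y [py Ay] <-]; split => //; exists y.
Qed.

Lemma npoints_translate t phi A : measurable A ->
  npoints A (translate t phi) = npoints (shift_set t A) phi.
Proof.
move=> mA; rewrite !npoints_esum//; last exact: measurable_shift_set.
by rewrite -[in LHS](setIT (translate t phi)) esum_translate setIT.
Qed.

(** A count in A after translation by x is the sum over y in phi of the indicator of A at y - x, to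
    which [measurable_esum_config] applies with the pair (x, phi) as parameter. *)
Lemma measurable_translate_pair :
  measurable_fun setT (fun p : 'rV[R]_d * config R d => translate p.1 p.2).
Proof.
apply: measurable_config_fun => A mA bA.
have m2 : measurable_fun setT (@snd 'rV[R]_d (config R d)) by exact: measurable_snd.
have := @measurable_esum_config _ _ _ _ _ m2 (fun q => (\1_A (q.2 - q.1.1))%:E) setT.
have mH : measurable_fun setT (fun q : ('rV[R]_d * config R d) * 'rV[R]_d =>
    (\1_A (q.2 - q.1.1))%:E : \bar R).
  apply/measurable_EFinP.
  have mI : measurable_fun setT (\1_A : 'rV[R]_d -> R) by exact: measurable_indic.
  apply: (measurableT_comp mI).
  apply: (measurableT_comp rV_sub_measurable (g := fun q => (q.1.1, q.2))).
  apply/measurable_fun_pairP.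
  split; last exact: measurable_snd.
  exact: (measurableT_comp (measurable_fst (T1 := 'rV[R]_d) (T2 := config R d)) measurable_fst).
have H0 (q : ('rV[R]_d * config R d) * 'rV[R]_d) :
  (0 <= (\1_A (q.2 - q.1.1))%:E :> \bar R)%E by rewrite lee_fin.
move=> /(_ measurableT mH H0).
apply: eq_measurable_fun => -[x phi] _ /=.
rewrite npoints_translate// npoints_esum ?setIT//.
exact: measurable_shift_set.
Qed.

Lemma measurable_translate t : measurable_fun setT (translate t : config R d -> config R d).
Proof.
apply: (measurableT_comp measurable_translate_pair (g := fun phi => (t, phi))).
exact: measurable_pair1.
Qed.

Lemma measurable_weighted_count w A : measurable A -> measurable_fun setT w ->
  (forall phi, 0 <= w phi)%E -> measurable_fun setT (weighted_count w A).
Proof.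
move=> mA mw w0.
have mH : measurable_fun setT (fun q : config R d * 'rV[R]_d => w (translate q.2 q.1)).
  apply: measurableT_comp mw _.
  apply: (measurableT_comp measurable_translate_pair (g := fun q => (q.2, q.1))).
  by apply/measurable_fun_pairP; split; [exact: measurable_snd|exact: measurable_fst].
have mid : measurable_fun setT (@id (config R d)) by exact: measurable_id.
exact: (measurable_esum_config mid mA mH).
Qed.

Lemma weighted_count_translate w A t phi :
  weighted_count w A (translate t phi) = weighted_count w (shift_set t A) phi.
Proof.
rewrite /weighted_count esum_translate; apply: eq_esum => x _.
by rewrite translate_translate subrK.
Qed.

Lemma weighted_count_ge0 w A phi : (forall psi, 0 <= w psi)%E -> (0 <= weighted_count w A phi)%E.
Proof. by move=> w0; exact: esum_ge0. Qed.

Lemma weighted_count_bigcup w (F : nat -> set 'rV[R]_d) phi :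
  (forall psi, 0 <= w psi)%E -> trivIset setT F ->
  weighted_count w (\bigcup_n F n) phi = (\sum_(n <oo) weighted_count w (F n) phi)%E.
Proof.
move=> w0 tF; rewrite /weighted_count setI_bigcupr esum_bigcupT//; last exact: trivIset_setIl.
by rewrite -nneseries_esumT// => n; exact: esum_ge0.
Qed.

Lemma measurable_translate_point phi :
  measurable_fun setT (fun x : 'rV[R]_d => translate x phi).
Proof.
apply: (measurableT_comp measurable_translate_pair (g := fun x => (x, phi))).
exact: measurable_pair2.
Qed.

Lemma weighted_countE w A phi : measurable A -> measurable_fun setT w ->
  (forall psi, 0 <= w psi)%E ->
  weighted_count w A phi = (\int[point_measure phi]_(x in A) w (translate x phi))%E.
Proof.
move=> mA mw w0; rewrite integral_point_measure//.
exact: measurableT_comp mw (measurable_translate_point phi).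
Qed.

Lemma weighted_count_nneseries (w : nat -> config R d -> \bar R) A phi : measurable A ->
  (forall n, measurable_fun setT (w n)) -> (forall n psi, 0 <= w n psi)%E ->
  weighted_count (fun psi => \sum_(n <oo) w n psi)%E A phi =
  (\sum_(n <oo) weighted_count (w n) A phi)%E.
Proof.
move=> mA mw w0; rewrite weighted_countE//.
- rewrite integral_nneseries//.
    by apply: eq_eseriesr => n _; rewrite -weighted_countE.
  by move=> n; apply: measurable_funTS; apply: measurableT_comp (mw n) (measurable_translate_point phi).
- by apply: ge0_emeasurable_sum.
- by move=> psi; apply: nneseries_ge0.
Qed.

(** An integer n is the sum over j of the indicators of j + 1 <= n. This reduces an integral of
    counts to the masses of events, in terms of which the Palm measure is defined. *)
Lemma npoints_layers A phi : npoints A phi =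
  (\sum_(j <oo) (\1_[set psi : config R d | (j.+1%:R%:E <= npoints A psi)%E] phi)%:E)%E.
Proof.
under eq_eseriesr do rewrite indicE.
have memE j : (phi \in [set psi : config R d | (j.+1%:R%:E <= npoints A psi)%E]) = (j.+1%:R%:E <= npoints A phi)%E.
  by apply/idP/idP => [/set_mem//|h]; exact: mem_set.
under eq_eseriesr do rewrite memE.
have [->|] := eqVneq (npoints A phi) +oo%E.
  apply/esym/eqyP => M M0.
  apply: (le_trans _ (@nneseries_lim_ge _ _ xpredT 0%N (Num.truncn M).+1 _)).
    under eq_bigr do rewrite leey.
    rewrite big_mkord sumEFin lee_fin sumr_const card_ord.
    exact/ltW/truncnS_gt.
  by move=> n _; rewrite lee_fin.
rewrite /npoints /counting; case: ifPn => // _ _.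
set n := #|` _|.
rewrite (nneseries_split 0 n); last by move=> j _; rewrite lee_fin.
rewrite eseries0 ?adde0; last first.
  by move=> j; rewrite add0n => nj _; rewrite lee_fin ler_nat ltnNge nj.
rewrite add0n big_mkord (eq_bigr (fun=> 1%E)); last first.
  by move=> j _; rewrite lee_fin ler_nat ltn_ord.
by rewrite sumEFin sumr_const card_ord.
Qed.

End translation.

Section eq_set_function_integral.
Import HBNNSimple.

(* [eq_measure_integral] for bare set functions, such as [palm] and [gamma] *)
Lemma eq_set_function_integral dT (T : measurableType dT) (R : realType)
    (m1 m2 : set T -> \bar R) (f : T -> \bar R) :
  (forall A, measurable A -> m1 A = m2 A) ->
  (\int[m1]_x f x = \int[m2]_x f x)%E.
Proof.
move=> m12.
have E (h : {nnsfun T >-> R}) : sintegral m1 h = sintegral m2 h.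
  by apply: eq_fsbigr => x _; rewrite m12.
by rewrite /integral; congr (ereal_sup _ - ereal_sup _)%E; apply: eq_imagel => h _; exact: E.
Qed.

End eq_set_function_integral.

(** * The Palm measure *)

Section palm.
Context {R : realType} {d : nat} {disp : measure_display} {Omega : measurableType disp}.
Variables (P : probability Omega R) (chi : {RV P >-> config R d}).
Variables (B : set 'rV[R]_d).
Hypothesis mB : measurable B.
Local Notation mu := (distribution P chi).

(** The formula of [palm] written on the law of [chi], where it carries a measure structure. Both
    agree on measurable events and hence give the same integrals. *)
Definition palm_measure (F : set (config R d)) : \bar R :=
  ((fine (lebesgue_rV d B))^-1%:E *
   \int[mu]_phi weighted_count (fun psi => (\1_F psi)%:E) B phi)%E.

Let c0 : 0 <= (fine (lebesgue_rV d B))^-1.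
Proof. by rewrite invr_ge0 fine_ge0. Qed.

Let palm_measure0 : palm_measure set0 = 0%E.
Proof.
rewrite /palm_measure integral0_eq ?mule0// => phi _.
by apply: esum1 => x _; rewrite indic0.
Qed.

Let palm_measure_ge0 F : (0 <= palm_measure F)%E.
Proof.
apply: mule_ge0; rewrite ?lee_fin//; apply: integral_ge0 => phi _.
by apply: weighted_count_ge0 => psi; rewrite lee_fin.
Qed.

Let mw F : measurable F -> measurable_fun setT (fun phi : config R d => (\1_F phi)%:E : \bar R).
Proof. by move=> mF; apply/measurable_EFinP; exact: measurable_indic. Qed.

Let w0 F (phi : config R d) : (0 <= (\1_F phi)%:E :> \bar R)%E.
Proof. by rewrite lee_fin. Qed.

Let palm_measure_sigma_additive : semi_sigma_additive palm_measure.
Proof.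
move=> F mF tF mUF.
have -> : palm_measure (\bigcup_n F n) = (\sum_(n <oo) palm_measure (F n))%E.
  rewrite /palm_measure nneseriesZl; last first.
    by move=> n _; apply: integral_ge0 => phi _; exact: weighted_count_ge0.
  congr (_ * _)%E; rewrite -integral_nneseries//; last 2 first.
  - by move=> n; apply: measurable_weighted_count => //; exact: mw.
  - by move=> n x _; apply: weighted_count_ge0.
  apply: eq_integral => phi _; rewrite -weighted_count_nneseries//; last first.
    by move=> n; exact: mw.
  congr (weighted_count _ B phi); apply/funext => psi.
  exact: (@measure_semi_bigcup _ _ _ (@dirac _ _ psi R) F mF tF mUF).
by apply: is_cvg_nneseries => n _ _; exact: palm_measure_ge0.
Qed.

HB.instance Definition _ := isMeasure.Build _ _ _ palm_measure
  palm_measure0 palm_measure_ge0 palm_measure_sigma_additive.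

Lemma palm_palm_measure F : measurable F -> palm chi B F = palm_measure F.
Proof.
move=> mF; rewrite /palm /palm_measure; congr (_ * _)%E.
rewrite ge0_integral_distribution//.
  by apply: measurable_weighted_count => //; exact: mw.
by move=> phi; apply: weighted_count_ge0.
Qed.

Lemma intensity_palm A : measurable A -> intensity (palm chi B) A =
  ((fine (lebesgue_rV d B))^-1%:E * \int[mu]_phi weighted_count (npoints A) B phi)%E.
Proof.
move=> mA; rewrite /intensity (@eq_set_function_integral _ _ _ _ palm_measure); last first.
  by move=> F mF; exact: palm_palm_measure.
pose S j := [set psi : config R d | j.+1%:R%:E <= npoints A psi]%E.
have mS j : measurable (S j).
  rewrite /S -[X in measurable X]setTI.
  by apply: emeasurable_fun_c_infty => //; exact: measurable_npoints.
under eq_integral do rewrite npoints_layers.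
rewrite integral_nneseries//.
under eq_eseriesr => n _.
  rewrite integral_indic//; last exact: mS.
  rewrite setIT.
  over.
rewrite /palm_measure nneseriesZl; last first.
  by move=> n _; apply: integral_ge0 => phi _; exact: weighted_count_ge0.
congr (_ * _)%E; rewrite -integral_nneseries//; last 2 first.
- by move=> n; exact: (measurable_weighted_count mB (mw (mS n)) (w0 _)).
- by move=> n x _; apply: weighted_count_ge0.
apply: eq_integral => phi _; rewrite -weighted_count_nneseries//; last by move=> n; exact: mw (mS n).
  by congr (weighted_count _ B phi); apply/funext => psi; rewrite npoints_layers.
by move=> n; exact: mw (mS n).
Qed.

End palm.

Section pushforward_measure.
Context d1 d2 (T1 : measurableType d1) (T2 : measurableType d2) (R : realType).
Variables (m : {measure set T1 -> \bar R}) (f : T1 -> T2).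
Hypothesis mf : measurable_fun setT f.

Definition pushforward_measure : {measure set T2 -> \bar R} :=
  measure_function_pushforward__canonical__measure_function_Measure m mf.

Lemma pushforward_measureE A : pushforward_measure A = m (f @^-1` A).
Proof. by []. Qed.

End pushforward_measure.

(** * Lebesgue measure under affine maps *)

Section lebesgue_affine.
Context {R : realType}.
Implicit Types (r : R).

Lemma itv_affine_preimage r (t a b : R) : 0 < r ->
  (fun x => r * x + t) @^-1` `]a, b]%classic = `](a - t) / r, (b - t) / r]%classic.
Proof.
move=> r0; apply/seteqP; split=> x /=; rewrite !in_itv/=.
  by rewrite ltr_pdivrMr// ler_pdivlMr// ltrBlDr lerBrDr ![x * r]mulrC.
by rewrite ltr_pdivrMr// ler_pdivlMr// ltrBlDr lerBrDr ![x * r]mulrC.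
Qed.

Lemma measurable_affine1 r (t : R) :
  measurable_fun setT ((fun x => r * x + t) : measurableTypeR R -> measurableTypeR R).
Proof. by apply: measurable_funD => //; apply: measurable_funM. Qed.

Lemma lebesgue_measure_affine r (t : R) (A : set (measurableTypeR R)) : 0 < r ->
  measurable A ->
  (r%:E * lebesgue_measure ((fun x => r * x + t)%R @^-1` A))%E = lebesgue_measure A.
Proof.
move=> r0 mA.
have r0' : 0 <= r by exact: ltW.
pose m := mscale (NngNum r0') (pushforward_measure (@lebesgue_measure R) (measurable_affine1 r t)).
rewrite [RHS](@lebesgue_measure_unique R m)// => _ [[a b]] _ <-.
have L x y : lebesgue_measure (`]x, y]%classic : set (measurableTypeR R)) =
    if x < y then (y - x)%:E else 0%E.
  by apply: etrans (lebesgue_measure_itv _) _; rewrite /= lte_fin.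
transitivity (r%:E * lebesgue_measure (`]((a - t) / r)%R, ((b - t) / r)%R]%classic : set (measurableTypeR R)))%E; last first.
  by rewrite -itv_affine_preimage.
rewrite !L /= ltr_pM2r ?invr_gt0// ltrD2r.
case: ifPn => // ab; last by rewrite mule0.
rewrite -EFinM; congr EFin.
by field; rewrite gt_eqF.
Qed.

(** Induction on the dimension: under [cons_rV] the map acts separately on the first coordinate and
    on the others, so uniqueness of the product measure reduces the claim to rectangles. *)
Lemma lebesgue_rV_affine d r (t : 'rV[R]_d) A : 0 < r -> measurable A ->
  ((r ^+ d)%:E * lebesgue_rV d ((fun v => r *: v + t)%R @^-1` A))%E = lebesgue_rV d A.
Proof.
move=> r0; elim: d t A => [|d IH] t A mA.
  rewrite expr0 mul1e /= !diracE; congr (_%:R%:E).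
  have E (v : 'rV[R]_0) : v = 0 by apply/rowP => -[].
  rewrite (_ : (fun v : 'rV[R]_0 => r *: v + t) = id)//.
  by apply/funext => v; rewrite (E v) (E (_ + _)).
have r0' : 0 <= r ^+ d.+1 by exact/ltW/exprn_gt0.
pose h (p : measurableTypeR R * 'rV[R]_d) : measurableTypeR R * 'rV[R]_d :=
  (r * p.1 + t ord0 ord0, r *: p.2 + (uncons_rV t).2).
have mh : measurable_fun setT h.
  apply/measurable_fun_pairP; split.
    exact: (measurableT_comp (measurable_affine1 r (t ord0 ord0)) measurable_fst).
  exact: (measurableT_comp (rV_affine_measurable r (uncons_rV t).2) measurable_snd).
pose L := (@lebesgue_measure R \x lebesgue_rV d)%E.
pose m := mscale (NngNum r0') (pushforward_measure L mh).
have mcA : measurable (@cons_rV R d @^-1` A).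
  by rewrite -[X in measurable X]setTI; exact: measurable_cons_rV.
rewrite /= /lebesgue_rV_step /pushforward.
rewrite [RHS](@product_measure_unique _ _ _ _ _ _ _ m) //.
  transitivity ((r ^+ d.+1)%:E * L (h @^-1` (@cons_rV R d @^-1` A)))%E; last by [].
  rewrite -/L; congr (_ * L _)%E.
  have hE p : r *: cons_rV p + t = cons_rV (h p).
    by apply/rowP => i; rewrite !mxE; case: unliftP => [j ->|->] /=; rewrite ?mxE.
  by apply/seteqP; split=> p /=; rewrite hE.
move=> X Y mX mY; rewrite /m /= /mscale/= pushforward_measureE.
have -> : h @^-1` (X `*` Y) =
   ((fun x => r * x + t ord0 ord0) @^-1` X) `*` ((fun v => r *: v + (uncons_rV t).2) @^-1` Y).
  by apply/seteqP; split=> -[x v].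
have mpX : measurable ((fun x : measurableTypeR R => r * x + t ord0 ord0 : measurableTypeR R) @^-1` X).
  by rewrite -[X in measurable X]setTI; exact: measurable_affine1.
have mpY : measurable ((fun v : 'rV[R]_d => r *: v + (uncons_rV t).2) @^-1` Y).
  by rewrite -[X in measurable X]setTI; exact: rV_affine_measurable.
have E := product_measure1E (@lebesgue_measure R) (lebesgue_rV d) mpX mpY.
apply: etrans (congr1 (mule _) E) _.
  by rewrite exprS EFinM muleACA lebesgue_measure_affine// IH.
exact: mh.
Qed.

Lemma lebesgue_rV_shift d (t : 'rV[R]_d) A : measurable A ->
  lebesgue_rV d (shift_set t A) = lebesgue_rV d A.
Proof.
move=> mA; have := lebesgue_rV_affine (- t) ltr01 mA.
rewrite expr1n mul1e => <-; congr (lebesgue_rV d _).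
by apply/seteqP; split => x /=; rewrite scale1r.
Qed.

Definition unit_cube d : set 'rV[R]_d := [set v | forall i, 0 <= v ord0 i < 1].

Lemma measurable_unit_cube d : measurable (@unit_cube d).
Proof.
rewrite (_ : @unit_cube d = \bigcap_(i in [set: 'I_d])
    ((fun v : 'rV[R]_d => v ord0 i) @^-1` `[0, 1[)); last first.
  apply/seteqP; split=> v.
    by move=> abv i _; rewrite /= in_itv/=; exact: abv.
  by move=> abv i; have := abv i Logic.I; rewrite /= in_itv.
apply: fin_bigcap_measurable => // i _; rewrite -[X in measurable X]setTI.
exact: rV_coord_measurable.
Qed.

Lemma lebesgue_unit_cube d : lebesgue_rV d (@unit_cube d) = 1%E.
Proof.
elim: d => [|d IH]; first by rewrite /= diracE mem_set// => -[].
rewrite /= /lebesgue_rV_step /pushforward.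
have -> : @cons_rV R d @^-1` (@unit_cube d.+1) = `[0, 1[%classic `*` @unit_cube d.
  apply/seteqP; split=> -[x v] /=.
    move=> abv; split.
      by rewrite in_itv/=; have := abv ord0; rewrite mxE unlift_none.
    by move=> i; have := abv (lift ord0 i); rewrite !mxE liftK.
  move=> [+ abv]; rewrite in_itv/= => x01 i; rewrite mxE.
  by case: unliftP => [j|] _ //=; exact: abv.
rewrite product_measure1E//; last exact: measurable_unit_cube.
rewrite IH mule1; apply: etrans (lebesgue_measure_itv _) _.
by rewrite /= lte_fin ltr01 sube0.
Qed.

End lebesgue_affine.

(** * The Euclidean norm and the volume of its balls *)

Section euclidean_norm.
Context {R : realType} {d : nat}.
Implicit Types (u v : 'rV[R]_d) (r : R).

Definition eucl_norm v : R := Num.sqrt (\sum_i v ord0 i ^+ 2).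

Lemma eucl_ballE r v : eucl_ball r v = (eucl_norm v < r).
Proof. by []. Qed.

Lemma eucl_norm_ge0 v : 0 <= eucl_norm v.
Proof. exact: sqrtr_ge0. Qed.

Lemma sqr_eucl_norm v : eucl_norm v ^+ 2 = \sum_i v ord0 i ^+ 2.
Proof. by rewrite sqr_sqrtr// sumr_ge0// => i _; exact: sqr_ge0. Qed.

(** Lagrange's identity: the sum of squares D is twice the difference of the two sides. *)
Lemma cauchy_schwarz_sum u v :
  (\sum_i u ord0 i * v ord0 i) ^+ 2 <= (\sum_i u ord0 i ^+ 2) * (\sum_i v ord0 i ^+ 2).
Proof.
pose D := \sum_i \sum_j (u ord0 i * v ord0 j - u ord0 j * v ord0 i) ^+ 2.
have D0 : 0 <= D by apply: sumr_ge0 => i _; apply: sumr_ge0 => j _; exact: sqr_ge0.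
suff DE : D = 2 * ((\sum_i u ord0 i ^+ 2) * (\sum_i v ord0 i ^+ 2)) -
    2 * (\sum_i u ord0 i * v ord0 i) ^+ 2 by lra.
pose a := fun i => u ord0 i ^+ 2. pose b := fun i => v ord0 i ^+ 2.
pose c := fun i => u ord0 i * v ord0 i.
have -> : D = \sum_i \sum_j (a i * b j) + \sum_i \sum_j (b i * a j) - 2 * (\sum_i \sum_j c i * c j).
  rewrite -big_split/= mulr_sumr -sumrB; apply: eq_bigr => i _.
  rewrite -big_split/= mulr_sumr -sumrB; apply: eq_bigr => j _.
  by rewrite /a /b /c; ring.
rewrite -!big_distrlr/= expr2 /a /b /c; ring.
Qed.

Lemma eucl_normD u v : eucl_norm (u + v) <= eucl_norm u + eucl_norm v.
Proof.
rewrite -(@ler_pXn2r _ 2)// ?nnegrE ?addr_ge0 ?eucl_norm_ge0//.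
rewrite sqrrD !sqr_eucl_norm.
have -> : \sum_i (u + v) ord0 i ^+ 2 = \sum_i u ord0 i ^+ 2 +
    (\sum_i u ord0 i * v ord0 i) *+ 2 + \sum_i v ord0 i ^+ 2.
  rewrite -sumrMnl -!big_split/=; apply: eq_bigr => i _.
  by rewrite mxE sqrrD.
rewrite lerD2r lerD2l lerMn2r /=; apply: (le_trans (ler_norm _)).
rewrite -(@ler_pXn2r _ 2)// ?nnegrE ?mulr_ge0 ?eucl_norm_ge0//.
by rewrite exprMn !sqr_eucl_norm real_normK ?num_real// cauchy_schwarz_sum.
Qed.

Lemma eucl_normN v : eucl_norm (- v) = eucl_norm v.
Proof. by rewrite /eucl_norm; congr Num.sqrt; apply: eq_bigr => i _; rewrite mxE sqrrN. Qed.

Lemma eucl_normZ r v : 0 <= r -> eucl_norm (r *: v) = r * eucl_norm v.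
Proof.
move=> r0; rewrite -[in RHS](ger0_norm r0) -sqrtr_sqr /eucl_norm -sqrtrM ?sqr_ge0//.
by congr Num.sqrt; rewrite mulr_sumr; apply: eq_bigr => i _; rewrite mxE exprMn.
Qed.

Lemma coord_le_norm v i : `|v ord0 i| <= `|v|.
Proof.
by rewrite [leRHS]/Num.norm/= mx_normrE (le_bigmax _ (fun ij : 'I_1 * 'I_d => `|v ij.1 ij.2|) (ord0, i)).
Qed.

Lemma norm_le_coord v r : 0 <= r -> (forall i, `|v ord0 i| <= r) -> `|v| <= r.
Proof.
move=> r0 vr; rewrite [leLHS]/Num.norm/= mx_normrE; apply/bigmax_leP; split => // -[i j] _ /=.
by rewrite ord1.
Qed.

Lemma norm_le_eucl v : `|v| <= eucl_norm v.
Proof.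
apply: norm_le_coord => [|i]; first exact: eucl_norm_ge0.
rewrite -sqrtr_sqr ler_wsqrtr// (bigD1 i)//= lerDl.
by apply: sumr_ge0 => j _; exact: sqr_ge0.
Qed.

Lemma eucl_le_norm v : eucl_norm v <= d%:R * `|v|.
Proof.
rewrite -(@ler_pXn2r _ 2)// ?nnegrE ?mulr_ge0 ?eucl_norm_ge0//.
rewrite sqr_eucl_norm; apply: (@le_trans _ _ (\sum_(i < d) `|v| ^+ 2)).
  apply: ler_sum => i _; rewrite -(real_normK (num_real (v ord0 i))).
  by rewrite ler_pXn2r// ?nnegrE// coord_le_norm.
rewrite sumr_const card_ord -[leLHS]mulr_natl exprMn ler_wpM2r ?exprn_ge0//.
by rewrite -natrX ler_nat; case: (d) => // n; rewrite leq_pmulr.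
Qed.

Lemma measurable_eucl_norm : measurable_fun setT eucl_norm.
Proof.
have ms : measurable_fun setT (@Num.sqrt R).
  exact: continuous_measurable_fun (@sqrt_continuous R).
apply: (measurableT_comp ms).
apply: measurable_sum => i; apply: measurable_funX; exact: rV_coord_measurable.
Qed.

Lemma measurable_eucl_ball r : measurable (@eucl_ball R d r).
Proof.
rewrite (_ : eucl_ball r = eucl_norm @^-1` `]-oo, r[%classic).
  by rewrite -[X in measurable X]setTI; exact: measurable_eucl_norm.
by apply/seteqP; split => v /=; rewrite in_itv.
Qed.

Lemma eucl_ball_sub_sup_ball r : @eucl_ball R d r `<=` sup_ball r.
Proof. by move=> v /ltW; exact: le_trans (norm_le_eucl v). Qed.

Lemma bounded_eucl_ball r : bounded_set (@eucl_ball R d r).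
Proof. exact: bounded_subset (@eucl_ball_sub_sup_ball r) (bounded_sup_ball r). Qed.

Lemma sup_ballE r : 0 <= r -> sup_ball r = [set v : 'rV[R]_d |
  forall i, (const_mx (- r) : 'rV[R]_d) ord0 i <= v ord0 i <= (const_mx r : 'rV[R]_d) ord0 i].
Proof.
move=> r0; apply/seteqP; split=> v /=.
  by move=> vr i; rewrite !mxE -ler_norml (le_trans (coord_le_norm _ _)).
by move=> vr; apply: norm_le_coord => // i; have := vr i; rewrite !mxE -ler_norml.
Qed.

Lemma lebesgue_sup_ball r : 0 <= r -> lebesgue_rV d (sup_ball r) = ((r *+ 2) ^+ d)%:E.
Proof.
move=> r0; rewrite sup_ballE// lebesgue_rV_box.
  by congr EFin; rewrite (eq_bigr (fun=> r *+ 2)) ?prodr_const ?card_ord// => i _; rewrite !mxE opprK.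
by move=> i; rewrite !mxE ge0_cp.
Qed.

Definition eucl_vol : R := fine (lebesgue_rV d (eucl_ball 1)).

Lemma lebesgue_eucl_ball1 : lebesgue_rV d (eucl_ball 1) = eucl_vol%:E.
Proof.
rewrite fineK// ge0_fin_numE//; apply: (@le_lt_trans _ _ (lebesgue_rV d (sup_ball 1))).
  apply: le_measure; [apply/mem_set; exact: measurable_eucl_ball|apply/mem_set; exact: measurable_sup_ball|].
  exact: eucl_ball_sub_sup_ball.
by rewrite lebesgue_sup_ball// ltry.
Qed.

Lemma eucl_vol_gt0 : 0 < eucl_vol.
Proof.
(* With radius 1/(d + 1), d times the sup norm is strictly below 1, in dimension 0 as well. *)
have c0 : 0 < (d.+1%:R : R)^-1 by rewrite invr_gt0.
rewrite -lte_fin -lebesgue_eucl_ball1; apply: (@lt_le_trans _ _ (lebesgue_rV d (sup_ball d.+1%:R^-1))).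
  by rewrite lebesgue_sup_ball ?ltW// lte_fin exprn_gt0// mulrn_wgt0.
apply: le_measure; [apply/mem_set; exact: measurable_sup_ball|apply/mem_set; exact: measurable_eucl_ball|].
move=> v /= vr; rewrite eucl_ballE; apply: (le_lt_trans (eucl_le_norm v)).
apply: (le_lt_trans (ler_wpM2l (ler0n _ _) vr)).
by rewrite ltr_pdivrMr// mul1r ltr_nat.
Qed.

Lemma lebesgue_eucl_ball r : 0 < r -> lebesgue_rV d (eucl_ball r) = (eucl_vol * r ^+ d)%:E.
Proof.
move=> r0; rewrite -(lebesgue_rV_affine 0 r0 (measurable_eucl_ball r)).
rewrite mulrC EFinM -lebesgue_eucl_ball1; congr (_ * lebesgue_rV d _)%E.
apply/seteqP; split => v /=; rewrite addr0 !eucl_ballE eucl_normZ ?ltW//.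
  by move=> h; rewrite -(ltr_pM2l r0) mulr1.
by move=> h; rewrite -(ltr_pM2l r0) mulr1 in h.
Qed.

End euclidean_norm.

(** * Campbell's formula *)

Section campbell.
Context {R : realType} {d : nat} (mu : probability (config R d) R).
Hypothesis stat : stationary mu.
Implicit Types (A B : set 'rV[R]_d).

Lemma integral_translate (f : config R d -> \bar R) t : measurable_fun setT f ->
  (forall phi, 0 <= f phi)%E ->
  (\int[mu]_phi f (translate t phi) = \int[mu]_phi f phi)%E.
Proof.
move=> mf f0.
rewrite -(@ge0_integral_pushforward _ _ _ _ _ _ (measurable_translate t) mu setT f)//.
by apply: eq_set_function_integral => F mF; exact: (stat t mF).
Qed.

Variable w : config R d -> \bar R.
Hypothesis mw : measurable_fun setT w.
Hypothesis w0 : forall phi, (0 <= w phi)%E.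

(** For fixed w this is a measure in A, translation invariant by stationarity; Campbell's formula
    identifies it as a multiple of Lebesgue measure. *)
Definition mean_count A : \bar R := (\int[mu]_phi weighted_count w A phi)%E.

Let mean_count0 : mean_count set0 = 0%E.
Proof.
by rewrite /mean_count integral0_eq// => phi _; rewrite /weighted_count setI0 esum_set0.
Qed.

Let mean_count_ge0 A : (0 <= mean_count A)%E.
Proof. by apply: integral_ge0 => phi _; exact: weighted_count_ge0. Qed.

Let mean_count_sigma_additive : semi_sigma_additive mean_count.
Proof.
move=> F mF tF mUF.
have -> : mean_count (\bigcup_n F n) = (\sum_(n <oo) mean_count (F n))%E.
  rewrite /mean_count -integral_nneseries//.
  - by apply: eq_integral => phi _; exact: weighted_count_bigcup.
  - by move=> n; exact: measurable_weighted_count.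
  - by move=> n phi _; exact: weighted_count_ge0.
by apply: is_cvg_nneseries => n _ _; exact: mean_count_ge0.
Qed.

HB.instance Definition _ := isMeasure.Build _ _ _ mean_count
  mean_count0 mean_count_ge0 mean_count_sigma_additive.

Lemma mean_count_shift t A : measurable A -> mean_count (shift_set t A) = mean_count A.
Proof.
move=> mA; rewrite /mean_count -[RHS](@integral_translate _ t).
- by apply: eq_integral => phi _; rewrite weighted_count_translate.
- exact: measurable_weighted_count.
- by move=> phi; exact: weighted_count_ge0.
Qed.

Hypothesis fin : forall n : nat, (mean_count (sup_ball n%:R) < +oo)%E.

Let mean_count_sigma_finite : sigma_finite setT mean_count.
Proof.
exists (fun n : nat => sup_ball n%:R).
  apply/seteqP; split=> // x _; exists (Num.truncn `|x|).+1 => //; exact/ltW/truncnS_gt.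
by move=> n; split; [exact: measurable_sup_ball|exact: fin].
Qed.

HB.instance Definition _ := Measure_isSigmaFinite.Build _ _ _ mean_count
  mean_count_sigma_finite.

(* Both sides are the integral of [1_A(x) 1_B(x+y)] against [mean_count (x) dy]. *)
Lemma mean_count_symmetric A B : measurable A -> measurable B ->
  (forall x, A x -> A (- x)) ->
  (mean_count A * lebesgue_rV d B = mean_count B * lebesgue_rV d A)%E.
Proof.
move=> mA mB symA.
pose ind (C : set 'rV[R]_d) x : \bar R := (\1_C x)%:E.
have mind C : measurable C -> measurable_fun setT (ind C).
  by move=> mC; apply/measurable_EFinP; exact: measurable_indic.
have madd : measurable_fun setT (fun p : 'rV[R]_d * 'rV[R]_d => p.1 + p.2).
  apply/rV_measurable_funP => i; under eq_fun do rewrite !mxE.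
  by apply: measurable_funD; apply: (measurableT_comp (rV_coord_measurable i)).
have msub : measurable_fun setT (fun p : 'rV[R]_d * 'rV[R]_d => p.1 - p.2).
  apply/rV_measurable_funP => i; under eq_fun do rewrite !mxE.
  by apply: measurable_funB; apply: (measurableT_comp (rV_coord_measurable i)).
pose F p := (ind A p.1 * ind B (p.1 + p.2)%R)%E.
pose G p := (ind B p.1 * ind A (p.1 - p.2)%R)%E.
have ind0 C x : (0 <= ind C x)%E by rewrite /ind lee_fin.
have F0 p : (0 <= F p)%E by exact: mule_ge0.
have G0 p : (0 <= G p)%E by exact: mule_ge0.
have mF : measurable_fun setT F.
  apply: emeasurable_funM.
    exact: measurableT_comp (mind _ mA) measurable_fst.
  exact: measurableT_comp (mind _ mB) madd.
have mG : measurable_fun setT G.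
  apply: emeasurable_funM.
    exact: measurableT_comp (mind _ mB) measurable_fst.
  exact: measurableT_comp (mind _ mA) msub.
have LF : (\int[mean_count]_x \int[lebesgue_rV d]_y F (x, y) = mean_count A * lebesgue_rV d B)%E.
  rewrite (eq_integral (fun x => ind A x * lebesgue_rV d B)%E); last first.
    move=> x _; rewrite /F/= ge0_integralZl//.
    congr (_ * _)%E; rewrite -(lebesgue_rV_shift (- x) mB).
    rewrite -[X in lebesgue_rV _ X]setIT -integral_indic//; last exact: measurable_shift_set.
    apply: eq_integral => y _; rewrite /ind !indicE; congr (_%:R%:E); congr (nat_of_bool _).
    by apply/idP/idP => /set_mem/= h; apply/mem_set; move: h; rewrite /shift_set/= opprK addrC.
    exact: measurableT_comp (mind _ mB) (measurableT_comp madd (measurable_pair1 x)).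
  by rewrite ge0_integralZr//; [rewrite integral_indic// setIT|exact: mind].
have LG : (\int[mean_count]_x \int[lebesgue_rV d]_y G (x, y) = mean_count B * lebesgue_rV d A)%E.
  rewrite (eq_integral (fun x => ind B x * lebesgue_rV d A)%E); last first.
    move=> x _; rewrite /G/= ge0_integralZl//.
    congr (_ * _)%E; rewrite -(lebesgue_rV_shift x mA).
    rewrite -[X in lebesgue_rV _ X]setIT -integral_indic//; last exact: measurable_shift_set.
    apply: eq_integral => y _; rewrite /ind !indicE; congr (_%:R%:E); congr (nat_of_bool _).
    apply/idP/idP => /set_mem/= h; apply/mem_set; move: h; rewrite /shift_set/=.
      by move/symA; rewrite opprB.
    by move/symA; rewrite opprB.
    exact: measurableT_comp (mind _ mA) (measurableT_comp msub (measurable_pair1 x)).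
  by rewrite ge0_integralZr//; [rewrite integral_indic// setIT|exact: mind].
rewrite -LF -LG.
rewrite (fubini_tonelli (m1 := mean_count) (m2 := lebesgue_rV d) F mF F0).
rewrite (fubini_tonelli (m1 := mean_count) (m2 := lebesgue_rV d) G mG G0).
apply: eq_integral => y _.
(* For fixed y the two integrals over x are the masses of the intersection of A with B - y and of B
   with A + y, which are translates of each other by y. *)
have mE : measurable (A `&` shift_set (- y) B).
  by apply: measurableI => //; exact: measurable_shift_set.
transitivity (mean_count (A `&` shift_set (- y) B)).
  rewrite -[X in mean_count X]setIT -integral_indic//; apply: eq_integral => x _.
  by rewrite /F/= /ind -EFinM indicI/= -[\1_(shift_set _ _) x]/(\1_B (x - - y)) opprK.
have shE : shift_set y (A `&` shift_set (- y) B) = B `&` shift_set y A.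
  by apply/seteqP; split=> x; rewrite /shift_set/= opprK subrK => -[].
rewrite -(mean_count_shift y mE) shE -[X in mean_count X]setIT -integral_indic//; last first.
  by apply: measurableI => //; exact: measurable_shift_set.
by apply: eq_integral => x _; rewrite /G/= /ind -EFinM indicI.
Qed.

(** [mean_count_symmetric] asks for a symmetric set, and the centred cube of side 1 serves. It has
    volume 1 like [unit_cube], so the two have the same mean count. *)
Lemma mean_countE B : measurable B ->
  mean_count B = (mean_count (@unit_cube R d) * lebesgue_rV d B)%E.
Proof.
have half0 : 0 <= 2^-1 :> R by rewrite invr_ge0.
have symS (x : 'rV[R]_d) : sup_ball 2^-1 x -> sup_ball 2^-1 (- x).
  by rewrite /sup_ball/= normrN.
have E C : measurable C -> mean_count C = (mean_count (sup_ball 2^-1) * lebesgue_rV d C)%E.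
  move=> mC; rewrite (mean_count_symmetric (measurable_sup_ball _) mC symS).
  rewrite lebesgue_sup_ball// (_ : 2^-1 *+ 2 = 1) ?expr1n ?mule1//.
  by rewrite -[_ *+ 2]mulr_natr mulVf.
move=> mB; rewrite [LHS]E// [in RHS]E; last exact: measurable_unit_cube.
by rewrite lebesgue_unit_cube mule1.
Qed.

End campbell.

(** * Lattice boxes and a Vitali covering bound *)

Section lattice_boxes.
Context {d : nat}.
Local Notation Z := 'rV[int]_d.
Implicit Types (z w : Z) (n m : nat).

Definition box n : {fset Z} :=
  [fset z in [seq (\row_i ((f i : nat)%:Z - n%:Z) : Z) | f : {ffun 'I_d -> 'I_(n.*2.+1)}]]%fset.

Lemma mem_boxP z n : reflect (forall i : 'I_d, (absz (z ord0 i) <= n)%N) (z \in box n).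
Proof.
rewrite inE; apply: (iffP mapP) => [[/= f _ ->] i|zn].
  by rewrite mxE; have := ltn_ord (f i); lia.
have H i : (absz (z ord0 i + n%:Z)%R < n.*2.+1)%N by have := zn i; lia.
exists [ffun i => Ordinal (H i)]; first by rewrite mem_enum.
apply/rowP => i; rewrite mxE ffunE /=; move: (zn i); move: (z ord0 i) => a; lia.
Qed.

Lemma card_box n : #|` box n| = (n.*2.+1 ^ d)%N.
Proof.
have U : uniq [seq (\row_i ((f i : nat)%:Z - n%:Z) : Z) | f : {ffun 'I_d -> 'I_(n.*2.+1)}].
  rewrite /image_mem map_inj_uniq ?enum_uniq// => f g /rowP fg; apply/ffunP => i; apply: val_inj => /=.
  by have := fg i; rewrite !mxE; lia.
by rewrite card_fseq undup_id// size_map -cardE card_ffun !card_ord.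
Qed.

Lemma box0_in n : (0 : Z) \in box n.
Proof. by apply/mem_boxP => i; rewrite mxE. Qed.

Lemma boxN z n : z \in box n -> - z \in box n.
Proof.
move=> /mem_boxP zn; apply/mem_boxP => i; rewrite mxE.
by move: (z ord0 i) (zn i) => a; lia.
Qed.

Lemma boxD z w n m : z \in box n -> w \in box m -> z + w \in box (n + m).
Proof.
move=> /mem_boxP zn /mem_boxP wm; apply/mem_boxP => i; rewrite mxE.
by move: (z ord0 i) (w ord0 i) (zn i) (wm i) => a b; lia.
Qed.

Lemma box_le n m : (n <= m)%N -> {subset box n <= box m}.
Proof.
by move=> nm z /mem_boxP zn; apply/mem_boxP => i; exact: leq_trans (zn i) nm.
Qed.

Definition vbox z n : {fset Z} := [fset (z + w)%R | w in box n]%fset.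

Lemma mem_vbox y z n : (y \in vbox z n) = (y - z \in box n).
Proof.
apply/imfsetP/idP => [[w /= wn ->]|yz]; first by rewrite addrC addKr.
by exists (y - z) => //=; rewrite addrC subrK.
Qed.

Lemma card_vbox z n : #|` vbox z n| = (n.*2.+1 ^ d)%N.
Proof. by rewrite card_imfset ?card_box//; exact: addrI. Qed.

Context {R : realType}.
Implicit Types (F : Z -> R) (a : R).

Lemma sum_vbox F z n : \sum_(w <- vbox z n) F w = \sum_(w <- box n) F (z + w).
Proof. by rewrite big_imfset//= => x y _ _; exact: addrI. Qed.

Lemma fset_sum_split F (A V : {fset Z}) : (A `<=` V)%fset ->
  \sum_(w <- V) F w = \sum_(w <- A) F w + \sum_(w <- (V `\` A)%fset) F w.
Proof.
move=> AV; rewrite (big_fsetID _ (mem A))/=; congr (_ + _); apply: eq_fbigl => x.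
  rewrite !inE/=; have [xA|] := boolP (x \in A); rewrite ?andbF// andbT.
  by rewrite (fsubsetP AV).
by rewrite !inE/= andbC.
Qed.

(* Greedy selection: the largest remaining box is kept, and every box it meets has
   its centre in the box of twice the radius. *)
Lemma vitali_box F a (S V : {fset Z}) (rad : Z -> nat) :
  0 <= a -> (forall z, 0 <= F z) ->
  (forall z, z \in S -> a * ((rad z).*2.+1 ^ d)%:R <= \sum_(w <- vbox z (rad z)) F w) ->
  (forall z, z \in S -> (vbox z (rad z) `<=` V)%fset) ->
  a * #|` S|%:R <= (2 ^ d)%:R * \sum_(w <- V) F w.
Proof.
move=> a0 F0; have [k] := ubnP #|` S|; elim: k S V => // k IH S V Sk HS HV.
have [->|/fset0Pn[z0 z0S]] := eqVneq S fset0%fset.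
  rewrite cardfs0 mulr0 mulr_ge0//; exact: sumr_ge0.
have [z zS zmax] : exists2 z, z \in S & forall y, y \in S -> (rad y <= rad z)%N.
  have [z _ zP] := @arg_maxnP S [` z0S]%fset xpredT (fun y => rad (val y)) isT.
  by exists (val z); [exact: valP|move=> y yS; exact: (zP [` yS]%fset)].
pose W := vbox z (rad z).*2.
(* Centres in W are discarded. The remaining boxes miss the kept one, so they fit into V' and the
   sums over kept boxes add up within V. *)
pose S' := (S `\` W)%fset; pose V' := (V `\` vbox z (rad z))%fset.
have S'k : (#|` S'| < k)%N.
  apply: (leq_ltn_trans (n := #|` (S `\ z)%fset|)).
    apply: fsubset_leq_card; apply/fsubsetP => y; rewrite !inE => /andP[yW ->].
    rewrite andbT; apply: contra yW => /eqP ->.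
    by rewrite mem_vbox subrr box0_in.
  by move: Sk; rewrite (cardfsD1 z S) zS; lia.
have sS' y : y \in S' -> y \in S by rewrite inE => /andP[].
have := IH S' V' S'k (fun y yS' => HS y (sS' y yS')).
have HV' y : y \in S' -> (vbox y (rad y) `<=` V')%fset.
  move=> yS'; apply/fsubsetP => x xy; rewrite inE (fsubsetP (HV y (sS' y yS')) x xy) andbT.
  move: (yS'); rewrite inE => /andP[yW _]; apply: contra yW => xz.
  rewrite mem_vbox (_ : y - z = - (x - y) + (x - z)); last by rewrite opprB addrA subrK.
  rewrite mem_vbox in xy; rewrite mem_vbox in xz.
  apply: (@box_le (rad y + rad z)); last exact: boxD (boxN xy) xz.
  by have := zmax y (sS' y yS'); lia.
move=> /(_ HV') IHS.
(* Origin of the factor 2^d: with r the kept radius, W has (4r + 1)^d points, at most 2^d (2r +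
   1)^d. *)
have cS : (#|` S| <= #|` S'| + 2 ^ d * (rad z).*2.+1 ^ d)%N.
  rewrite -(cardfsID W S) addnC leq_add2l.
  apply: (leq_trans (fsubset_leq_card (fsubsetIr S W))).
  rewrite card_vbox -expnMn; move: (rad z) => r.
  by case: (d) => // k'; rewrite leq_exp2r//; lia.
rewrite (fset_sum_split F (HV z zS)) mulrDr.
apply: (@le_trans _ _ (a * (#|` S'|%:R + (2 ^ d)%:R * ((rad z).*2.+1 ^ d)%:R))).
  by rewrite ler_wpM2l// -natrM -natrD ler_nat.
rewrite mulrDr addrC lerD// mulrCA ler_wpM2l//.
exact: HS.
Qed.

Definition beta n : R := (n.*2.+1 ^ d)%:R.

Lemma beta_gt0 n : 0 < beta n.
Proof. by rewrite ltr0n expn_gt0. Qed.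

(** Boxes form a Folner sequence: a layer of fixed thickness is negligible against the box, so the
    boundary terms of box averages vanish in the limit. *)
Lemma beta_ratio m : beta (n + m) / beta n @[n --> \oo] --> (1 : R).
Proof.
have E n : beta (n + m) / beta n = (1 + 2 * m%:R / n.*2.+1%:R) ^+ d.
  rewrite /beta !natrX -expr_div_n; congr (_ ^+ _).
  have -> : ((n + m).*2.+1%:R : R) = n.*2.+1%:R + 2 * m%:R.
    by rewrite -natrM -natrD; congr (_%:R); lia.
  by rewrite mulrDl divff// pnatr_eq0.
rewrite (funext E).
have C : (1 + 2 * m%:R / n.*2.+1%:R : R) @[n --> \oo] --> (1 : R).
  rewrite -[X in _ --> X]addr0; apply: cvgD; first exact: cvg_cst.
  rewrite -[X in _ --> X](mulr0 (2 * m%:R)); apply: cvgMr.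
  apply/gtr0_cvgV0; first by near=> n; rewrite ltr0n.
  apply/cvgryPge => M; near=> n.
  have : M <= n%:R by near: n; exact: nbhs_infty_ger.
  by move=> /le_trans; apply; rewrite ler_nat; lia.
by have := cvg_comp _ _ C (@exprn_continuous _ d 1); rewrite expr1n.
Unshelve. all: by end_near. Qed.

Lemma sum_sub_bounds F (A V : {fset Z}) (K : R) : (forall z, 0 <= F z <= K) -> (A `<=` V)%fset ->
  \sum_(w <- V) F w - K * (#|` V|%:R - #|` A|%:R) <= \sum_(w <- A) F w <= \sum_(w <- V) F w.
Proof.
move=> FK AV; rewrite (fset_sum_split F AV) lerDl.
have -> : (#|` V|%:R - #|` A|%:R : R) = #|` (V `\` A)%fset|%:R.
  by rewrite cardfsDS// natrB// fsubset_leq_card.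
rewrite lerBlDr lerD2l sumr_ge0 ?andbT => [|z _]; last by case/andP: (FK z).
apply: (@le_trans _ _ (\sum_(w <- (V `\` A)%fset) K)).
  by apply: ler_sum => z _; case/andP: (FK z).
by rewrite big_const_seq count_predT iter_addr addr0 mulr_natr.
Qed.

(** The box and its shift by w both lie in the box of radius n + m, and each sum falls short of the
    sum over that box by at most K per missed point. *)
Lemma box_osc F n m w (K : R) : (forall z, 0 <= F z <= K) -> w \in box m ->
  `|\sum_(z <- box n) F (w + z) - \sum_(z <- box n) F z| <= K * (beta (n + m) - beta n).
Proof.
move=> FK wm.
have s1 : (box n `<=` box (n + m))%fset by apply/fsubsetP; apply: box_le; lia.
have s2 : (vbox w n `<=` box (n + m))%fset.
  apply/fsubsetP => y; rewrite mem_vbox => yn.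
  by rewrite -(subrK w y); exact: boxD.
have := sum_sub_bounds FK s1; have := sum_sub_bounds FK s2.
rewrite sum_vbox !card_box card_vbox -/(beta _) -/(beta _).
set A := \sum_(_ <- _) _; set B := \sum_(_ <- _) _; set C := \sum_(_ <- _) _.
by move=> /andP[? ?] /andP[? ?]; rewrite ler_distl; apply/andP; split; lra.
Qed.

End lattice_boxes.
Arguments beta d {R} n.

(** * The maximal inequality *)

Section lattice_action.
Context {d : nat} {dT : measure_display} {T : measurableType dT} {R : realType}.
Variables (P : probability T R) (tau : 'rV[int]_d -> T -> T).
Hypothesis mtau : forall z, measurable_fun setT (tau z).
Hypothesis tauD : forall z w x, tau z (tau w x) = tau (z + w) x.
Hypothesis Ptau : forall z F, measurable F -> P (tau z @^-1` F) = P F.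
Implicit Types (f g : T -> R) (x : T).

Lemma integral_tau (f : T -> \bar R) z : measurable_fun setT f -> (forall x, 0 <= f x)%E ->
  (\int[P]_x f (tau z x) = \int[P]_x f x)%E.
Proof.
move=> mf f0; rewrite -(@ge0_integral_pushforward _ _ _ _ _ _ (mtau z) P setT f)//.
apply: (@eq_measure_integral _ _ _ _ P
  (measure_function_pushforward__canonical__measure_function_Measure P (mtau z))) => F mF _.
exact: Ptau.
Qed.

Definition box_sum g n x : R := \sum_(z <- box n) g (tau z x).

Lemma measurable_box_sum g n : measurable_fun setT g -> measurable_fun setT (box_sum g n).
Proof. by move=> mg; apply: measurable_sum => z; exact: measurableT_comp mg (mtau z). Qed.

Lemma box_sum_tau g n z x : box_sum g n (tau z x) = \sum_(w <- vbox z n) g (tau w x).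
Proof. by rewrite sum_vbox; apply: eq_bigr => w _; rewrite tauD addrC. Qed.

Lemma integral_box_sum g n : measurable_fun setT g -> (forall x, 0 <= g x) ->
  (\int[P]_x (box_sum g n x)%:E = (beta d n)%:E * \int[P]_x (g x)%:E)%E.
Proof.
move=> mg g0; rewrite /box_sum; under eq_integral do rewrite -sumEFin.
have mgz z : measurable_fun setT (fun x => (g (tau z x))%:E).
  by apply/measurable_EFinP; exact: measurableT_comp mg (mtau z).
rewrite ge0_integral_sum//; last by move=> z x _; rewrite lee_fin.
rewrite (eq_bigr (fun=> \int[P]_x (g x)%:E)%E); last first.
  move=> z _; apply: (@integral_tau (fun x => (g x)%:E)) => [|x]; last by rewrite lee_fin.
  exact/measurable_EFinP.
rewrite big_const_seq count_predT -[size _]/(#|` box n|) card_box /beta.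
set I := (\int[P]_x _)%E; elim: (_ ^ _)%N => [|k IH] /=; first by rewrite mul0e.
by rewrite IH -addn1 natrD EFinD ge0_muleDl ?lee_fin// mul1e addeC.
Qed.

Section maximal.
Variables (g : T -> R) (a : R).
Hypotheses (mg : measurable_fun setT g) (g0 : forall x, 0 <= g x) (a0 : 0 <= a).

(** Radii are cut at K so that boxes centred in [box L] stay inside [box (L + K)]: the covering
    argument needs a finite window. *)
Let bad K := [set x | exists2 n, (n < K)%N & a * beta d n <= box_sum g n x].

Let measurable_bad K : measurable (bad K).
Proof.
rewrite (_ : bad K = \bigcup_(n in `I_K) [set x | a * beta d n <= box_sum g n x]).
  apply: bigcup_measurable => n _; rewrite -[X in measurable X]setTI.
  exact: measurable_fun_le (measurable_cst _) (measurable_box_sum n mg).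
by apply/seteqP; split=> x [n nK h]; exists n.
Qed.

(** Transference: along the orbit of x, the bad times in [box L] are the centres to which
    [vitali_box] applies, with F z = g (tau z x). *)
Let bad_pointwise K L x :
  a * \sum_(z <- box L) \1_(bad K) (tau z x) <= (2 ^ d)%:R * box_sum g (L + K) x.
Proof.
pose S := [fset z in box L | tau z x \in bad K]%fset.
have -> : \sum_(z <- box L) \1_(bad K) (tau z x) = #|` S|%:R :> R.
  rewrite card_fset_sum1 natr_sum /S.
  transitivity (\sum_(z <- box L | tau z x \in bad K) (1 : R)); last first.
    by rewrite big_fset_condE.
  rewrite [RHS]big_mkcond/=; apply: eq_bigr => z _.
  by rewrite indicE; case: (_ \in _).
pose Q z := [set n | (n < K)%N /\ a * beta d n <= box_sum g n (tau z x)].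
pose rad z := xget 0%N (Q z).
have radP z : z \in S -> Q z (rad z).
  rewrite !inE/= => /andP[_ /set_mem[n nK h]]; apply: xgetPex; by exists n.
apply: (@vitali_box _ _ (fun z => g (tau z x)) _ S (box (L + K)) rad) => //.
  by move=> z /radP[_]; rewrite box_sum_tau.
move=> z zS; apply/fsubsetP => y; rewrite mem_vbox => yz.
have zL : z \in box L by move: zS; rewrite !inE => /andP[].
rewrite -(subrK z y) addrC; apply: boxD => //; apply: box_le yz.
by have [/ltnW] := radP _ zS.
Qed.

Let bad_le K L : (a%:E * ((beta d L)%:E * P (bad K)) <=
  (2 ^ d)%:R%:E * ((beta d (L + K))%:E * \int[P]_x (g x)%:E))%E.
Proof.
have mI : measurable_fun setT (\1_(bad K) : T -> R) by exact: measurable_indic.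
rewrite -(integral_box_sum _ mg g0).
have <- : (\int[P]_x (\1_(bad K) x)%:E = P (bad K))%E by rewrite integral_indic// setIT.
rewrite -(integral_box_sum _ mI)//.
rewrite -!ge0_integralZl_EFin//; last 4 first.
- by move=> x _; rewrite lee_fin sumr_ge0.
- exact/measurable_EFinP/measurable_box_sum.
- by move=> x _; rewrite lee_fin sumr_ge0.
- exact/measurable_EFinP/measurable_box_sum.
apply: ge0_le_integral => //.
- by move=> x _; rewrite -EFinM lee_fin mulr_ge0// sumr_ge0.
- by apply: measurable_funeM; exact/measurable_EFinP/measurable_box_sum.
- by apply: measurable_funeM; exact/measurable_EFinP/measurable_box_sum.
by move=> x _; rewrite -!EFinM lee_fin; exact: bad_pointwise.
Qed.

Hypothesis ig : (\int[P]_x (g x)%:E < +oo)%E.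

(** For fixed K the ratio of the box sizes in [bad_le] tends to 1 as L grows, which leaves a bound
    independent of K; the events [bad K] increase with K to the full one. *)
Lemma lattice_maximal_inequality :
  (a%:E * P [set x | exists n, (a * beta d n <= box_sum g n x)%R] <=
   (2 ^ d)%:R%:E * \int[P]_x (g x)%:E)%E.
Proof.
set I := (\int[P]_x _)%E; have igI : (I < +oo)%E := ig.
have I0 : (0 <= I)%E by apply: integral_ge0 => x _; rewrite lee_fin.
have badK K : (a%:E * P (bad K) <= (2 ^ d)%:R%:E * I)%E.
  have If : I = (fine I)%:E by rewrite fineK// ge0_fin_numE.
  have Pf : P (bad K) = (fine (P (bad K)))%:E by rewrite fineK// fin_num_measure.
  rewrite If Pf -!EFinM lee_fin.
  have H L : a * fine (P (bad K)) <= (2 ^ d)%:R * fine I * (beta d (L + K) / beta d L).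
    have := bad_le K L; rewrite -/I If Pf -!EFinM lee_fin => H.
    rewrite mulrA ler_pdivlMr ?beta_gt0// mulrC; lra.
  have C : (2 ^ d)%:R * fine I * (beta d (L + K) / beta d L) @[L --> \oo] --> (2 ^ d)%:R * fine I * 1.
    by apply: cvgMr; exact: beta_ratio.
  rewrite -(mulr1 (_ * fine I)) -(cvg_lim _ C)//; apply: limr_ge; first by apply/cvg_ex; eexists; exact: C.
  by near=> L.
have -> : [set x | exists n, a * beta d n <= box_sum g n x] = \bigcup_K bad K.
  by apply/seteqP; split=> [x [n h]|x [K _ [n _ h]]]; [exists n.+1 => //; exists n|exists n].
have nd : nondecreasing_seq bad.
  move=> K K' KK'; apply/subsetPset => x [n nK h]; exists n => //; exact: leq_trans nK KK'.
have C : (P (bad K) @[K --> \oo] --> P (\bigcup_K bad K))%E.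
  by apply: nondecreasing_cvg_mu => //; exact: bigcupT_measurable.
have C' : (a%:E * P (bad K) @[K --> \oo] --> a%:E * P (\bigcup_K bad K))%E.
  by apply: cvgeZl.
rewrite -(cvg_lim _ C')//; apply: lime_le; first by apply/cvg_ex; eexists; exact: C'.
by near=> K; exact: badK.
Unshelve. all: by end_near. Qed.

End maximal.
End lattice_action.

(** * Expectations of bounded measurable functions *)

Section rintegral_bounded.
Context {dT : measure_display} {T : measurableType dT} {R : realType} (P : probability T R).
Implicit Types (f g h : T -> R).
Local Notation E f := (Rintegral P setT f).

Definition bounded_measurable f := measurable_fun setT f /\ exists C, forall x, `|f x| <= C.

Lemma bounded_measurable_integrable f : bounded_measurable f -> P.-integrable setT (EFin \o f).
Proof.
move=> [mf [C fC]]; apply: (@le_integrable _ _ _ P setT _ _ (EFin \o cst C)) => //.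
- exact/measurable_EFinP.
- move=> x _ /=; rewrite lee_fin (le_trans (fC x))// ler_norm//.
- by apply: finite_measure_integrable_cst.
Qed.

Lemma bm_cst c : bounded_measurable (cst c).
Proof. by split => //; exists `|c|. Qed.

Lemma bmD f g : bounded_measurable f -> bounded_measurable g ->
  bounded_measurable (fun x => f x + g x).
Proof.
move=> [mf [C fC]] [mg [D gD]]; split; first exact: measurable_funD.
by exists (C + D) => x; apply: (le_trans (ler_normD _ _)); exact: lerD.
Qed.

Lemma bmM f g : bounded_measurable f -> bounded_measurable g ->
  bounded_measurable (fun x => f x * g x).
Proof.
move=> [mf [C fC]] [mg [D gD]]; split; first exact: measurable_funM.
by exists (C * D) => x; rewrite normrM ler_pM.
Qed.

Lemma bmB f g : bounded_measurable f -> bounded_measurable g ->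
  bounded_measurable (fun x => f x - g x).
Proof.
move=> [mf [C fC]] [mg [D gD]]; split; first exact: measurable_funB.
by exists (C + D) => x; apply: (le_trans (ler_normB _ _)); exact: lerD.
Qed.

Lemma bmZ c f : bounded_measurable f -> bounded_measurable (fun x => c * f x).
Proof. by move=> bf; apply: bmM => //; exact: bm_cst. Qed.

Lemma bm_norm f : bounded_measurable f -> bounded_measurable (fun x => `|f x|).
Proof.
move=> [mf [C fC]]; split; first exact: measurableT_comp mf.
by exists C => x; rewrite normr_id.
Qed.

Lemma bm_sum (I : Type) (s : seq I) (F : I -> T -> R) : (forall i, bounded_measurable (F i)) ->
  bounded_measurable (fun x => \sum_(i <- s) F i x).
Proof.
move=> bF; elim: s => [|i s IH].
  by under eq_fun do rewrite big_nil; exact: bm_cst.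
by under eq_fun do rewrite big_cons; exact: bmD.
Qed.

Lemma meanD f g : bounded_measurable f -> bounded_measurable g ->
  E (fun x => f x + g x) = E f + E g.
Proof. by move=> bf bg; rewrite RintegralD//; exact: bounded_measurable_integrable. Qed.

Lemma meanB f g : bounded_measurable f -> bounded_measurable g ->
  E (fun x => f x - g x) = E f - E g.
Proof. by move=> bf bg; rewrite RintegralB//; exact: bounded_measurable_integrable. Qed.

Lemma meanZ c f : bounded_measurable f -> E (fun x => c * f x) = c * E f.
Proof. by move=> bf; rewrite RintegralZl//; exact: bounded_measurable_integrable. Qed.

Lemma mean_cst c : E (fun=> c) = c.
Proof. by rewrite Rintegral_cst//= probability_setT mulr1. Qed.

Lemma mean_le f g : bounded_measurable f -> bounded_measurable g ->
  (forall x, f x <= g x) -> E f <= E g.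
Proof. by move=> bf bg fg; apply: le_Rintegral => //; exact: bounded_measurable_integrable. Qed.

Lemma mean_sum (I : Type) (s : seq I) (F : I -> T -> R) : (forall i, bounded_measurable (F i)) ->
  E (fun x => \sum_(i <- s) F i x) = \sum_(i <- s) E (F i).
Proof.
move=> bF; elim: s => [|i s IH].
  by under eq_Rintegral do rewrite big_nil; rewrite mean_cst big_nil.
under eq_Rintegral do rewrite big_cons.
by rewrite meanD ?IH ?big_cons//; exact: bm_sum.
Qed.

Lemma mean_EFin f : bounded_measurable f -> (\int[P]_x (f x)%:E)%E = (E f)%:E.
Proof.
move=> bf; rewrite /Rintegral fineK//.
by apply: integrable_fin_num => //; exact: bounded_measurable_integrable.
Qed.

End rintegral_bounded.

(** Cauchy-Schwarz against the constant 1. With a the new term, the cross term obeys 2 a S <= n a^2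
    + Q, because the squares of the two sides differ by 4 a^2 (n Q - S^2) + (n a^2 - Q)^2. *)
Lemma sum_sqr_le (R : realFieldType) (I : Type) (s : seq I) (F : I -> R) :
  (\sum_(i <- s) F i) ^+ 2 <= (size s)%:R * \sum_(i <- s) F i ^+ 2.
Proof.
elim: s => [|i s IH]; first by rewrite !big_nil expr0n mulr0.
rewrite !big_cons /=; set S := \sum_(_ <- _) _ in IH *; set Q := \sum_(_ <- _) _ in IH *.
have Q0 : 0 <= Q by apply: sumr_ge0 => j _; exact: sqr_ge0.
set n : R := (size s)%:R in IH *; have n0 : 0 <= n by rewrite ler0n.
have H : 2 * (F i * S) <= n * F i ^+ 2 + Q.
  apply: (le_trans (ler_norm _)).
  have H0 : 0 <= n * F i ^+ 2 + Q by rewrite addr_ge0// mulr_ge0// sqr_ge0.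
  rewrite -(@ler_pXn2r _ 2)// real_normK ?num_real//.
  have h1 : 0 <= F i ^+ 2 * (n * Q - S ^+ 2) by rewrite mulr_ge0 ?sqr_ge0// subr_ge0.
  have h2 : 0 <= (n * F i ^+ 2 - Q) ^+ 2 by exact: sqr_ge0.
  by rewrite -subr_ge0 (_ : _ - _ = 4 * (F i ^+ 2 * (n * Q - S ^+ 2)) + (n * F i ^+ 2 - Q) ^+ 2);
    [lra|ring].
have -> : ((size s).+1%:R : R) = n + 1.
  by rewrite -addn1 natrD.
rewrite sqrrD -mulr_natl; lra.
Qed.

(** * The mean ergodic theorem *)

Section mean_ergodic.
Context {d : nat} {dT : measure_display} {T : measurableType dT} {R : realType}.
Variables (P : probability T R) (tau : 'rV[int]_d -> T -> T).
Hypothesis mtau : forall z, measurable_fun setT (tau z).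
Hypothesis tauD : forall z w x, tau z (tau w x) = tau (z + w) x.
Hypothesis Ptau : forall z F, measurable F -> P (tau z @^-1` F) = P F.
Implicit Types (f g c : T -> R) (x : T).
Local Notation E f := (Rintegral P setT f).
Local Notation bm := bounded_measurable.
Local Notation bsum := (box_sum tau).

Definition box_avg f n x : R := bsum f n x / beta d n.

Lemma box_avg_itv f K n x : (forall y, 0 <= f y <= K) -> 0 <= box_avg f n x <= K.
Proof.
move=> fK; have b0 := @beta_gt0 d R n; rewrite /box_avg.
apply/andP; split.
  by rewrite divr_ge0 ?(ltW b0)//; apply: sumr_ge0 => z _; case/andP: (fK (tau z x)).
rewrite ler_pdivrMr//; apply: (@le_trans _ _ (\sum_(z <- box n) K)).
  by apply: ler_sum => z _; case/andP: (fK (tau z x)).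
by rewrite big_const_seq count_predT iter_addr addr0 -[size _]/(#|` box n|) card_box mulr_natr.
Qed.

Lemma bm_tau f z : bm f -> bm (fun x => f (tau z x)).
Proof. by move=> [mf [C fC]]; split; [exact: measurableT_comp mf (mtau z)|exists C]. Qed.

Lemma mean_tau f z : bm f -> E (fun x => f (tau z x)) = E f.
Proof.
move=> bf; have [mf [C fC]] := bf.
pose g x := f x + C.
have bg : bm g by apply: bmD => //; exact: bm_cst.
have g0 x : 0 <= g x by have := fC x; rewrite ler_norml /g => /andP[]; lra.
have H : E (fun x => g (tau z x)) = E g.
  congr fine; apply: (@integral_tau _ _ _ _ _ _ mtau Ptau (fun x => (g x)%:E)).
    by apply/measurable_EFinP; case: bg.
  by move=> x; rewrite lee_fin.
move: H; rewrite meanD//; last 2 first.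
- exact: bm_tau.
- exact: bm_cst.
by rewrite meanD//; [move/addIr|exact: bm_cst].
Qed.

Lemma bm_box_avg f n : bm f -> bm (box_avg f n).
Proof.
move=> bf; rewrite /box_avg /box_sum.
under eq_fun do rewrite mulrC.
by apply: bmZ; apply: bm_sum => z; exact: bm_tau.
Qed.

Lemma mean_box_avg f n : bm f -> E (box_avg f n) = E f.
Proof.
move=> bf; rewrite /box_avg /box_sum.
under eq_Rintegral do rewrite mulrC.
rewrite meanZ; last by apply: bm_sum => z; exact: bm_tau.
rewrite mean_sum; last by move=> z; exact: bm_tau.
rewrite (eq_bigr (fun=> E f)); last by move=> z _; exact: mean_tau.
rewrite big_const_seq count_predT iter_addr addr0 -[size _]/(#|` box n|) card_box.
by rewrite -mulr_natl mulrA mulVf ?mul1r// gt_eqF// beta_gt0.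
Qed.

(** Averaging is a contraction in L^2: Cauchy-Schwarz pointwise, then invariance of the mean. *)
Lemma mean_sqr_box_avg f n : bm f -> E (fun x => box_avg f n x ^+ 2) <= E (fun x => f x ^+ 2).
Proof.
move=> bf.
have bf2 : bm (fun x => f x ^+ 2) by exact: bmM.
rewrite -(mean_box_avg n bf2); apply: mean_le.
- by apply: bmM; exact: bm_box_avg.
- exact: bm_box_avg.
move=> x; rewrite /box_avg expr_div_n ler_pdivrMr ?exprn_gt0 ?beta_gt0//.
rewrite mulrAC -mulrA expr2 -mulrA divff ?mulr1 ?gt_eqF ?beta_gt0// mulrC.
rewrite -expr2 mulrC.
by apply: (le_trans (sum_sqr_le _ _)); rewrite -[size _]/(#|` box n|) card_box.
Qed.

Variables (f : T -> R) (K : R).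
Hypotheses (mf : measurable_fun setT f) (fK : forall x, 0 <= f x <= K).

Let K0 : 0 <= K.
Proof. by have /andP[h1 h2] := fK point; exact: le_trans h1 h2. Qed.

Let bf : bm f.
Proof.
by split => //; exists K => x; have /andP[? ?] := fK x; rewrite ger0_norm.
Qed.

Let A n := box_avg f n.

Let AK n x : 0 <= A n x <= K. Proof. exact: box_avg_itv. Qed.

Let bA n : bm (A n). Proof. exact: bm_box_avg. Qed.

Definition osc n m : R := K * (beta d (n + m) / beta d n - 1).

Lemma osc_cvg m : osc n m @[n --> \oo] --> (0 : R).
Proof.
rewrite -[X in _ --> X](mulr0 K) -(subrr 1); apply: cvgMr; apply: cvgB; last exact: cvg_cst.
exact: beta_ratio.
Qed.

Lemma osc_near m e : 0 < e -> exists N, forall n, (N <= n)%N -> osc n m < e.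
Proof.
move=> e0; have /cvgrPdist_lt/(_ e e0)[N _ NP] := osc_cvg m.
by exists N => n Nn; have := NP n Nn; rewrite sub0r normrN => /ltr_normlW.
Qed.

Lemma oscE n m : osc n m = K * (beta d (n + m) - beta d n) / beta d n.
Proof. by rewrite /osc -mulrA mulrBl divff// gt_eqF// beta_gt0. Qed.

Let A_tau n m w x : w \in box m -> `|A n (tau w x) - A n x| <= osc n m.
Proof.
move=> wm; rewrite /A /box_avg -mulrBl normrM normfV [X in _ / X]gtr0_norm ?beta_gt0//.
rewrite oscE ler_pM2r ?invr_gt0 ?beta_gt0//.
have := @box_osc d R (fun z => f (tau z x)) n m w K (fun z => fK _) wm.
by congr (`|_ - _| <= _); apply: eq_bigr => z _; rewrite tauD addrC.
Qed.

(** Exchanging the two averages writes the left one as the mean over w in [box m] of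
    [A n (tau w x)], each term of which is close to [A n x]. *)
Let A_A n m x : `|box_avg (A m) n x - A n x| <= osc n m.
Proof.
have b0 := @beta_gt0 d R m; have b1 := @beta_gt0 d R n.
have -> : box_avg (A m) n x = (\sum_(w <- box m) A n (tau w x)) / beta d m.
  rewrite /A /box_avg /box_sum /box_avg /box_sum -!mulr_suml [RHS]mulrAC; congr (_ / _ / _).
  rewrite exchange_big/=; apply: eq_bigr => w _; apply: eq_bigr => z _.
  by rewrite !tauD addrC.
have E1 : A n x = (\sum_(w <- @box d m) A n x) / beta d m.
  rewrite big_const_seq count_predT iter_addr addr0 -[size _]/(#|` box m|) card_box.
  by rewrite -[_ *+ _]mulr_natr mulfK// gt_eqF.
rewrite E1 -mulrBl -sumrB normrM normfV [X in _ / X]gtr0_norm// ler_pdivrMr//.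
apply: (le_trans (ler_norm_sum _ _ _)).
apply: (@le_trans _ _ (\sum_(w <- box m) osc n m)).
  by rewrite big_seq [leRHS]big_seq; apply: ler_sum => w wm; exact: A_tau.
by rewrite big_const_seq count_predT iter_addr addr0 -[size _]/(#|` box m|) card_box mulr_natr.
Qed.

Let a n := E (fun x => A n x ^+ 2).

Let bsq g : bm g -> bm (fun x => g x ^+ 2). Proof. by move=> bg; exact: bmM. Qed.

(** The contraction bounds the norm of the averages of c by that of c; passing from them to [A r]
    costs at most 2 K e, since a difference of squares factors and all values lie in [0, K]. *)
Let a_le c r e : bm c -> (forall x, 0 <= box_avg c r x <= K) ->
  (forall x, `|box_avg c r x - A r x| <= e) -> a r <= E (fun x => c x ^+ 2) + 2 * K * e.
Proof.
move=> bc cK ce.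
have bcr : bm (box_avg c r) by exact: bm_box_avg.
apply: (@le_trans _ _ (E (fun x => box_avg c r x ^+ 2) + 2 * K * e)); last first.
  by rewrite lerD2r; exact: mean_sqr_box_avg.
rewrite -(mean_cst P (2 * K * e)) -meanD; [|exact: bsq|exact: bm_cst].
apply: mean_le; [exact: bsq|by apply: bmD; [exact: bsq|exact: bm_cst]|].
move=> x; have /andP[h1 h2] := AK r x; have /andP[h3 h4] := cK x.
have := ce x; rewrite ler_norml => /andP[h5 h6].
have e0 : 0 <= e by exact: le_trans (normr_ge0 _) (ce x).
rewrite -lerBlDl subr_sqr.
apply: (@le_trans _ _ (e * (A r x + box_avg c r x))).
  by rewrite ler_wpM2r ?addr_ge0//; lra.
rewrite mulrC ler_wpM2r//; lra.
Qed.

Let m := inf [set a n | n in [set: nat]].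

Let a0 n : 0 <= a n.
Proof. by apply: Rintegral_ge0 => x _; exact: sqr_ge0. Qed.

Let hm : has_inf [set a n | n in [set: nat]].
Proof. by split; [exists (a 0%N), 0%N|exists 0 => _ [n _ <-]; exact: a0]. Qed.

Let m_le n : m <= a n.
Proof. by apply: ge_inf; [case: hm|exists n]. Qed.

(** The whole tail of norms is near the infimum, not only a subsequence: [A n] is nearly an average
    of a fixed [A p], and averaging does not increase the norm. *)
Let a_near e : 0 < e -> exists N, forall n, (N <= n)%N -> a n <= m + e.
Proof.
move=> e0; have e20 : 0 < e / 2 by rewrite divr_gt0.
have [_ [p _ <-] ap] := inf_adherent e20 hm.
have Ke : 0 < e / 2 / (2 * K + 1) by rewrite divr_gt0//; have := K0; lra.
have [N NP] := osc_near p Ke.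
exists N => n Nn; apply: (@le_trans _ _ (a p + 2 * K * osc n p)).
  apply: (@a_le (A p) n (osc n p)) => // x; exact: box_avg_itv.
have : osc n p * (2 * K + 1) < e / 2.
  by rewrite -ltr_pdivlMr; [exact: NP|have := K0; lra].
have [h0|h0] := leP 0 (osc n p); first by rewrite /m; lra.
have : 2 * K * osc n p <= 0 by rewrite mulr_ge0_le0 ?(ltW h0)// mulr_ge0.
rewrite /m; lra.
Qed.

(* Parallelogram identity: [A p] and [A q] almost minimize the norm, and so does
   their mean. *)
Let A_cauchy e : 0 < e -> exists N, forall p q, (N <= p)%N -> (N <= q)%N ->
  E (fun x => (A p x - A q x) ^+ 2) <= e.
Proof.
(* The parallelogram identity leaves 2 (m + e/4) + 2 (m + e/4) - 4 m = e. *)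
move=> e0; have e40 : 0 < e / 4 by rewrite divr_gt0.
have [N NP] := a_near e40; exists N => p q Np Nq.
pose c x := 2^-1 * (A p x + A q x).
have bc : bm c by apply: bmZ; exact: bmD.
have cK x : 0 <= c x <= K by have := AK p x; have := AK q x; rewrite /c; lra.
have cE r x : box_avg c r x = 2^-1 * (box_avg (A p) r x + box_avg (A q) r x).
  by rewrite /box_avg /box_sum -mulr_sumr big_split/= -mulrA mulrDl.
(* For large r the box averages of c are close to [A r], whose squared norm is at least m; the
   contraction carries this bound over to c. *)
have mc : m <= E (fun x => c x ^+ 2).
  apply/ler_addgt0Pr => e1 e10.
  have Ke : 0 < e1 / (2 * K + 1) by rewrite divr_gt0//; have := K0; lra.
  have [M1 M1P] := osc_near p Ke; have [M2 M2P] := osc_near q Ke.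
  pose r := maxn M1 M2; pose e2 := e1 / (2 * K + 1).
  apply: (le_trans (m_le r)); apply: (@le_trans _ _ (E (fun x => c x ^+ 2) + 2 * K * e2)).
    apply: a_le => // x; first exact: box_avg_itv.
    have := A_A r p x; have := A_A r q x.
    have := M1P r (leq_maxl _ _); have := M2P r (leq_maxr _ _).
    rewrite -/e2 cE !ler_norml => ? ? /andP[? ?] /andP[? ?]; apply/andP; split; lra.
  rewrite lerD2l /e2 mulrA ler_pdivrMr; last by have := K0; lra.
  rewrite mulrC ler_wpM2l ?ltW//; lra.
have -> : E (fun x => (A p x - A q x) ^+ 2) =
    E (fun x => 2 * A p x ^+ 2 + 2 * A q x ^+ 2 - 4 * c x ^+ 2).
  by apply: eq_Rintegral => x _; rewrite /c; field.
rewrite (@meanB _ _ _ P (fun x => 2 * A p x ^+ 2 + 2 * A q x ^+ 2) (fun x => 4 * c x ^+ 2)); last 2 first.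
- by apply: bmD; apply: bmZ; exact: bsq.
- by apply: bmZ; exact: bsq.
rewrite (@meanD _ _ _ P (fun x => 2 * A p x ^+ 2) (fun x => 2 * A q x ^+ 2)); last 2 first.
- by apply: bmZ; exact: bsq.
- by apply: bmZ; exact: bsq.
rewrite (@meanZ _ _ _ P _ (fun x => A p x ^+ 2)); last exact: bsq.
rewrite (@meanZ _ _ _ P _ (fun x => A q x ^+ 2)); last exact: bsq.
rewrite (@meanZ _ _ _ P _ (fun x => c x ^+ 2)); last exact: bsq.
have := NP p Np; have := NP q Nq; rewrite /a; lra.
Qed.

(* [sigma] stands for the translations of the whole space, of which [tau] is only
   the lattice part. *)
Variables (I : Type) (sigma : I -> T -> T).
Hypothesis sigma_osc : forall t, exists m, forall n x,
  `|bsum f n (sigma t x) - bsum f n x| <= K * (beta d (n + m) - beta d n).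
Hypothesis erg : forall F, measurable F -> (forall t, sigma t @^-1` F = F) ->
  P F = 0%E \/ P F = 1%E.

(** Along a subsequence with summable L^1 increments, the sum r of the increments controls the
    distance from [u 0] to all later terms. The zero-one law for the event that the upper limit
    reaches l + 3 e1 turns this into an upper bound for [u 0]; as [u 0] has mean l, an upper bound
    alone controls its L^1 distance to l. *)
Lemma mean_ergodic e : 0 < e -> exists N, E (fun x => `|A N x - E f|) <= e.
Proof.
move=> e0.
(* The final estimate collects 6 e1 from twice the threshold 3 e1 and 2 e1 from twice the integral
   of r. *)
pose e1 := e / 8; have e10 : 0 < e1 by rewrite divr_gt0.
pose ek k := e1 / (2 ^ k.+1)%:R.
have ek0 k : 0 < ek k by rewrite divr_gt0// ltr0n expn_gt0.
have /choice[N NP] k := A_cauchy (exprn_gt0 2 (ek0 k)).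
(* [n k] is at least every N i with i <= k, which makes consecutive terms close, and at least k, so
   that the radii tend to infinity. *)
pose n k := (k + \sum_(i < k.+1) N i)%N.
have nk k : (k <= n k)%N by rewrite leq_addr.
have Nn k j : (k <= j)%N -> (N k <= n j)%N.
  move=> kj; apply: leq_trans (leq_addl _ _).
  have kj' : (k < j.+1)%N by [].
  by rewrite (bigD1 (Ordinal kj'))//= leq_addr.
pose u k := A (n k).
have u1 k : E (fun x => `|u k x - u k.+1 x|) <= ek k.
  have H : E (fun x => (u k x - u k.+1 x) ^+ 2) <= ek k ^+ 2.
    by apply: NP; apply: Nn.
  have bu : bm (fun x => u k x - u k.+1 x) by exact: (bmB (bA _) (bA _)).
  (* From L^2 to L^1 by t <= t^2 / (2 s) + s / 2 with s = [ek k]. *)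
  apply: (@le_trans _ _ (E (fun x => (2 * ek k)^-1 * (u k x - u k.+1 x) ^+ 2 + ek k / 2))).
    apply: mean_le; [exact: bm_norm|apply: bmD; [apply: bmZ; exact: bsq|exact: bm_cst]|].
    move=> x; rewrite -(real_normK (num_real (u k x - u k.+1 x))); set t := `|_|.
    have -> : (2 * ek k)^-1 * t ^+ 2 + ek k / 2 = t + (2 * ek k)^-1 * (t - ek k) ^+ 2.
      by field; rewrite gt_eqF.
    by rewrite lerDl mulr_ge0 ?sqr_ge0// invr_ge0 mulr_ge0// ltW.
  rewrite (@meanD _ _ _ P (fun x => (2 * ek k)^-1 * (u k x - u k.+1 x) ^+ 2) (fun=> ek k / 2)); last 2 first.
  - by apply: bmZ; exact: bsq.
  - exact: bm_cst.
  rewrite (@meanZ _ _ _ P _ (fun x => (u k x - u k.+1 x) ^+ 2)) ?mean_cst; last exact: bsq.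
  rewrite [leRHS](_ : _ = (2 * ek k)^-1 * ek k ^+ 2 + ek k / 2); last by field; rewrite gt_eqF.
  by rewrite lerD2r ler_wpM2l// invr_ge0 mulr_ge0// ltW.
pose r x : \bar R := (\sum_(k <oo) (`|u k x - u k.+1 x|)%:E)%E.
have r0 x : (0 <= r x)%E by apply: nneseries_ge0 => k _ _; rewrite lee_fin.
have mr : measurable_fun setT r.
  apply: ge0_emeasurable_sum => [k x _ _|k _]; first by rewrite lee_fin.
  by apply/measurable_EFinP; case: (bm_norm (bmB (bA (n k)) (bA (n k.+1)))).
have Er : (\int[P]_x r x <= e1%:E)%E.
  rewrite integral_nneseries//.
    apply: le_trans (@epsilon_trick0 R e1 xpredT (ltW e10)).
    apply: lee_nneseries => [k _ _|k _]; first by apply: integral_ge0 => x _; rewrite lee_fin.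
    by rewrite mean_EFin ?lee_fin ?u1//; exact: bm_norm (bmB (bA _) (bA _)).
  by move=> k; apply/measurable_EFinP; case: (bm_norm (bmB (bA (n k)) (bA (n k.+1)))).
have ur x k : (`|u 0%N x - u k x|%:E <= r x)%E.
  apply: (@le_trans _ _ (\sum_(0 <= j < k) (`|u j x - u j.+1 x|)%:E)%E).
    rewrite sumEFin lee_fin; elim: k => [|k IH].
      by rewrite big_geq// subrr normr0.
    rewrite big_nat_recr//= (_ : u 0%N x - u k.+1 x = (u 0%N x - u k x) + (u k x - u k.+1 x)).
      by apply: (le_trans (ler_normD _ _)); rewrite lerD2r.
    by rewrite addrA subrK.
  by apply: nneseries_lim_ge => j _; rewrite lee_fin.
pose l := E f.
have l0 : 0 <= l by apply: Rintegral_ge0 => x _; case/andP: (fK x).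
pose c := l + 3 * e1.
(* The event that the limsup of [u] is at least [c] is literally invariant under
   every [sigma t], as [erg] demands, because it is defined by limits everywhere. *)
pose F := \bigcap_k \bigcap_N \bigcup_i [set x | c - k.+1%:R^-1 < u (N + i)%N x].
have mF : measurable F.
  apply: bigcap_measurable => // k _; apply: bigcap_measurable => // M _.
  apply: bigcup_measurable => i _;
  have := (bA (n (M + i)%N)).1 measurableT _ (measurable_itv `]c - k.+1%:R^-1, +oo[).
  rewrite setTI; congr measurable.
  by apply/seteqP; split=> x /=; rewrite in_itv/= andbT.
have F_near x x' : (forall e2, 0 < e2 -> exists N, forall j, (N <= j)%N -> `|u j x - u j x'| < e2) ->
    F x -> F x'.
  move=> xy Fx k _ N1 _.
  have k0 : 0 < (2 * k.+1%:R)^-1 :> R by rewrite invr_gt0 mulr_gt0.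
  have [M MP] := xy _ k0.
  (* Index 2k + 1 has tolerance 1/(2k + 2), half of 1/(k + 1); the other half absorbs the
     perturbation. *)
  have [i _ /= ui] := Fx (k.*2.+1) Logic.I (maxn N1 M) Logic.I.
  exists (maxn N1 M - N1 + i)%N => //=.
  rewrite addnA subnKC ?leq_maxl//.
  have := MP (maxn N1 M + i)%N (leq_trans (leq_maxr _ _) (leq_addr _ _)).
  have e2 : (k.*2.+2%:R^-1 : R) = (2 * k.+1%:R)^-1 by rewrite -natrM; congr (_%:R^-1); lia.
  have e3 y : y != 0 -> y^-1 = (2 * y)^-1 + (2 * y)^-1 :> R by move=> y0; field.
  rewrite e2 in ui; rewrite (e3 k.+1%:R) ?pnatr_eq0//.
  move: ui; move: ((2 * k.+1%:R)^-1 : R) => s ui; rewrite ltr_norml => /andP[_]; lra.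
have u_sigma t x e2 : 0 < e2 ->
    exists N1, forall j, (N1 <= j)%N -> `|u j (sigma t x) - u j x| < e2.
  move=> e20; have [m0 m0P] := sigma_osc t; have [N1 N1P] := osc_near m0 e20.
  exists N1 => j Nj; apply: le_lt_trans (N1P (n j) (leq_trans Nj (nk j))).
  rewrite /u /A /box_avg -mulrBl normrM normfV [X in _ / X]gtr0_norm ?beta_gt0//.
  by rewrite oscE ler_pM2r ?invr_gt0 ?beta_gt0.
have invF t : sigma t @^-1` F = F.
  apply/seteqP; split=> x /= Fx; apply: F_near Fx => e2 e20.
    exact: u_sigma.
  by have [N1 N1P] := u_sigma t x e2 e20; exists N1 => j /N1P; rewrite distrC.
have mu0 : measurable_fun setT (fun x => (u 0%N x)%:E) by apply/measurable_EFinP; case: (bA (n 0%N)).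
have EA : E (u 0%N) = l by exact: mean_box_avg.
have Eu0 : (\int[P]_x (u 0%N x)%:E = l%:E)%E.
  by rewrite mean_EFin; [congr EFin|exact: bA].
have PFE : (\int[P]_x (\1_F x)%:E = P F)%E by rewrite integral_indic// setIT.
(* If P F = 1, then [u 0] + r is at least c almost surely, and integration gives c <= l + e1,
   contrary to c = l + 3 e1. *)
have [PF|PF] := erg mF invF; last first.
  exfalso.
  have H : (c%:E <= (l + e1)%:E)%E; last by move: H; rewrite lee_fin /c; lra.
  have c0 : 0 <= c by rewrite /c; lra.
  have mind : measurable_fun setT (fun x => (\1_F x)%:E : \bar R).
    by apply/measurable_EFinP; exact: measurable_indic.
  apply: (@le_trans _ _ (\int[P]_x ((u 0%N x)%:E + r x))%E); last first.
    rewrite ge0_integralD//; [|by move=> x _; rewrite lee_fin; case/andP: (AK (n 0%N) x)].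
    by rewrite Eu0 EFinD leeD2l.
  have -> : c%:E = (\int[P]_x (c%:E * (\1_F x)%:E))%E.
    by rewrite ge0_integralZl_EFin// PFE PF mule1.
  apply: ge0_le_integral => //.
  - by move=> x _; rewrite mule_ge0 ?lee_fin.
  - exact: measurable_funeM.
  - exact: emeasurable_funD.
  move=> x _; rewrite indicE; have [/set_mem Fx|] := boolP (x \in F); last first.
    by rewrite mule0 adde_ge0// lee_fin; case/andP: (AK (n 0%N) x).
  rewrite mule1.
  move: (ur x) (r0 x); case: (r x) => [s|_ _|//]; last by rewrite addey// leey.
  move=> us s0; rewrite -EFinD lee_fin; apply/ler_addgt0Pr => e2 e20.
  have [k ke] : exists k : nat, k.+1%:R^-1 < e2.
    by have /ltr_add_invr[k] := e20; rewrite add0r; exists k.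
  have [i _ /= ui] := Fx k Logic.I 0%N Logic.I.
  move: ke ui; move: (k.+1%:R^-1 : R) => y ke ui.
  have := us (0 + i)%N; rewrite lee_fin ler_norml => /andP[? ?]; lra.
exists (n 0%N); rewrite -[A (n 0%N)]/(u 0%N) -/l.
have bv : bm (fun x => `|u 0%N x - l|).
  by apply: bm_norm; apply: bmB; [exact: bA|exact: bm_cst].
have PFI : (\int[P]_x (\1_F x)%:E = 0)%E by rewrite PFE.
have mind : measurable_fun setT (fun x => (\1_F x)%:E : \bar R).
  by apply/measurable_EFinP; exact: measurable_indic.
(* The left integrand is the larger of 2 [u 0] - l and l, so off F an upper bound for [u 0] is
   enough; on the null event F it is at most 2 K. *)
suff H : (\int[P]_x (`|u 0%N x - l| + u 0%N x)%:E <=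
    \int[P]_x ((6 * e1 + l)%:E + (2%:E * r x + (2 * K)%:E * (\1_F x)%:E)))%E.
  move: H; rewrite mean_EFin; last by apply: bmD => //; exact: bA.
  rewrite meanD//; last exact: bA.
  rewrite ge0_integralD//; last 3 first.
  - by move=> x _; rewrite lee_fin; lra.
  - by move=> x _; rewrite adde_ge0// mule_ge0// lee_fin// mulr_ge0.
  - by apply: emeasurable_funD; exact: measurable_funeM.
  rewrite ge0_integralD//; last 4 first.
  - by move=> x _; rewrite mule_ge0.
  - exact: measurable_funeM.
  - by move=> x _; rewrite mule_ge0// lee_fin// mulr_ge0.
  - exact: measurable_funeM.
  rewrite !ge0_integralZl_EFin ?mulr_ge0// PFI mule0 adde0 integral_cst//= probability_setT mule1.
  rewrite [Rintegral _ _ (fun x => u 0%N x)]EA.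
  move=> H.
  have : ((E (fun x => `|u 0%N x - l|) + l)%:E <= (6 * e1 + l + 2 * e1)%:E)%E.
    apply: (le_trans H); rewrite [leRHS]EFinD; apply: leeD2l; rewrite EFinM.
    by apply: lee_wpmul2l; rewrite ?lee_fin.
  rewrite lee_fin /e1; lra.
apply: ge0_le_integral => //.
- by move=> x _; rewrite lee_fin addr_ge0//; case/andP: (AK (n 0%N) x).
- by apply/measurable_EFinP; case: (bmD bv (bA (n 0%N))).
- apply: emeasurable_funD => //; apply: emeasurable_funD; exact: measurable_funeM.
move=> x _; have /andP[h1 h2] := AK (n 0%N) x; rewrite -/(u 0%N) in h1 h2.
have lK : l <= K.
  rewrite /l -(mean_cst P K); apply: mean_le => //; first exact: bm_cst.
  by move=> y; case/andP: (fK y).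
rewrite indicE; have [Fx|/negP Fx] := boolP (x \in F).
  rewrite mule1; apply: (@le_trans _ _ ((6 * e1 + l)%:E + (0 + (2 * K)%:E))%E).
    rewrite add0e -EFinD lee_fin.
    have : `|u 0%N x - l| <= K by rewrite ler_norml; apply/andP; split; lra.
    lra.
  by rewrite leeD2l// leeD2r// mule_ge0.
rewrite mule0 adde0.
have : ((u 0%N x)%:E <= c%:E + r x)%E.
  have : ~ F x by move=> h; apply: Fx; exact: mem_set.
  rewrite /F /bigcap/= => /existsNP[k /not_implyP[_ /existsNP[M /not_implyP[_ nM]]]].
  move: (ur x M) (r0 x); case: (r x) => [s|_ _|//]; last by rewrite addey// leey.
  rewrite lee_fin ler_norml => /andP[_ us] _.
  have : ~ (c - k.+1%:R^-1 < u (M + 0)%N x) by move=> h; apply: nM; exists 0%N.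
  move=> /negP; rewrite -leNgt addn0 => h3.
  have : 0 < k.+1%:R^-1 :> R by rewrite invr_gt0.
  rewrite -EFinD lee_fin; move: h3; move: (k.+1%:R^-1 : R) => y h3 hy; lra.
move: (r0 x); case: (r x) => [s|_ _|//]; last by rewrite mulry gtr0_sg// mul1e addey// leey.
rewrite -EFinM -!EFinD !lee_fin /c => s0 h3.
have [h4|h4] := leP 0 (u 0%N x - l); [rewrite ger0_norm//|rewrite ltr0_norm//]; lra.
Qed.

End mean_ergodic.

(** * The pointwise ergodic theorem *)

Section pointwise_ergodic.
Context {d : nat} {dT : measure_display} {T : measurableType dT} {R : realType}.
Variables (P : probability T R) (tau : 'rV[int]_d -> T -> T).
Hypothesis mtau : forall z, measurable_fun setT (tau z).
Hypothesis tauD : forall z w x, tau z (tau w x) = tau (z + w) x.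
Hypothesis Ptau : forall z F, measurable F -> P (tau z @^-1` F) = P F.
Variables (I : Type) (sigma : I -> T -> T).
Hypothesis erg : forall F, measurable F -> (forall t, sigma t @^-1` F = F) ->
  P F = 0%E \/ P F = 1%E.

Variables (f : T -> R) (lam : R).
Hypotheses (mf : measurable_fun setT f) (f0 : forall x, 0 <= f x).
Hypothesis Ef : (\int[P]_x (f x)%:E = lam%:E)%E.

(** Bounded minorants approximating f in L^1, to which the mean ergodic theorem applies; their
    bounds may degrade with k. *)
Variables (fk : nat -> T -> R) (K : nat -> R).
Hypothesis mfk : forall k, measurable_fun setT (fk k).
Hypothesis fkK : forall k x, 0 <= fk k x <= K k.
Hypothesis fkf : forall k x, fk k x <= f x.
Hypothesis fk_approx : forall e : R, 0 < e ->
  exists k, (\int[P]_x (f x - fk k x)%:E <= e%:E)%E.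
Hypothesis fk_osc : forall k t, exists m, forall n x,
  `|box_sum tau (fk k) n (sigma t x) - box_sum tau (fk k) n x| <=
  K k * (beta d (n + m) - beta d n).

(** [S r] is an averaging set of size about [vol r]. A shift by [box m] enlarges its parameter by
    [rho m], which [S_vol] makes negligible; [S_box] encloses it in a box of comparable size, so
    that the maximal inequality for boxes applies. *)
Variables (S : R -> {fset 'rV[int]_d}) (vol : R -> R) (rho : nat -> R) (C : R).
Hypothesis vol0 : forall r, 0 < r -> 0 < vol r.
Hypothesis S_vol : forall m, (#|` S (r + rho m)|%:R / vol r) @[r --> +oo] --> (1 : R).
Hypothesis S_vol0 : (#|` S r|%:R / vol r) @[r --> +oo] --> (1 : R).
Hypothesis S_shift : forall r m w z, w \in box m -> z \in S r -> w + z \in S (r + rho m).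
Hypothesis S_box : forall r, 1 <= r -> exists2 n, {subset S r <= box n} & beta d n <= C * vol r.

Lemma S_osc (F : 'rV[int]_d -> R) k r m w : (forall z, 0 <= F z <= k) -> w \in box m ->
  `|\sum_(z <- S r) F (w + z) - \sum_(z <- S r) F z| <=
  k * (#|` S (r + rho m)|%:R - #|` S r|%:R).
Proof.
move=> Fk wm.
have s1 : (S r `<=` S (r + rho m))%fset.
  apply/fsubsetP => z zS; rewrite -(add0r z); apply: S_shift => //; exact: box0_in.
pose Sw := [fset (w + z)%R | z in S r]%fset.
have s2 : (Sw `<=` S (r + rho m))%fset.
  by apply/fsubsetP => _ /imfsetP[z /= zS ->]; exact: S_shift.
have cSw : #|` Sw| = #|` S r| by rewrite card_imfset//; exact: addrI.
have -> : \sum_(z <- S r) F (w + z) = \sum_(z <- Sw) F z.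
  by rewrite big_imfset//= => x y _ _; exact: addrI.
have := sum_sub_bounds Fk s1; have := sum_sub_bounds Fk s2; rewrite cSw.
set a := \sum_(_ <- _) _; set b := \sum_(_ <- _) _; set c := \sum_(_ <- _) _.
by move=> /andP[? ?] /andP[? ?]; rewrite ler_distl; apply/andP; split; lra.
Qed.

(** Replacing [fk k] by its averages of fixed radius N only shifts the sum over [S r] by elements of
    [box N], hence costs a boundary term. The L^1 closeness of these averages to a constant thereby
    becomes usable for sums of [fk k]. *)
Lemma S_box_avg_osc k N r x :
  `|\sum_(z <- S r) box_avg tau (fk k) N (tau z x) - \sum_(z <- S r) fk k (tau z x)| <=
  K k * (#|` S (r + rho N)|%:R - #|` S r|%:R).
Proof.
have b0 := @beta_gt0 d R N.
set B := K k * _.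
have -> : \sum_(z <- S r) box_avg tau (fk k) N (tau z x) =
    (\sum_(w <- box N) \sum_(z <- S r) fk k (tau (w + z) x)) / beta d N.
  rewrite exchange_big/= mulr_suml; apply: eq_bigr => z _; rewrite /box_avg; congr (_ / _).
  by apply: eq_bigr => w _; rewrite tauD.
set s := \sum_(z <- S r) _.
have -> : s = (\sum_(w <- @box d N) s) / beta d N.
  rewrite big_const_seq count_predT iter_addr addr0 -[size _]/(#|` box N|) card_box.
  by rewrite -[_ *+ _]mulr_natr mulfK// gt_eqF.
rewrite -mulrBl -sumrB normrM normfV [X in _ / X]gtr0_norm// ler_pdivrMr//.
apply: (le_trans (ler_norm_sum _ _ _)).
apply: (@le_trans _ _ (\sum_(w <- @box d N) B)).
  rewrite big_seq [leRHS]big_seq; apply: ler_sum => w wm.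
  exact: (@S_osc (fun z => fk k (tau z x)) _ r N w).
by rewrite big_const_seq count_predT iter_addr addr0 -[size _]/(#|` box N|) card_box mulr_natr.
Qed.

Let C0 : 0 < C.
Proof.
have [n _ h] := S_box (lexx 1).
have := lt_le_trans (beta_gt0 n) h; rewrite pmulr_lgt0//; exact: vol0.
Qed.

Let lam0 : 0 <= lam.
Proof. by rewrite -lee_fin -Ef; apply: integral_ge0 => x _; rewrite lee_fin. Qed.

(** Sums of f are compared with sums of [fk k], these with sums of its box averages, and those with
    a constant. The first and last errors make up g, small in L^1 and controlled off the maximal
    event; the middle one is a boundary term. *)
Lemma pointwise_ergodic_approx e eta : 0 < e -> 0 < eta ->
  exists2 E : set T, measurable E /\ (P E <= eta%:E)%E &
    forall x, ~ E x -> \forall r \near +oo, `|(\sum_(z <- S r) f (tau z x)) / vol r - lam| <= e.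
Proof.
move=> e0 eta0.
(* Off the maximal event the sum of g over [S r] is at most a C [vol r], that is e/4 times
   [vol r]. *)
pose a := e / 4 / C.
have a0 : 0 < a by rewrite !divr_gt0.
(* The second bound makes the maximal inequality yield P E <= 2^d (2 D) / a <= eta. *)
pose D := Num.min (e / 16) (a * eta / ((2 ^ d)%:R * 2)).
have pd : 0 < (2 ^ d)%:R :> R by rewrite ltr0n expn_gt0.
have D0 : 0 < D by rewrite /D lt_min divr_gt0//= divr_gt0// mulr_gt0.
have De : D <= e / 16 by rewrite /D ge_min lexx.
have Da : D <= a * eta / ((2 ^ d)%:R * 2) by rewrite /D ge_min lexx orbT.
have [k kD] := fk_approx D0.
pose lk := Rintegral P setT (fk k).
have bk : bounded_measurable (fk k).
  by split => //; exists (K k) => x; have /andP[? ?] := fkK k x; rewrite ger0_norm.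
have [N ND] := mean_ergodic mtau tauD Ptau (mfk k) (fkK k) (fk_osc k) erg D0.
pose A := box_avg tau (fk k) N.
have bA : bounded_measurable (fun x => `|A x - lk|).
  by apply: bm_norm; apply: bmB; [exact: bm_box_avg|exact: bm_cst].
pose g x := (f x - fk k x) + `|A x - lk|.
have fd0 x : 0 <= f x - fk k x by rewrite subr_ge0.
have mfd : measurable_fun setT (fun x => f x - fk k x) by exact: measurable_funB.
have g0 x : 0 <= g x by rewrite addr_ge0.
have mg : measurable_fun setT g by apply: measurable_funD => //; case: bA.
have Eg : (\int[P]_x (g x)%:E <= (D *+ 2)%:E)%E.
  under eq_integral do rewrite EFinD.
  rewrite ge0_integralD//; first 1 last.
  - by move=> x _; rewrite lee_fin.
  - exact/measurable_EFinP.
  - by apply/measurable_EFinP; case: bA.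
  by rewrite mulr2n EFinD leeD// mean_EFin// lee_fin.
have lamk : 0 <= lam - lk <= D.
  have : (lam%:E = lk%:E + \int[P]_x (f x - fk k x)%:E)%E.
    rewrite -Ef -mean_EFin// -ge0_integralD//; first 1 last.
    - by move=> x _; rewrite lee_fin; case/andP: (fkK k x).
    - exact/measurable_EFinP.
    - by move=> x _; rewrite lee_fin.
    - exact/measurable_EFinP.
    by apply: eq_integral => x _; rewrite -EFinD addrC subrK.
  have : (0 <= \int[P]_x (f x - fk k x)%:E)%E by apply: integral_ge0 => x _; rewrite lee_fin.
  move: kD; case: (\int[P]_x _)%E => // s; rewrite !lee_fin => ? ? /eqP.
  by rewrite -EFinD eqe => /eqP ->; apply/andP; split; lra.
pose E := [set x | exists n, a * beta d n <= box_sum tau g n x].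
have mE : measurable E.
  rewrite (_ : E = \bigcup_n [set x | a * beta d n <= box_sum tau g n x]).
    apply: bigcup_measurable => n _; rewrite -[X in measurable X]setTI.
    exact: measurable_fun_le (measurable_cst _) (measurable_box_sum mtau n mg).
  by apply/seteqP; split=> x [n]; exists n.
exists E.
  split => //.
  have igy : (\int[P]_x (g x)%:E < +oo)%E by rewrite (le_lt_trans Eg)// ltry.
  have := @lattice_maximal_inequality _ _ _ _ P tau mtau tauD Ptau g a mg g0 (ltW a0) igy.
  move=> /le_trans/(_ (lee_wpmul2l _ Eg)).
  rewrite lee_fin ler0n => /(_ isT).
  rewrite -lee_pdivlMl// => /le_trans; apply.
  rewrite -!EFinM lee_fin.
  move: Da; rewrite ler_pdivlMr ?mulr_gt0// => Da.
  rewrite mulrC ler_pdivrMr// -[D *+ 2]mulr_natr; lra.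
move=> x /forallNP xE.
have near1 m e1 : 0 < e1 -> \forall r \near +oo, `|1 - #|` S (r + rho m)|%:R / vol r| < e1.
  by move=> e10; move/cvgrPdist_lt : (S_vol m); apply.
have near2 e1 : 0 < e1 -> \forall r \near +oo, `|1 - #|` S r|%:R / vol r| < e1.
  by move=> e10; move/cvgrPdist_lt : S_vol0; apply.
pose e1 := Num.min 1 (e / 16 / (K k + lam + 1)).
have Kl : 0 < K k + lam + 1.
  by have /andP[h1 h2] := fkK k point; have := le_trans h1 h2; have := lam0; lra.
have e10 : 0 < e1 by rewrite lt_min ltr01/= !divr_gt0.
near=> r.
have r1 : 1 <= r by near: r; exact: nbhs_pinfty_ge.
have v0 : 0 < vol r by apply: vol0; exact: lt_le_trans r1.
have [n Sn bn] := S_box r1.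
have N1 : `|1 - #|` S (r + rho N)|%:R / vol r| < e1 by near: r; exact: near1.
have N2 : `|1 - #|` S r|%:R / vol r| < e1 by near: r; exact: near2.
have G : \sum_(z <- S r) g (tau z x) <= a * C * vol r.
  apply: (@le_trans _ _ (box_sum tau g n x)).
    have Snb : (S r `<=` box n)%fset by apply/fsubsetP.
    rewrite /box_sum (fset_sum_split (fun z => g (tau z x)) Snb) lerDl.
    exact: sumr_ge0.
  have := xE n => /negP; rewrite -ltNge => /ltW/le_trans; apply.
  by rewrite -mulrA ler_wpM2l// ltW.
have M := S_box_avg_osc k N r x.
set sf := \sum_(z <- S r) f (tau z x).
set sk := \sum_(z <- S r) fk k (tau z x) in M.
set sA := \sum_(z <- S r) box_avg tau (fk k) N (tau z x) in M.
set c0 : R := #|` S r|%:R in M N2 *.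
set c1 : R := #|` S (r + rho N)|%:R in M N1.
have G' : `|sf - sk| + `|sA - lk * c0| <= a * C * vol r.
  apply: le_trans G; rewrite /g big_split/=; apply: lerD.
    by rewrite sumrB ger0_norm// subr_ge0; apply: ler_sum => z _.
  have -> : lk * c0 = \sum_(z <- S r) lk.
    by rewrite big_const_seq count_predT iter_addr addr0 mulr_natr.
  by rewrite -sumrB; exact: ler_norm_sum.
have aC : a * C = e / 4 by rewrite /a divfK// gt_eqF.
rewrite aC in G'.
have c1v : c1 < vol r * (1 + e1).
  by move: N1; rewrite ltr_norml => /andP[h _]; rewrite mulrC -ltr_pdivrMr//; lra.
have c0v : vol r * (1 - e1) < c0 < vol r * (1 + e1).
  move: N2; rewrite ltr_norml => /andP[h1 h2]; apply/andP; split.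
    by rewrite mulrC -ltr_pdivlMr//; lra.
  by rewrite mulrC -ltr_pdivrMr//; lra.
have K0 : 0 <= K k by have /andP[h1 h2] := fkK k point; exact: le_trans h1 h2.
have e11 : e1 <= 1 by rewrite /e1 ge_min lexx.
have p4 : (K k + lam + 1) * e1 * vol r <= e / 16 * vol r.
  by rewrite ler_wpM2r ?(ltW v0)// mulrC -ler_pdivlMr// /e1 ge_min lexx orbT.
have /andP[c0l c0u] := c0v.
have c00 : 0 <= c0 by rewrite ler0n.
have ev0 : 0 <= vol r * (1 - e1) by rewrite mulr_ge0 ?(ltW v0)//; lra.
have p1 : 0 <= (lam - lk) * c0 by rewrite mulr_ge0//; case/andP: lamk.
have p1' : (lam - lk) * c0 <= D * c0 by rewrite ler_wpM2r//; case/andP: lamk.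
have p1'' : D * c0 <= D * (2 * vol r).
  rewrite ler_wpM2l ?(ltW D0)//; apply: (le_trans (ltW c0u)).
  by rewrite mulrC ler_wpM2r ?(ltW v0)//; lra.
have p1x : D * vol r <= e / 16 * vol r by rewrite ler_wpM2r ?(ltW v0).
have p2 : lam * (c0 - vol r) <= lam * (e1 * vol r).
  rewrite ler_wpM2l//; lra.
have p2' : - (lam * (e1 * vol r)) <= lam * (c0 - vol r).
  rewrite -mulrN ler_wpM2l//; lra.
have p3 : K k * (c1 - c0) <= K k * (2 * e1 * vol r).
  rewrite ler_wpM2l//; lra.
have e1V : 0 <= e1 * vol r by rewrite mulr_ge0 ?(ltW e10) ?(ltW v0).
have t1 : `|(sf - sk) + (sA - lk * c0)| <= e / 4 * vol r by exact: le_trans (ler_normD _ _) G'.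
have -> : sf / vol r - lam = (sf - lam * vol r) / vol r by rewrite mulrBl mulfK// gt_eqF.
rewrite normrM normfV [X in _ / X]gtr0_norm// ler_pdivrMr//.
have eV : 0 <= e * vol r by rewrite mulr_ge0 ?(ltW e0) ?(ltW v0).
move: t1 M; rewrite !ler_norml => /andP[t1 t2] /andP[M1 M2].
by apply/andP; split; lra.
Unshelve. all: by end_near. Qed.

(** For tolerance 1/(n + 1) the exceptional set can be taken of measure at most 1/(j + 1) for every
    j; the intersection over j is null, and so is the union over n. *)
Lemma pointwise_ergodic :
  {ae P, forall x, (\sum_(z <- S r) f (tau z x)) / vol r @[r --> +oo] --> lam}.
Proof.
have inv0 n : 0 < n.+1%:R^-1 :> R by rewrite invr_gt0.
have /choice[E EP] (p : nat * nat) : exists E : set T,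
    (measurable E /\ (P E <= (p.2.+1%:R^-1)%:E)%E) /\
    forall x, ~ E x -> \forall r \near +oo,
      `|(\sum_(z <- S r) f (tau z x)) / vol r - lam| <= p.1.+1%:R^-1.
  by have [E ? ?] := pointwise_ergodic_approx (inv0 p.1) (inv0 p.2); exists E.
pose N n := \bigcap_j E (n, j).
have mN n : measurable (N n).
  by apply: bigcap_measurable => // j _; have [[]] := EP (n, j).
have PN n : P (N n) = 0%E.
  apply/eqP; rewrite eq_le measure_ge0 andbT; apply/lee_addgt0Pr => e e0.
  have [j je] : exists j : nat, j.+1%:R^-1 < e.
    by have /ltr_add_invr[k] := e0; rewrite add0r; exists k.
  rewrite add0e; apply: (@le_trans _ _ (P (E (n, j)))).
    by apply: le_measure; [exact: mem_set|apply: mem_set; have [[]] := EP (n, j)|exact: bigcap_inf].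
  have [[_ h] _] := EP (n, j); apply: (le_trans h); rewrite lee_fin; exact: ltW.
have : P.-negligible (\bigcup_n N n).
  by apply: (@negligible_bigcup _ _ _ P N) => n; exists (N n); split; [exact: mN|exact: PN|].
apply: negligibleS.
move=> x /= nx; apply: contrapT => xN; apply: nx.
apply/cvgrPdist_le => e e0.
have [n ne] : exists n : nat, n.+1%:R^-1 < e.
  by have /ltr_add_invr[k] := e0; rewrite add0r; exists k.
have : ~ N n x by move=> h; apply: xN; exists n.
move=> /existsNP[j /not_implyP[_ nE]].
have [_ /(_ x nE)] := EP (n, j); apply: filterS => r h.
by rewrite distrC (le_trans h)// ltW.
Qed.

End pointwise_ergodic.

(** * Unit cells and the lattice points of a ball *)

Section lattice_cells.
Context {R : realType} {d : nat}.
Implicit Types (z w : 'rV[int]_d) (t v : 'rV[R]_d) (A : {fset 'rV[int]_d}) (r : R).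

Definition lattice_pt z : 'rV[R]_d := map_mx intr z.

Lemma lattice_ptD z w : lattice_pt (z + w) = lattice_pt z + lattice_pt w.
Proof. exact: map_mxD. Qed.

Lemma norm_lattice_pt z n : z \in box n -> `|lattice_pt z| <= n%:R.
Proof.
move=> /mem_boxP zn; apply: norm_le_coord => // i.
by rewrite mxE -intr_norm -[n%:R]/((n%:Z)%:~R) ler_int -abszE lez_nat.
Qed.

Lemma lattice_pt_box z n : `|lattice_pt z| < n.+1%:R -> z \in box n.
Proof.
move=> zn; apply/mem_boxP => i; have := le_lt_trans (coord_le_norm (lattice_pt z) i) zn.
by rewrite mxE -intr_norm -[n.+1%:R]/((n.+1%:Z)%:~R) ltr_int -abszE ltz_nat.
Qed.

Definition lattice_floor v : 'rV[int]_d := map_mx Num.floor v.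

Lemma sub_lattice_floor v : unit_cube (v - lattice_pt (lattice_floor v)).
Proof.
move=> i; rewrite !mxE subr_ge0 ltrBlDr floor_le_tmp/=.
by rewrite addrC -intrD1 floorD1_gt.
Qed.

Lemma unit_cube_lattice_pt v z : unit_cube (v - lattice_pt z) -> z = lattice_floor v.
Proof.
move=> vz; apply/rowP => i; rewrite mxE; apply/esym/floor_def.
by have := vz i; rewrite !mxE subr_ge0 ltrBlDr intrD addrC.
Qed.

Lemma norm_unit_cube v : unit_cube v -> `|v| <= 1.
Proof.
move=> vU; apply: norm_le_coord => // i; have /andP[v0 v1] := vU i.
by rewrite ger0_norm// ltW.
Qed.

Lemma eucl_norm_unit_cube v : unit_cube v -> eucl_norm v <= d%:R.
Proof.
move=> /norm_unit_cube v1; apply: (le_trans (eucl_le_norm v)).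
by rewrite -[leRHS]mulr1 ler_wpM2l.
Qed.

(** The displacement t is arbitrary in R^d: translating a configuration by t amounts to displacing
    the grid by t. *)
Definition cell z t : set 'rV[R]_d := shift_set (lattice_pt z + t) (@unit_cube R d).

Definition cells A t : set 'rV[R]_d := \bigcup_(z in [set` A]) cell z t.

Lemma cellE z t v : cell z t v <-> z = lattice_floor (v - t).
Proof.
rewrite /cell /shift_set/= opprD addrCA addrC; split; first exact: unit_cube_lattice_pt.
by move=> ->; exact: sub_lattice_floor.
Qed.

Lemma cellsE A t v : cells A t v <-> lattice_floor (v - t) \in A.
Proof.
split=> [[z zA /cellE <-//]|vA]; exists (lattice_floor (v - t)) => //.
exact/cellE.
Qed.

Lemma measurable_cell z t : measurable (cell z t).
Proof. by apply: measurable_shift_set; exact: measurable_unit_cube. Qed.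

Lemma measurable_cells A t : measurable (cells A t).
Proof. by apply: fin_bigcup_measurable => // z _; exact: measurable_cell. Qed.

Lemma measure_cells (m : {measure set 'rV[R]_d -> \bar R}) A t :
  m (cells A t) = (\sum_(z <- A) m (cell z t))%E.
Proof.
rewrite /cells measure_fin_bigcup//.
- by apply/esym/fsbig_seq; exact: fset_uniq.
- by move=> z w _ _ [v [/cellE -> /cellE ->]].
- by move=> z _; exact: measurable_cell.
Qed.

(** A point of a displaced cell is within |t| + 1 of its lattice point and within 1 of its own
    floor; hence the m + 1 extra layers. *)
Lemma cells_shift (n : nat) m t : `|t| + 1 <= m%:R ->
  cells (box n) t `<=` cells (box (n + m.+1)) 0.
Proof.
move=> tm v /cellsE vn; apply/cellsE; rewrite subr0.
apply: lattice_pt_box; set z := lattice_floor (v - t) in vn.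
have h1 := norm_unit_cube (sub_lattice_floor (v - t)).
have h2 := norm_unit_cube (sub_lattice_floor v).
have h3 := norm_lattice_pt vn.
have -> : lattice_pt (lattice_floor v) = lattice_pt z + (v - t - lattice_pt z) + t - (v - lattice_pt (lattice_floor v)).
  by apply/rowP => i; rewrite !mxE; ring.
apply: (le_lt_trans (ler_normB _ _)).
have : `|lattice_pt z + (v - t - lattice_pt z) + t| <= n%:R + 1 + `|t|.
  by apply: (le_trans (ler_normD _ _)); rewrite lerD2r (le_trans (ler_normD _ _))// lerD.
have -> : ((n + m.+1).+1%:R : R) = n%:R + m%:R + 2 by rewrite -!natrD; congr (_%:R); lia.
lra.
Qed.

Definition lattice_ball r : {fset 'rV[int]_d} :=
  [fset z in box (Num.truncn r) | eucl_norm (lattice_pt z) < r]%fset.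

Lemma mem_lattice_ball r z : (z \in lattice_ball r) = (eucl_norm (lattice_pt z) < r).
Proof.
apply/imfsetP/idP => [[y /=]|zr]; first by rewrite inE => /andP[_ yr] ->.
exists z => //=; rewrite inE zr andbT; apply: lattice_pt_box.
by apply: (le_lt_trans (norm_le_eucl _)); rewrite (lt_trans zr)// truncnS_gt.
Qed.

Lemma eucl_ball_sub_cells r : eucl_ball (r - d%:R) `<=` cells (lattice_ball r) 0.
Proof.
move=> v; rewrite eucl_ballE => vr; apply/cellsE; rewrite subr0 mem_lattice_ball.
have -> : lattice_pt (lattice_floor v) = v - (v - lattice_pt (lattice_floor v)) by rewrite subKr.
apply: (le_lt_trans (eucl_normD _ _)); rewrite eucl_normN.
have := eucl_norm_unit_cube (sub_lattice_floor v); lra.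
Qed.

Lemma cells_sub_eucl_ball r : cells (lattice_ball r) 0 `<=` eucl_ball (r + d%:R).
Proof.
move=> v /cellsE; rewrite subr0 mem_lattice_ball eucl_ballE => vr.
rewrite -(subrK (lattice_pt (lattice_floor v)) v).
apply: (le_lt_trans (eucl_normD _ _)).
have := eucl_norm_unit_cube (sub_lattice_floor v); lra.
Qed.

(** A point is within Euclidean distance d of the corner of its cell. The measure is arbitrary
    because Lebesgue measure serves to count lattice points and the pair count of a configuration to
    compare pair sums. *)
Lemma lattice_ball_measure (m : {measure set 'rV[R]_d -> \bar R}) r :
  (m (eucl_ball (r - d%:R)) <= \sum_(z <- lattice_ball r) m (cell z 0) <=
   m (eucl_ball (r + d%:R)))%E.
Proof.
rewrite -measure_cells; apply/andP; split; apply: le_measure;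
  try by apply/mem_set; exact: measurable_eucl_ball.
- by apply/mem_set; exact: measurable_cells.
- exact: eucl_ball_sub_cells.
- by apply/mem_set; exact: measurable_cells.
- exact: cells_sub_eucl_ball.
Qed.

Local Notation V := (@eucl_vol R d).

Lemma card_lattice_ball r : d%:R < r ->
  V * (r - d%:R) ^+ d <= #|` lattice_ball r|%:R <= V * (r + d%:R) ^+ d.
Proof.
move=> dr; have : (lebesgue_rV d (eucl_ball (r - d%:R)) <=
    \sum_(z <- lattice_ball r) lebesgue_rV d (cell z 0) <=
    lebesgue_rV d (eucl_ball (r + d%:R)))%E := lattice_ball_measure (lebesgue_rV d) r.
have r0 : 0 < r - d%:R by rewrite subr_gt0.
have r1 : 0 < r + d%:R by have : (0 : R) <= d%:R by []; lra.
rewrite !lebesgue_eucl_ball//.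
rewrite (eq_bigr (fun=> 1%E)); last first.
  move=> z _; rewrite (lebesgue_rV_shift _ (@measurable_unit_cube R d)).
  exact: lebesgue_unit_cube.
by rewrite sumEFin !lee_fin big_const_seq count_predT iter_addr addr0.
Qed.

Definition ball_vol r : R := V * r ^+ d.

Lemma ball_vol_gt0 r : 0 < r -> 0 < ball_vol r.
Proof. by move=> r0; rewrite mulr_gt0 ?eucl_vol_gt0// exprn_gt0. Qed.

Lemma cvg_ball_vol_ratio c : ball_vol (r + c) / ball_vol r @[r --> +oo] --> (1 : R).
Proof.
have C : (1 + c / r : R) @[r --> +oo] --> (1 : R).
  rewrite -[X in _ --> X]addr0; apply: cvgD; first exact: cvg_cst.
  rewrite -[X in _ --> X](mulr0 c); apply: cvgMr.
  apply/gtr0_cvgV0; first by near=> r; near: r; exact: nbhs_pinfty_gt.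
  exact: cvg_id.
have := cvg_comp _ _ C (@exprn_continuous _ d 1); rewrite expr1n.
apply: cvg_trans; apply: near_eq_cvg; near=> r.
have r0 : 0 < r by near: r; exact: nbhs_pinfty_gt.
rewrite /ball_vol -mulf_div divff ?mul1r -?expr_div_n; last by rewrite gt_eqF// eucl_vol_gt0.
by rewrite mulrDl divff// gt_eqF.
Unshelve. all: by end_near. Qed.

Lemma cvg_card_lattice_ball c : #|` lattice_ball (r + c)|%:R / ball_vol r @[r --> +oo] --> (1 : R).
Proof.
apply: (@squeeze_cvgr _ _ _ _ (fun r => ball_vol (r + (c - d%:R)) / ball_vol r)
  (fun r => ball_vol (r + (c + d%:R)) / ball_vol r)); [|exact: cvg_ball_vol_ratio..].
near=> r.
have r0 : 0 < r by near: r; exact: nbhs_pinfty_gt.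
have rd : d%:R < r + c by rewrite -ltrBlDr; near: r; apply: nbhs_pinfty_gt; exact: num_real.
have := card_lattice_ball rd.
have v0 := ball_vol_gt0 r0.
by rewrite !ler_pM2r ?invr_gt0// /ball_vol !addrA.
Unshelve. all: by end_near. Qed.

Lemma lattice_ball_box r : 1 <= r -> exists2 n, {subset lattice_ball r <= box n} &
  beta d n <= 5 ^+ d / V * ball_vol r.
Proof.
move=> r1; exists (Num.truncn r) => [z|]; first by rewrite !inE => /andP[].
rewrite /ball_vol mulrA divfK ?gt_eqF ?eucl_vol_gt0// -exprMn /beta natrX.
apply: lerXn2r; rewrite ?nnegrE//; first by rewrite mulr_ge0//; lra.
have : (Num.truncn r)%:R <= r by rewrite truncn_le//; lra.
have -> : (Num.truncn r).*2.+1%:R = (Num.truncn r)%:R * 2 + 1 :> R.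
  by rewrite -natrM -natr1 muln2.
lra.
Qed.

Lemma lattice_ball_shift r m w z : w \in box m -> z \in lattice_ball r ->
  w + z \in lattice_ball (r + d%:R * m%:R).
Proof.
rewrite !mem_lattice_ball => /norm_lattice_pt wm zr; rewrite lattice_ptD.
apply: (le_lt_trans (eucl_normD _ _)); rewrite addrC.
apply: ltr_leD => //; apply: (le_trans (eucl_le_norm _)).
by rewrite ler_wpM2l.
Qed.

End lattice_cells.

Section weighted_measure.
Context {R : realType} {d : nat}.
Implicit Types (A B : set 'rV[R]_d) (phi : config R d).

Lemma le_npoints A B phi : measurable A -> measurable B -> A `<=` B ->
  (npoints A phi <= npoints B phi)%E.
Proof.
move=> mA mB AB; apply: (@le_measure _ _ _ (point_measure phi)) => //; exact: mem_set.
Qed.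

Lemma weighted_count_le_cst (w : config R d -> \bar R) A phi (c : \bar R) : measurable A -> (0 <= c)%E ->
  (forall x, points phi x -> A x -> (w (translate x phi) <= c)%E) ->
  (weighted_count w A phi <= c * npoints A phi)%E.
Proof.
move=> mA c0 wc; rewrite -(integral_cst (point_measure phi) mA) integral_point_measure//.
by apply: le_esum => x [px Ax]; exact: wc.
Qed.

(** The nonnegativity proof is an argument so that the measure structure can be attached to the
    term. *)
Definition weighted_measure (w : config R d -> \bar R) (w0 : forall phi, (0 <= w phi)%E)
  phi A := weighted_count w A phi.

Section weighted_measure_instance.
Variables (w : config R d -> \bar R) (w0 : forall phi, (0 <= w phi)%E) (phi : config R d).

Let weighted_measure0 : weighted_measure w0 phi set0 = 0%E.
Proof. by rewrite /weighted_measure /weighted_count setI0 esum_set0. Qed.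

Let weighted_measure_ge0 A : (0 <= weighted_measure w0 phi A)%E.
Proof. exact: weighted_count_ge0. Qed.

Let weighted_measure_sigma_additive : semi_sigma_additive (weighted_measure w0 phi).
Proof.
move=> F mF tF mUF; rewrite /weighted_measure weighted_count_bigcup//.
by apply: is_cvg_nneseries => n _ _; exact: weighted_count_ge0.
Qed.

HB.instance Definition _ := isMeasure.Build _ _ _ (weighted_measure w0 phi)
  weighted_measure0 weighted_measure_ge0 weighted_measure_sigma_additive.
End weighted_measure_instance.

End weighted_measure.

(** * Counting pairs of points *)

Section pair_counts.
Context {R : realType} {d : nat}.
Variables (C : set 'rV[R]_d) (q : nat).
Hypotheses (mC : measurable C) (Cq : C `<=` sup_ball q%:R).
Implicit Types (A B : set 'rV[R]_d) (phi : config R d) (k n : nat).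

Lemma npoints_translate_le x n phi : sup_ball n%:R x ->
  (npoints C (translate x phi) <= npoints (sup_ball (n + q)%:R) phi)%E.
Proof.
move=> xn; rewrite npoints_translate//; apply: le_npoints.
- exact: measurable_shift_set.
- exact: measurable_sup_ball.
move=> y /Cq; rewrite /sup_ball/= => yq; rewrite -(subrK x y) natrD addrC.
by rewrite (le_trans (ler_normD _ _))// lerD.
Qed.

(** Each point of A sees at most the points of the larger ball, and A has no more points than that
    ball. This is how square integrability of the process enters. *)
Lemma pair_count_le A n phi : measurable A -> A `<=` sup_ball n%:R ->
  (weighted_count (npoints C) A phi <= npoints (sup_ball (n + q)%:R) phi ^+ 2)%E.
Proof.
move=> mA An; apply: (@le_trans _ _ (npoints (sup_ball (n + q)%:R) phi * npoints A phi)%E).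
  apply: weighted_count_le_cst => // x _ /An xn.
  exact: npoints_translate_le.
rewrite expe2; apply: lee_wpmul2l; first exact: npoints_ge0.
apply: le_npoints => //; first exact: measurable_sup_ball.
by apply: (subset_trans An) => x /=; rewrite /sup_ball/= => /le_trans; apply; rewrite ler_nat leq_addr.
Qed.

Lemma pair_count_fin A phi : measurable A -> bounded_set A ->
  weighted_count (npoints C) A phi \is a fin_num.
Proof.
move=> mA /bounded_set_sub_sup_ball[n An]; rewrite ge0_fin_numE; last first.
  by apply: weighted_count_ge0 => psi; exact: npoints_ge0.
apply: (le_lt_trans (pair_count_le phi mA An)).
by rewrite ltey_eq fin_numX// npoints_fin//; exact: bounded_sup_ball.
Qed.

(** Truncating each weight would not bound the sum over a cube with many points. Dropping the points
    whose ball of radius q holds more than k points bounds both the weights and the number of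
    contributing points. *)
Definition capped_npoints k phi : \bar R :=
  if (npoints (sup_ball q%:R) phi <= k%:R%:E)%E then npoints C phi else 0%E.

Lemma measurable_capped_npoints k : measurable_fun setT (capped_npoints k).
Proof.
apply: measurable_fun_if => //.
- have mq := measurable_npoints (@measurable_sup_ball R d q%:R).
  have -> : (fun phi => (npoints (sup_ball q%:R) phi <= k%:R%:E)%E) =
      (fun phi => (npoints (sup_ball q%:R) phi <= cst (k%:R%:E) phi)%E) by [].
  exact: measurable_fun_lee.
- by apply: measurable_funS (measurable_npoints mC).
Qed.

Lemma capped_npoints_ge0 k phi : (0 <= capped_npoints k phi)%E.
Proof. by rewrite /capped_npoints; case: ifPn => // _; exact: npoints_ge0. Qed.

Lemma capped_npoints_le k phi : (capped_npoints k phi <= npoints C phi)%E.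
Proof. by rewrite /capped_npoints; case: ifPn => // _; exact: npoints_ge0. Qed.

Lemma unit_cube_sub_sup_ball : @unit_cube R d `<=` sup_ball 1%:R.
Proof. by move=> v; exact: norm_unit_cube. Qed.

Hypothesis q1 : (0 < q)%N.

(* Any two points of the unit cube see each other within distance [q], so a
   single point whose neighbourhood is not overcrowded bounds the whole cube. *)
Lemma capped_pair_count_le k phi :
  (weighted_count (capped_npoints k) (@unit_cube R d) phi <= (k%:R ^+ 2)%:E)%E.
Proof.
have mU := @measurable_unit_cube R d.
have [[x [px [Ux xk]]]|no] := pselect (exists x, points phi x /\ unit_cube x /\
  (npoints (sup_ball q%:R) (translate x phi) <= k%:R%:E)%E); last first.
  rewrite /weighted_count esum1 ?lee_fin ?exprn_ge0// => x [px Ux].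
  rewrite /capped_npoints; case: ifPn => // xk.
  by exfalso; apply: no; exists x.
apply: (@le_trans _ _ (k%:R%:E * npoints (@unit_cube R d) phi)%E).
  apply: weighted_count_le_cst => // y _ _; rewrite /capped_npoints.
  case: ifPn => [yk|]; last by rewrite lee_fin.
  by apply: le_trans yk; apply: le_npoints => //; exact: measurable_sup_ball.
rewrite expr2 EFinM lee_wpmul2l//; apply: le_trans xk.
rewrite npoints_translate; last exact: measurable_sup_ball.
apply: le_npoints => //; first by apply: measurable_shift_set; exact: measurable_sup_ball.
move=> y Uy; rewrite /shift_set/= /sup_ball/=.
apply: (@le_trans _ _ 1); last by rewrite ler1n.
apply: norm_le_coord => // i; rewrite !mxE ler_norml.
have /andP[? ?] := Ux i; have /andP[? ?] := Uy i; apply/andP; split; lra.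
Qed.

(** The neighbourhoods of all points of the cube lie in one ball with finitely many points; beyond
    that number the cap is inactive. *)
Lemma capped_pair_count_eq phi : exists k0, forall k, (k0 <= k)%N ->
  weighted_count (capped_npoints k) (@unit_cube R d) phi =
  weighted_count (npoints C) (@unit_cube R d) phi.
Proof.
have := npoints_fin phi (@bounded_sup_ball R d (1 + q)%:R).
move=> /fineK => Nfin; set N := fine _ in Nfin.
exists (Num.truncn N).+1 => k kN; apply: eq_esum => x [px Ux]; rewrite /capped_npoints.
case: ifPn => // /negP[].
apply: (@le_trans _ _ N%:E).
  rewrite Nfin; rewrite npoints_translate; last exact: measurable_sup_ball.
  apply: le_npoints; [by apply: measurable_shift_set; exact: measurable_sup_ball|exact: measurable_sup_ball|].
  move=> y; rewrite /shift_set/= /sup_ball/= => yq; rewrite -(subrK x y) natrD addrC.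
  by rewrite (le_trans (ler_normD _ _))// lerD//; exact: norm_unit_cube.
by rewrite lee_fin (le_trans (ltW (truncnS_gt N)))// ler_nat.
Qed.

End pair_counts.

Section pair_sums.
Context {R : realType} {d : nat} (C : set 'rV[R]_d).
Hypothesis mC : measurable C.
Implicit Types (phi : config R d) (r rho : R).

Lemma le_esum_set (T : choiceType) (A B : set T) (a : T -> \bar R) :
  (forall i, 0 <= a i)%E -> A `<=` B -> (\esum_(i in A) a i <= \esum_(i in B) a i)%E.
Proof.
by move=> a0 AB; rewrite [leRHS](esumID A)// (setIidr AB) leeDl// esum_ge0.
Qed.

Definition pair_sum phi r : \bar R :=
  \esum_(xy in (phi `&` eucl_ball r) `*` (phi `&` eucl_ball r)) \d_(xy.2 - xy.1)%R C.

Lemma pair_sumE phi r : pair_sum phi r =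
  \esum_(x in phi `&` eucl_ball r) \esum_(y in phi `&` eucl_ball r) (\1_C (y - x))%:E.
Proof.
rewrite esum_esum => [|x y _ _]; last by rewrite lee_fin.
by congr esum; apply/seteqP; split.
Qed.

Lemma npoints_translate_esum phi x :
  npoints C (translate x phi) = \esum_(y in phi) (\1_C (y - x))%:E.
Proof.
rewrite npoints_esum// -(setIT (points (translate x phi))) esum_translate.
by rewrite setIT.
Qed.

Lemma pair_sum_le phi r : (pair_sum phi r <= weighted_count (npoints C) (eucl_ball r) phi)%E.
Proof.
rewrite pair_sumE; apply: le_esum => x _; rewrite npoints_translate_esum.
by apply: le_esum_set => [y|]; [rewrite lee_fin|exact: subIsetl].
Qed.

Lemma pair_sum_ge phi r rho : 0 <= rho -> C `<=` eucl_ball rho ->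
  (weighted_count (npoints C) (eucl_ball (r - rho)) phi <= pair_sum phi r)%E.
Proof.
move=> rho0 Crho; rewrite pair_sumE.
apply: (@le_trans _ _ (\esum_(x in phi `&` eucl_ball (r - rho))
    \esum_(y in phi `&` eucl_ball r) (\1_C (y - x))%:E)%E).
  apply: le_esum => x [px xr]; rewrite npoints_translate_esum [leRHS]esum_mkcondr.
  apply: le_esum => y py; case: ifPn => // /negP yr.
  rewrite lee_fin indicE; case: (boolP (_ \in C)) => // /set_mem /Crho yx.
  exfalso; apply: yr; apply/mem_set; move: xr yx; rewrite !eucl_ballE => xr yx.
  rewrite -(subrK x y); apply: le_lt_trans (eucl_normD _ _) _; lra.
apply: le_esum_set => [x|x [px xr]]; first by apply: esum_ge0 => y _; rewrite lee_fin.
by split => //; move: xr; rewrite !eucl_ballE => /lt_le_trans; apply; lra.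
Qed.

Lemma gammaE phi r : 0 < r -> gamma phi r C = ((@ball_vol R d r)^-1%:E * pair_sum phi r)%E.
Proof. by move=> r0; rewrite /gamma lebesgue_eucl_ball. Qed.

End pair_sums.

(** * Almost sure convergence of the pair counts *)

Section pair_ergodic.
Context {R : realType} {d : nat} (mu : probability (config R d) R).
Hypotheses (stat : stationary mu) (erg : ergodic mu).
Hypothesis sq : forall n : nat, (\int[mu]_phi (npoints (sup_ball n%:R) phi ^+ 2) < +oo)%E.
Implicit Types (A B : set 'rV[R]_d) (phi : config R d) (k n : nat).
Local Notation U := (@unit_cube R d).

Definition lattice_shift (z : 'rV[int]_d) phi := translate (lattice_pt z) phi.

Section bounded_window.
Variables (C : set 'rV[R]_d) (q : nat).
Hypotheses (mC : measurable C) (Cq : C `<=` sup_ball q%:R) (q1 : (0 < q)%N).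
Local Notation w := (npoints C : config R d -> \bar R).
Local Notation wk := (capped_npoints C q).

Let mw : measurable_fun setT w. Proof. exact: measurable_npoints. Qed.
Let w0 phi : (0 <= w phi)%E. Proof. exact: npoints_ge0. Qed.
Let mU : measurable U. Proof. exact: measurable_unit_cube. Qed.
Let bU : bounded_set U.
Proof. exact: bounded_subset (@unit_cube_sub_sup_ball R d) (bounded_sup_ball _). Qed.

Lemma mean_pair_count_fin A : measurable A -> bounded_set A -> (mean_count mu w A < +oo)%E.
Proof.
move=> mA /bounded_set_sub_sup_ball[n An].
apply: le_lt_trans (sq (n + q)); apply: ge0_le_integral => //.
- by move=> phi _; exact: weighted_count_ge0.
- exact: measurable_weighted_count.
- have -> : (fun phi : config R d => npoints (sup_ball (n + q)%:R) phi ^+ 2)%E =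
    (fun phi : config R d => npoints (sup_ball (n + q)%:R) phi * npoints (sup_ball (n + q)%:R) phi)%E.
    by apply/funext => phi; rewrite expe2.
  by apply: emeasurable_funM; apply: measurable_npoints; exact: measurable_sup_ball.
- by move=> phi _; apply: pair_count_le.
Qed.

Let lam : R := fine (mean_count mu w U).

Let lamE : mean_count mu w U = lam%:E.
Proof.
rewrite /lam fineK// ge0_fin_numE; first exact: mean_pair_count_fin.
by apply: integral_ge0 => phi _; exact: weighted_count_ge0.
Qed.

Let f phi : R := fine (weighted_count w U phi).
Let fk k phi : R := fine (weighted_count (wk k) U phi).

Let fE phi : (f phi)%:E = weighted_count w U phi.
Proof. by rewrite fineK//; exact: (@pair_count_fin _ _ C q). Qed.

Let wk0 k phi : (0 <= wk k phi)%E. Proof. exact: capped_npoints_ge0. Qed.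
Let mwk k : measurable_fun setT (wk k). Proof. exact: measurable_capped_npoints. Qed.

Let fkE k phi : (fk k phi)%:E = weighted_count (wk k) U phi.
Proof.
rewrite fineK// ge0_fin_numE; last exact: weighted_count_ge0.
by apply: le_lt_trans (capped_pair_count_le mC Cq q1 k phi) _; rewrite ltry.
Qed.

Let mf : measurable_fun setT f.
Proof. by apply: measurableT_comp => //; exact: measurable_weighted_count. Qed.

Let mfk k : measurable_fun setT (fk k).
Proof. by apply: measurableT_comp => //; exact: measurable_weighted_count. Qed.

Let f0 phi : 0 <= f phi.
Proof. by rewrite -lee_fin fE weighted_count_ge0. Qed.

Let fkK k phi : 0 <= fk k phi <= k%:R ^+ 2.
Proof.
by rewrite -!lee_fin fkE weighted_count_ge0//=; exact: capped_pair_count_le.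
Qed.

Let fkf k phi : fk k phi <= f phi.
Proof.
rewrite -lee_fin fE fkE; apply: le_esum => x _; exact: capped_npoints_le.
Qed.

Let Ef : (\int[mu]_phi (f phi)%:E = lam%:E)%E.
Proof. by rewrite -lamE; apply: eq_integral => phi _; rewrite fE. Qed.

Let fk_approx (e : R) : 0 < e -> exists k, (\int[mu]_phi (f phi - fk k phi)%:E <= e%:E)%E.
Proof.
move=> e0.
have cv : (\int[mu]_phi (f phi - fk k phi)%:E)%E @[k --> \oo] --> (\int[mu]_phi (cst 0 phi : \bar R))%E.
  apply: (@dominated_cvg _ _ _ mu setT measurableT (fun k phi => (f phi - fk k phi)%:E) _ (EFin \o f)).
  - by move=> k; apply/measurable_EFinP; exact: measurable_funB.
  - move=> phi _; have [k0 k0P] := capped_pair_count_eq C q phi.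
    apply: cvg_near_cst; near=> k.
    have kk0 : (k0 <= k)%N by near: k; exact: nbhs_infty_ge.
    by rewrite EFinB fkE k0P// -fE -EFinB subrr.
  - by [].
  - apply/integrableP; split; first exact/measurable_EFinP.
    under eq_integral do rewrite gee0_abs ?lee_fin//.
    by rewrite Ef ltry.
  - move=> k phi _; have := fkf k phi; have /andP[? ?] := fkK k phi => ?.
    by rewrite lee_fin ger0_norm; lra.
rewrite integral0 in cv.
have [n _ /(_ n (leqnn n)) h] := cv _ (@open_ereal_lt' R 0%E e%:E ltac:(by rewrite lte_fin)).
by exists n; exact: ltW.
Unshelve. all: by end_near. Qed.

(** Lattice sums over the translate by t are masses of displaced cells under a measure that depends
    on phi alone, so box sums for different t can be compared by inclusion of regions. *)
Let fk_cell k z t phi : (fk k (lattice_shift z (translate t phi)))%:E =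
  weighted_measure (wk0 k) phi (cell z t).
Proof. by rewrite fkE /lattice_shift translate_translate weighted_count_translate. Qed.

Let box_sum_le k n m t phi : `|t| + 1 <= m%:R ->
  box_sum lattice_shift (fk k) n (translate t phi) <=
  box_sum lattice_shift (fk k) (n + m.+1) phi.
Proof.
move=> tm; rewrite /box_sum -lee_fin -!sumEFin -[in leRHS](translate0 phi).
under eq_bigr do rewrite fk_cell.
under [leRHS]eq_bigr do rewrite fk_cell.
rewrite -!measure_cells; apply: le_measure; try by apply/mem_set; exact: measurable_cells.
exact: cells_shift.
Qed.

(** [box_sum_le] is used for t and, from the translate back, for - t. This gives asymptotic
    invariance under all of R^d for sums that run over the lattice only. *)
Let fk_osc k t : exists m, forall n phi,
  `|box_sum lattice_shift (fk k) n (translate t phi) - box_sum lattice_shift (fk k) n phi| <=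
  k%:R ^+ 2 * (beta d (n + m) - beta d n).
Proof.
pose m := (Num.truncn (`|t| + 1)).+1.
have tm : `|t| + 1 <= m%:R by exact/ltW/truncnS_gt.
exists m.+1 => n phi.
have sub : (@box d n `<=` box (n + m.+1))%fset.
  by apply/fsubsetP; apply: box_le; exact: leq_addr.
have := @sum_sub_bounds _ _ (fun z => fk k (lattice_shift z phi)) _ _ _ (fun z => fkK k _) sub.
have := @sum_sub_bounds _ _ (fun z => fk k (lattice_shift z (translate t phi))) _ _ _ (fun z => fkK k _) sub.
have := box_sum_le k n phi tm.
have := @box_sum_le k n m (- t) (translate t phi); rewrite normrN translate_translate addNr translate0 => /(_ tm).
rewrite /box_sum !card_box -!/(beta d _).
set a := \sum_(_ <- _) _; set b := \sum_(_ <- _) _; set c := \sum_(_ <- _) _; set e := \sum_(_ <- _) _.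
by move=> ? ? /andP[? ?] /andP[? ?]; rewrite ler_distl; apply/andP; split; lra.
Qed.

Let measurable_lattice_shift z : measurable_fun setT (lattice_shift z).
Proof. exact: measurable_translate. Qed.

Let lattice_shiftD y z phi : lattice_shift y (lattice_shift z phi) = lattice_shift (y + z) phi.
Proof. by rewrite /lattice_shift translate_translate lattice_ptD. Qed.

Let lattice_average : {ae mu, forall phi,
  (\sum_(z <- lattice_ball r) f (lattice_shift z phi)) / @ball_vol R d r @[r --> +oo] --> lam}.
Proof.
apply: (@pointwise_ergodic _ _ _ _ mu lattice_shift measurable_lattice_shift lattice_shiftD
  (fun z => @stat _) _ _ erg f lam mf f0 Ef fk (fun k => k%:R ^+ 2) mfk fkK fkf fk_approx
  fk_osc (@lattice_ball R d) (@ball_vol R d) (fun m => d%:R * m%:R) (5 ^+ d / @eucl_vol R d)).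
- exact: ball_vol_gt0.
- by move=> m; exact: cvg_card_lattice_ball.
- have := @cvg_card_lattice_ball R d 0; by under eq_fun do rewrite addr0.
- by move=> r m w z; exact: lattice_ball_shift.
- exact: lattice_ball_box.
Qed.

Let lattice_average_shift phi (c : R) :
  (\sum_(z <- lattice_ball r) f (lattice_shift z phi)) / @ball_vol R d r @[r --> +oo] --> lam ->
  ((\sum_(z <- lattice_ball (r + c)) f (lattice_shift z phi)) / @ball_vol R d r)%:E @[r --> +oo]
  --> lam%:E.
Proof.
move=> h; apply: cvg_EFin; first exact: nearW.
have hc : (r + c)%R @[r --> +oo] --> (+oo%R : set_system R).
  apply/cvgryPge => M; near=> r; rewrite -lerBlDr; near: r.
  apply: nbhs_pinfty_ge; exact: num_real.
have hM : ((\sum_(z <- lattice_ball (r + c)) f (lattice_shift z phi)) / @ball_vol R d (r + c) *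
    (@ball_vol R d (r + c) / @ball_vol R d r)) @[r --> +oo] --> (lam * 1 : R).
  by apply: cvgM; [exact: cvg_comp hc h|exact: cvg_ball_vol_ratio].
rewrite mulr1 in hM; apply: cvg_trans hM; apply: near_eq_cvg; near=> r => /=.
rewrite mulrA divfK// gt_eqF// ball_vol_gt0// -ltrBlDr sub0r; near: r.
apply: nbhs_pinfty_gt; exact: num_real.
Unshelve. all: by end_near. Qed.

Let fE_cell z phi : (f (lattice_shift z phi))%:E = weighted_measure w0 phi (cell z 0).
Proof. by rewrite fE /lattice_shift weighted_count_translate /cell addr0. Qed.

Lemma gamma_cvg_bounded : {ae mu, forall phi,
  gamma phi r C @[r --> +oo] --> mean_count mu w U}.
Proof.
rewrite lamE; apply: filterS lattice_average => phi h.
pose rho : R := d%:R * q%:R + 1.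
have Crho : C `<=` eucl_ball rho.
  move=> v /Cq vq; rewrite eucl_ballE (le_lt_trans (eucl_le_norm v))// /rho.
  by rewrite (le_lt_trans (ler_wpM2l _ vq))// ltrDl.
(* Cells of the lattice ball of radius r - rho - d lie in the ball of radius r - rho, and cells of
   the lattice ball of radius r + d cover the ball of radius r. *)
apply: (squeeze_cvge _ (lattice_average_shift (- rho - d%:R) h) (lattice_average_shift d%:R h)).
near=> r.
have r0 : 0 < r by near: r; exact: nbhs_pinfty_gt.
have v0 := @ball_vol_gt0 R d r r0.
rewrite gammaE//.
have iv0 : (0 <= (@ball_vol R d r)^-1%:E)%E by rewrite lee_fin invr_ge0 ltW.
have rho0 : 0 <= rho by rewrite addr_ge0.
apply/andP; split.
- rewrite mulrC EFinM; apply: lee_wpmul2l => //.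
  apply: le_trans (pair_sum_ge mC phi r rho0 Crho); rewrite -sumEFin.
  under eq_bigr do rewrite fE_cell.
  have /andP[_] := lattice_ball_measure (weighted_measure w0 phi) (r + (- rho - d%:R)).
  by rewrite addrA subrK.
- rewrite [in leRHS]mulrC EFinM; apply: lee_wpmul2l => //.
  apply: le_trans (pair_sum_le mC phi r) _; rewrite -sumEFin.
  under eq_bigr do rewrite fE_cell.
  have /andP[+ _] := lattice_ball_measure (weighted_measure w0 phi) (r + d%:R).
  by rewrite addrK.
Unshelve. all: by end_near. Qed.

End bounded_window.

Lemma gamma_cvg (C : set 'rV[R]_d) : measurable C -> bounded_set C -> {ae mu, forall phi,
  gamma phi r C @[r --> +oo] --> mean_count mu (npoints C) U}.
Proof.
move=> mC /bounded_set_sub_sup_ball[q Cq]; apply: (@gamma_cvg_bounded C q.+1) => // v /Cq.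
by rewrite /sup_ball/= => /le_trans; apply; rewrite ler_nat.
Qed.
End pair_ergodic.

(** * Vague convergence *)

Section step_approximation.
Context {dT : measure_display} {T : measurableType dT} {R : realType}.
Variables (m : {measure set T -> \bar R}) (I : Type) (s : seq I) (D : I -> set T).
Hypotheses (mD : forall i, measurable (D i)) (mDfin : forall i, (m (D i) < +oo)%E).
Implicit Types (a : I -> R).

Definition step a x : R := \sum_(i <- s) a i * \1_(D i) x.

Let integrable_ind i : m.-integrable setT (fun x => (\1_(D i) x)%:E).
Proof.
apply/integrableP; split; first by apply/measurable_EFinP; exact: measurable_indic.
under eq_integral do rewrite gee0_abs ?lee_fin//.
by rewrite integral_indic// setIT.
Qed.

Let integrable_term a i : m.-integrable setT (fun x => (a i * \1_(D i) x)%:E).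
Proof.
have -> : (fun x => (a i * \1_(D i) x)%:E) = (fun x => (a i)%:E * (\1_(D i) x)%:E)%E.
  by apply/funext => x; rewrite EFinM.
by apply: integrableZl => //; exact: integrable_ind.
Qed.

Lemma integrable_step a : m.-integrable setT (EFin \o step a).
Proof.
have -> : EFin \o step a = (fun x => \sum_(i <- s) (a i * \1_(D i) x)%R%:E)%E.
  by apply/funext => x; rewrite /= /step -sumEFin.
by apply: integrable_sum => // i _; exact: integrable_term.
Qed.

Lemma integral_step a : (\int[m]_x (step a x)%:E = (\sum_(i <- s) a i * fine (m (D i)))%:E)%E.
Proof.
rewrite /step; under eq_integral do rewrite -sumEFin.
have -> := integral_sum measurableT (integrable_term a) s xpredT.
rewrite -sumEFin; apply: eq_bigr => i _.
under eq_integral do rewrite EFinM.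
rewrite (integralZl measurableT (integrable_ind i)).
by rewrite integral_indic// setIT EFinM fineK// ge0_fin_numE.
Qed.

(** f lies between the steps with coefficients a - e and a + e. The error is a step function rather
    than a constant, which confines f to the cells and makes it integrable even if m has infinite
    total mass. *)
Lemma integral_step_approx (f : T -> R) a e : measurable_fun setT f ->
  (forall x, `|f x - step a x| <= step (fun=> e) x) ->
  exists2 l : R, (\int[m]_x (f x)%:E = l%:E)%E &
    `|l - \sum_(i <- s) a i * fine (m (D i))| <= e * \sum_(i <- s) fine (m (D i)).
Proof.
move=> mf fe.
have stepD b x : step (fun i => a i + b) x = step a x + step (fun=> b) x.
  by rewrite /step -big_split; apply: eq_bigr => i _; rewrite mulrDl.
have stepN x : step (fun=> - e) x = - step (fun=> e) x.
  by rewrite /step -sumrN; apply: eq_bigr => i _; rewrite mulNr.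
have fub x : f x <= step (fun i => a i + e) x.
  by have := fe x; rewrite stepD ler_norml => /andP[? ?]; lra.
have flb x : step (fun i => a i - e) x <= f x.
  by have := fe x; rewrite stepD stepN ler_norml => /andP[? ?]; lra.
have fint : m.-integrable setT (EFin \o f).
  have : m.-integrable setT (fun x => `|(step (fun i => a i + e) x)%:E| + `|(step (fun i => a i - e) x)%:E|)%E.
    by apply: integrableD => //; apply: integrable_abse; exact: integrable_step.
  apply: le_integrable => //; first exact/measurable_EFinP.
  move=> x _; rewrite /= lee_fin [leRHS]ger0_norm ?addr_ge0//.
  have := fub x; have := flb x => h1 h2; rewrite ler_norml; apply/andP; split.
    by have := ler_norm (- step (fun i => a i - e) x); rewrite normrN; have := normr_ge0 (step (fun i => a i + e) x); lra.
  by have := ler_norm (step (fun i => a i + e) x); have := normr_ge0 (step (fun i => a i - e) x); lra.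
have := integrable_fin_num measurableT fint.
have U : (\int[m]_x (f x)%:E <= \int[m]_x (step (fun i => a i + e) x)%:E)%E.
  by apply: le_integral => //; [exact: integrable_step|move=> x _; rewrite lee_fin].
have L : (\int[m]_x (step (fun i => a i - e) x)%:E <= \int[m]_x (f x)%:E)%E.
  by apply: le_integral => //; [exact: integrable_step|move=> x _; rewrite lee_fin].
move: U L; rewrite !integral_step.
case: (\int[m]_x _)%E => // l; rewrite !lee_fin => U L _; exists l => //.
have E b : \sum_(i <- s) (a i + b) * fine (m (D i)) =
    \sum_(i <- s) a i * fine (m (D i)) + b * \sum_(i <- s) fine (m (D i)).
  by rewrite mulr_sumr -big_split; apply: eq_bigr => i _; rewrite mulrDl.
move: U L; rewrite !E mulNr => U L.
by rewrite ler_norml; apply/andP; split; lra.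
Qed.

End step_approximation.

Section vague.
Context {R : realType} {d : nat}.
Implicit Types (f : 'rV[R]_d -> R).

Lemma continuous_rV_measurable f : continuous f -> measurable_fun setT f.
Proof.
move=> cf; apply: (measurability _ (RGenOpens.measurableE R)) => //.
move=> _ [_ [a [b ->] <-]]; rewrite setTI; apply: rV_open_measurable.
by move/continuousP : cf; apply; exact: interval_open.
Qed.

(** Only x is confined to K: the grid corner with which it is compared may lie outside. *)
Lemma compact_uniform_continuity f (K : set 'rV[R]_d) (e : R) : continuous f -> compact K -> 0 < e ->
  exists2 del : R, 0 < del & forall x y, K x -> `|x - y| <= del -> `|f x - f y| <= e.
Proof.
move=> cf cK e0.
have : \forall del \near 0^'+, K `<=` [set x | forall y, `|x - y| <= del -> `|f x - f y| <= e].
  apply: (compact_near_coveringP K).1 => // x Kx.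
  have /cvgrPdist_le/(_ (e / 2)) := cf x; rewrite divr_gt0// => /(_ isT)/nbhs_ballP[eta /= eta0 etaP].
  exists (ball x (eta / 2), [set del | del < eta / 2]).
    split; first by apply: nbhsx_ballx; rewrite divr_gt0.
    by apply: nbhs_right_lt; rewrite divr_gt0.
  move=> [x' del] [/= xx' del2] y x'y.
  rewrite -ball_normE/= in xx'.
  have e1 : `|f x - f x'| <= e / 2 by apply: etaP; rewrite -ball_normE/=; lra.
  have e2 : `|f x - f y| <= e / 2.
    apply: etaP; rewrite -ball_normE/= -(subrK x' x) -addrA.
    by apply: le_lt_trans (ler_normD _ _) _; lra.
  have -> : f x' - f y = (f x - f y) - (f x - f x') by ring.
  by apply: le_trans (ler_normB _ _) _; lra.
move=> h; near (0 : R)^'+ => del; exists del => [//|x y Kx].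
have : K `<=` [set x | forall y, `|x - y| <= del -> `|f x - f y| <= e] by near: del.
by move=> /(_ x Kx); apply.
Unshelve. all: by end_near. Qed.

Definition scaled_cell (j : nat) (z : 'rV[int]_d) : set 'rV[R]_d :=
  [set v | cell z 0 (j.+1%:R *: v)].

Lemma measurable_scaled_cell j z : measurable (scaled_cell j z).
Proof.
have := rV_affine_measurable j.+1%:R (0 : 'rV[R]_d) measurableT (@measurable_cell R d z 0).
rewrite setTI; congr measurable.
by apply/seteqP; split=> v /=; rewrite addr0.
Qed.

Lemma scaled_cellE j z (v : 'rV[R]_d) : scaled_cell j z v <-> z = lattice_floor (j.+1%:R *: v).
Proof. by rewrite -[X in lattice_floor X](subr0 (j.+1%:R *: v)); exact: cellE. Qed.

Lemma scaled_lattice_floor j (v : 'rV[R]_d) :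
  `|v - j.+1%:R^-1 *: lattice_pt (lattice_floor (j.+1%:R *: v))| <= j.+1%:R^-1.
Proof.
have h := norm_unit_cube (sub_lattice_floor (j.+1%:R *: v)).
rewrite -[X in X - _](scalerK (_ : j.+1%:R != 0 :> R))// -scalerBr normrZ ger0_norm//.
by rewrite ler_piMr.
Qed.

Lemma bounded_scaled_cell j z : bounded_set (scaled_cell j z).
Proof.
apply: (@bounded_subset _ _ _ (sup_ball (`|j.+1%:R^-1 *: lattice_pt z| + j.+1%:R^-1))); last exact: bounded_sup_ball.
move=> v /scaled_cellE zE; have := scaled_lattice_floor j v; rewrite -zE => h.
rewrite /sup_ball/= -(subrK (j.+1%:R^-1 *: lattice_pt z) v) addrC.
by rewrite (le_trans (ler_normD _ _))// lerD.
Qed.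

Lemma step_cells j M (a : 'rV[int]_d -> R) (v : 'rV[R]_d) : step (box M) (scaled_cell j) a v =
  if lattice_floor (j.+1%:R *: v) \in box M then a (lattice_floor (j.+1%:R *: v)) else 0 :> R.
Proof.
set z0 := lattice_floor _.
have E z : a z * \1_(scaled_cell j z) v = if z == z0 then a z else 0.
  rewrite indicE; case: eqVneq => [zE|zE].
    by rewrite mem_set ?mulr1//; exact/scaled_cellE.
  rewrite memNset ?mulr0// => /scaled_cellE zE'.
  by rewrite zE' eqxx in zE.
rewrite /step (eq_bigr _ (fun z _ => E z)); case: ifPn => z0M.
  rewrite (big_fsetD1 z0)//= eqxx big_seq big1 ?addr0// => z.
  by rewrite !inE => /andP[/negbTE ->].
rewrite big_seq big1// => z zM; case: eqVneq => // zz0.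
by rewrite -zz0 zM in z0M.
Qed.

(** N is chosen before e, so the cells used at any mesh lie in one fixed ball, whose mass bounds
    theirs independently of e. *)
Lemma compact_support_step f : continuous f -> compact (closure [set x | f x != 0]) ->
  exists N : nat, forall e : R, 0 < e -> exists j M,
    (forall v, `|f v - step (box M) (scaled_cell j)
        (fun z => f (j.+1%:R^-1 *: lattice_pt z)) v| <= step (box M) (scaled_cell j) (fun=> e) v) /\
    (forall v : 'rV[R]_d, lattice_floor (j.+1%:R *: v) \in box M -> sup_ball N%:R v).
Proof.
move=> cf /compact_bounded/bounded_set_sub_sup_ball[N supp].
exists N.+2 => e e0.
have [del del0 uc] := compact_uniform_continuity cf (@compact_sup_ball R d N.+2%:R) e0.
have [j jdel] : exists j : nat, j.+1%:R^-1 < del.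
  by have /ltr_add_invr[k] := del0; rewrite add0r; exists k.
have j0 : 0 < j.+1%:R :> R by [].
have scaled (v : 'rV[R]_d) : `|j.+1%:R *: v - lattice_pt (lattice_floor (j.+1%:R *: v))| <= 1 :> R.
  exact: norm_unit_cube (sub_lattice_floor _).
(* In units of the mesh, floors of points of the support have norm at most N (j + 1) + 1, which this
   radius exceeds or equals; the cells of the box stay in the ball of radius N + 2. *)
exists j, (N.+1 * j.+1)%N.
have inN (v : 'rV[R]_d) : lattice_floor (j.+1%:R *: v) \in box (N.+1 * j.+1) -> sup_ball (N.+2%:R : R) v.
  move=> /norm_lattice_pt => /(_ R) h; rewrite /sup_ball/=.
  rewrite -(ler_pM2l j0) -[leLHS](_ : `|j.+1%:R *: v| = _); last by rewrite normrZ ger0_norm.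
  rewrite -(subrK (lattice_pt (lattice_floor (j.+1%:R *: v))) (j.+1%:R *: v)).
  apply: (le_trans (ler_normD _ _)); apply: (le_trans (lerD (scaled v) h)).
  by rewrite -natrM addrC natr1 ler_nat; lia.
split=> // v; rewrite !step_cells; case: ifPn => vM.
  apply: uc; first exact: inN.
  exact: le_trans (scaled_lattice_floor j v) (ltW jdel).
rewrite subr0 normr_le0; apply: contraNT vM => fv.
have /supp vN : closure [set x | f x != 0] v by exact: subset_closure.
apply: (@lattice_pt_box R).
set z := lattice_floor _.
rewrite -(subKr (j.+1%:R *: v) (lattice_pt z)).
apply: (le_lt_trans (ler_normB _ _)).
have : `|j.+1%:R *: v| <= j.+1%:R * N%:R.
  by rewrite normrZ ger0_norm// ler_pM2l.
have := scaled v; rewrite -/z => h1 h2.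
apply: (le_lt_trans (lerD h2 h1)).
by rewrite -natrM natr1 ltr_nat; lia.
Qed.

(** For given e finitely many cells carry the approximating step function, so convergence on cells
    is enough. The approximation error is proportional to the mass of these cells, which for [m r]
    eventually exceeds the limit mass by at most 1. *)
Lemma vague_cvg_cells (m : R -> {measure set 'rV[R]_d -> \bar R})
    (m0 : {measure set 'rV[R]_d -> \bar R}) :
  (forall r A, m r A \is a fin_num) -> (forall n : nat, (m0 (sup_ball n%:R) < +oo)%E) ->
  (forall j z, m r (scaled_cell j z) @[r --> +oo] --> m0 (scaled_cell j z)) ->
  vague_cvg (fun r => m r) +oo m0.
Proof.
move=> mfin m0fin mcvg f cf /(compact_support_step cf)[N NP].
have mf := continuous_rV_measurable cf.
have mr r j z : (m r (scaled_cell j z) < +oo)%E by rewrite ltey_eq mfin.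
have m0c j z : (m0 (scaled_cell j z) < +oo)%E.
  have [n zn] := bounded_set_sub_sup_ball (bounded_scaled_cell j z).
  apply: le_lt_trans (m0fin n); apply: le_measure => //; apply/mem_set.
    exact: measurable_scaled_cell.
  exact: measurable_sup_ball.
pose A := fine (m0 (sup_ball N%:R)).
have A0 : 0 <= A by exact: fine_ge0.
have sumA j M : (forall v : 'rV[R]_d, lattice_floor (j.+1%:R *: v) \in box M -> sup_ball N%:R v) ->
    \sum_(z <- box M) fine (m0 (scaled_cell j z)) <= A.
  move=> sub; rewrite -lee_fin /A fineK ?ge0_fin_numE// -sumEFin.
  under eq_bigr do rewrite fineK ?ge0_fin_numE//.
  have -> : (\sum_(z <- box M) m0 (scaled_cell j z) =
      m0 (\bigcup_(z in [set` box M]) scaled_cell j z))%E.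
    rewrite measure_fin_bigcup//.
    - by apply/fsbig_seq; exact: fset_uniq.
    - by move=> z w _ _ [v [/scaled_cellE -> /scaled_cellE ->]].
    - by move=> z _; exact: measurable_scaled_cell.
  apply: le_measure.
  - by apply/mem_set; apply: fin_bigcup_measurable => // z _; exact: measurable_scaled_cell.
  - by apply/mem_set; exact: measurable_sup_ball.
  by move=> v [z zM /scaled_cellE zE]; apply: sub; rewrite -zE.
(* One grid, with error 1, shows that all the integrals of f are finite. *)
have [j1 [M1 [st1 _]]] := NP 1 ltr01.
have [l0 l0E _] := integral_step_approx (@measurable_scaled_cell j1) (m0c j1) mf st1.
have /choice[l lE] r : exists l : R, (\int[m r]_x (f x)%:E = l%:E)%E.
  have [l lE _] := integral_step_approx (@measurable_scaled_cell j1) (mr r j1) mf st1.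
  by exists l.
rewrite l0E; under eq_fun do rewrite lE.
apply: cvg_EFin; first exact: nearW.
apply/cvgrPdist_le => e e0.
(* Approximation costs at most e1 A for the limit and e1 (A + 1) for [m r], together e/2; the other
   e/2 is left for the convergence of the cell masses. *)
pose e1 := e / (2 * (2 * A + 1)).
have A1 : 0 < 2 * A + 1 by lra.
have e10 : 0 < e1 by rewrite divr_gt0// mulr_gt0.
have e1E : e1 * (2 * A + 1) = e / 2.
  by rewrite /e1; field; rewrite gt_eqF.
have [j [M [st sub]]] := NP e1 e10.
have sA := sumA _ _ sub.
have [l0' l0E' h0] := integral_step_approx (@measurable_scaled_cell j) (m0c j) mf st.
have -> : l0 = l0' by have := l0E; rewrite l0E' => -[].
have cvgz z : fine (m r (scaled_cell j z)) @[r --> +oo] --> fine (m0 (scaled_cell j z)).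
  by apply: fine_cvg; rewrite fineK ?ge0_fin_numE//; exact: mcvg.
have c1 : \sum_(z <- box M) fine (m r (scaled_cell j z)) @[r --> +oo] -->
    \sum_(z <- box M) fine (m0 (scaled_cell j z)).
  by apply: cvg_big => [|z _]; [exact: add_continuous|exact: cvgz].
pose c z := f (j.+1%:R^-1 *: lattice_pt z).
have c2 : \sum_(z <- box M) c z * fine (m r (scaled_cell j z)) @[r --> +oo] -->
    \sum_(z <- box M) c z * fine (m0 (scaled_cell j z)).
  by apply: cvg_big => [|z _]; [exact: add_continuous|apply: cvgMr; exact: cvgz].
near=> r.
have [l' l'E h] := integral_step_approx (@measurable_scaled_cell j) (mr r j) mf st.
rewrite /=; have -> : l r = l' by have := lE r; rewrite l'E => -[].
have n1 : `|\sum_(z <- box M) fine (m0 (scaled_cell j z)) -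
    \sum_(z <- box M) fine (m r (scaled_cell j z))| <= 1.
  by near: r; move/cvgrPdist_le : c1; apply.
have n2 : `|\sum_(z <- box M) c z * fine (m0 (scaled_cell j z)) -
    \sum_(z <- box M) c z * fine (m r (scaled_cell j z))| <= e / 2.
  by near: r; move/cvgrPdist_le : c2; apply; rewrite divr_gt0.
move: h h0 n1 n2 sA; rewrite -/(c _).
set a := \sum_(z <- _) _; set b := \sum_(z <- _) _.
set a' := \sum_(z <- _) _; set b' := \sum_(z <- _) _.
move=> h h0 n1 n2 sA.
have e1b : e1 * b' <= e1 * A by rewrite ler_wpM2l// ltW.
have e1a : e1 * b <= e1 * (A + 1).
  apply: ler_wpM2l; first exact: ltW.
  by move: n1; rewrite ler_norml => /andP[? _]; lra.
move: h h0 n2; rewrite !ler_norml => /andP[? ?] /andP[? ?] /andP[? ?].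
by apply/andP; split; lra.
Unshelve. all: by end_near. Qed.

End vague.

(** * The set functions [gamma] and [intensity] as measures *)

Section measures.
Context {R : realType} {d : nat}.

(** The ball holds finitely many points, so the bare set function [gamma] coincides with a scaled
    finite sum of Dirac measures. *)
Lemma gamma_measure (phi : config R d) r : exists m : {measure set 'rV[R]_d -> \bar R},
  (forall A, m A \is a fin_num) /\ gamma phi r = m.
Proof.
set S := (phi `&` eucl_ball r) `*` (phi `&` eucl_ball r).
have finS : finite_set S.
  by apply: finite_setX; exact: finite_config_bounded (bounded_eucl_ball r).
have c0 : 0 <= (fine (lebesgue_rV d (eucl_ball r)))^-1 by rewrite invr_ge0 fine_ge0.
pose e : seq ('rV[R]_d * 'rV[R]_d) := fset_set S.
pose p i := nth (0, 0) e i.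
pose m := mscale (NngNum c0) (msum (fun i => dirac ((p i).2 - (p i).1)) (size e)).
exists m; split=> [A|]; first rewrite fin_numM//.
  by apply: (big_ind (fun x : \bar R => x \is a fin_num)) => // x y xf yf; rewrite fin_numD xf.
apply/funext => A; rewrite /gamma /m /mscale /msum/=; congr (_ * _)%E.
rewrite esum_fset// fsbig_finite// -/e (big_nth (0, 0)) big_mkord.
by [].
Qed.

Section intensity_measure.
Variable m : {measure set (config R d) -> \bar R}.

Let intensity0 : intensity m set0 = 0%E.
Proof.
rewrite /intensity integral0_eq// => phi _.
exact: (@measure0 _ _ _ (point_measure phi)).
Qed.

Let intensity_ge0 A : (0 <= intensity m A)%E.
Proof. by apply: integral_ge0 => phi _; exact: npoints_ge0. Qed.

Let intensity_sigma_additive : semi_sigma_additive (intensity m).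
Proof.
move=> F mF tF mUF.
have -> : intensity m (\bigcup_n F n) = (\sum_(n <oo) intensity m (F n))%E.
  rewrite /intensity -integral_nneseries//.
  - apply: eq_integral => phi _.
    exact: (@measure_semi_bigcup _ _ _ (point_measure phi)).
  - by move=> n; exact: measurable_npoints.
by apply: is_cvg_nneseries => n _ _; exact: intensity_ge0.
Qed.

HB.instance Definition _ := isMeasure.Build _ _ _ (intensity m : set 'rV[R]_d -> \bar R)
  intensity0 intensity_ge0 intensity_sigma_additive.

End intensity_measure.
End measures.

(** * The intensity of the Palm measure as the limit *)

Section palm_intensity.
Context {R : realType} {d : nat} {disp : measure_display} {Omega : measurableType disp}.
Variables (P : probability Omega R) (chi : {RV P >-> config R d}) (B : set 'rV[R]_d).
Local Notation mu := (distribution P chi).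
Hypotheses (stat : stationary mu) (erg : ergodic mu) (sq : square_integrable chi).
Hypotheses (mB : measurable B) (B0 : (0 < lebesgue_rV d B < +oo)%E).

Lemma ae_distribution (Q : config R d -> Prop) :
  {ae mu, forall phi, Q phi} -> {ae P, forall w, Q (chi w)}.
Proof.
move=> [N [mN N0 QN]]; exists (chi @^-1` N); split=> //.
  by rewrite -[X in measurable X]setTI; exact: measurable_funPT.
by move=> w /QN.
Qed.

Lemma ae_forall_count dT (T : measurableType dT) (m : {measure set T -> \bar R})
    (I : countType) (Q : I -> T -> Prop) :
  (forall i, {ae m, forall x, Q i x}) -> {ae m, forall x, forall i, Q i x}.
Proof.
move=> aeQ.
have : {ae m, forall x, forall n, if @choice.unpickle I n is Some i then Q i x else True}.
  by apply: ae_foralln => n; case: (choice.unpickle n) => [i|]; [exact: aeQ|exact: aeW].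
by apply: filterS => x h i; have := h (choice.pickle i); rewrite choice.pickleK.
Qed.

Let square_fin (n : nat) : (\int[mu]_phi (npoints (sup_ball n%:R) phi ^+ 2) < +oo)%E.
Proof.
have msq : measurable_fun setT (fun phi : config R d => npoints (sup_ball n%:R) phi ^+ 2)%E.
  have -> : (fun phi : config R d => npoints (sup_ball n%:R) phi ^+ 2)%E =
    (fun phi : config R d => npoints (sup_ball n%:R) phi * npoints (sup_ball n%:R) phi)%E.
    by apply/funext => phi; rewrite expe2.
  by apply: emeasurable_funM; apply: measurable_npoints; exact: measurable_sup_ball.
rewrite ge0_integral_distribution//; last by move=> phi; rewrite expe2 mule_ge0// npoints_ge0.
have /integrableP[_] := sq (@compact_sup_ball R d n%:R).
under eq_integral do rewrite gee0_abs ?expe2 ?mule_ge0 ?npoints_ge0// -expe2.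
by [].
Qed.

(** Campbell's formula factors the mean count over B into its value on the unit cube and |B|, which
    cancels the normalisation of [palm]. *)
Let intensityE (A : set 'rV[R]_d) : measurable A -> bounded_set A ->
  intensity (palm chi B) A = mean_count mu (npoints A) (@unit_cube R d).
Proof.
move=> mA bA; have [q Aq] := bounded_set_sub_sup_ball bA.
rewrite intensity_palm// -/(mean_count mu (npoints A) B).
rewrite (mean_countE stat (measurable_npoints mA) (fun phi => npoints_ge0 phi A) _ mB); last first.
  move=> n; apply: (mean_pair_count_fin square_fin mA Aq).
    exact: measurable_sup_ball.
  exact: bounded_sup_ball.
move: B0; case: (lebesgue_rV d B) => [b| |] /andP[b0 boo] //=.
have {}b0 : 0 < b by rewrite -lte_fin.
by rewrite muleCA -EFinM mulVf ?mule1// gt_eqF.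
Qed.

Let intensity_fin (A : set 'rV[R]_d) : measurable A -> bounded_set A -> (intensity (palm chi B) A < +oo)%E.
Proof.
move=> mA bA; have [q Aq] := bounded_set_sub_sup_ball bA; rewrite intensityE//.
apply: (mean_pair_count_fin square_fin mA Aq); first exact: measurable_unit_cube.
exact: bounded_subset (@unit_cube_sub_sup_ball R d) (bounded_sup_ball _).
Qed.

Lemma intensity_locally_finite : locally_finite_measure (intensity (palm chi B)).
Proof.
move=> K cK; apply: intensity_fin; first exact: compact_rV_measurable.
exact: compact_bounded.
Qed.

Lemma gamma_cvg_intensity (C : set 'rV[R]_d) : measurable C -> bounded_set C ->
  {ae mu, forall phi, gamma phi r C @[r --> +oo] --> intensity (palm chi B) C}.
Proof. by move=> mC bC; rewrite intensityE//; exact: (gamma_cvg stat erg square_fin). Qed.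

Lemma gamma_vague_cvg :
  {ae mu, forall phi, vague_cvg (gamma phi) +oo (intensity (palm chi B))}.
Proof.
have : {ae mu, forall phi, forall jz : nat * 'rV[int]_d,
    gamma phi r (scaled_cell jz.1 jz.2) @[r --> +oo] -->
    intensity (palm chi B) (scaled_cell jz.1 jz.2)}.
  apply: ae_forall_count => -[j z]; apply: gamma_cvg_intensity.
    exact: measurable_scaled_cell.
  exact: bounded_scaled_cell.
apply: filterS => phi cells_cvg.
have /choice[m mP] := @gamma_measure R d phi.
have -> : gamma phi = (fun r => m r) by apply/funext => r; have [] := mP r.
(* [vague_cvg_cells] takes bundled measures, so [palm] is replaced by [palm_measure]; integrals see
   only measurable events, where the two agree. *)
have IE : intensity (palm chi B) = intensity (palm_measure chi B).
  by apply/funext => A; apply: eq_set_function_integral => F; exact: palm_palm_measure.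
rewrite IE; apply: vague_cvg_cells.
- by move=> r A; have [+ _] := mP r; apply.
- move=> n; have := intensity_fin (measurable_sup_ball n%:R) (@bounded_sup_ball _ _ n%:R).
  by rewrite IE.
- move=> j z; have := cells_cvg (j, z); rewrite IE.
  by under eq_fun do rewrite (mP _).2.
Qed.

End palm_intensity.

Theorem theorem1p1 (R : realType) (d : nat)
    (disp : measure_display) (Omega : measurableType disp)
    (P : probability Omega R) (chi : {RV P >-> config R d})
    (B : set 'rV[R]_d) :
  stationary (distribution P chi) ->
  ergodic (distribution P chi) ->
  square_integrable chi ->
  measurable B -> (0 < lebesgue_rV d B < +oo)%E ->
  [/\ locally_finite_measure (intensity (palm chi B)),
      forall C : set 'rV[R]_d, measurable C -> bounded_set C ->
        {ae P, forall w,
          gamma (chi w) r C @[r --> +oo] --> intensity (palm chi B) C} &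
      {ae P, forall w,
        vague_cvg (gamma (chi w)) +oo (intensity (palm chi B))}].
Proof.
move=> stat erg sq mB B0; split.
- exact: intensity_locally_finite.
- by move=> C mC bC; apply: (ae_distribution (gamma_cvg_intensity stat erg sq mB B0 mC bC)).
- exact: (ae_distribution (gamma_vague_cvg stat erg sq mB B0)).
Qed.
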